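(* A strongly continuous semigroup $(T(t))_{t\ge 0}$ on a Banach space $X$ is holomorphic if and only if there is a polynomial $f\in\mathbb{C}[z]$ such that $$\limsup_{t\downarrow 0}\|f(T(t))\|<\|f\|_{\mathbb{D}}.$$
   Context: Banach spaces are complex. For $f\in\mathbb{C}[z]$, $\|f\|_{\mathbb{D}}:=\sup_{|z|\le 1}|f(z)|$. For a bounded operator $S$ and $f(z)=\sum_k a_k z^k$, $f(S)=\sum_k a_k S^k$. A strongly continuous semigroup $(T(t))_{t\ge0}$ is called holomorphic if $T$ has a holomorphic extension to a sector $\{z\in\mathbb{C}\setminus\{0\}:|\arg z|<\delta\}$ for some $\delta\in(0,\frac{\pi}{2}]$.
   Formalization: ''Holomorphic'' additionally requires the extension to be strongly continuous at 0 (T(z)x → x as z → 0) in every smaller sector; with a bare holomorphic extension to the open sector the ''only if'' part is false. *)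

(* Defs.v *)
From mathcomp Require Export all_boot all_order all_algebra.
From mathcomp Require Export all_classical all_reals all_analysis.
From mathcomp Require Export complex.
Set Implicit Arguments.
Unset Strict Implicit.
Unset Printing Implicit Defensive.
Import Order.TTheory GRing.Theory Num.Theory.
Import numFieldNormedType.Exports.
Local Open Scope classical_set_scope.
Local Open Scope ring_scope.

(* On a normed space over R[i] the library norm takes values in the nonnegative
   reals of R[i]; rnorm is the same number seen in R. *)
Definition rnorm (R : realType) (V : normedModType R[i]) (v : V) : R :=
  complex.Re `|v|.

Definition opnorm (R : realType) (X : normedModType R[i]) (S : X -> X) : \bar R :=
  ereal_sup [set (rnorm (S x))%:E | x in [set x : X | `|x| <= 1]].

Definition disk_norm (R : realType) (f : {poly R[i]}) : \bar R :=
  ereal_sup [set (complex.Re `|f.[z]|)%:E | z in [set z : R[i] | `|z| <= 1]].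

Definition poly_op (R : realType) (X : normedModType R[i])
    (f : {poly R[i]}) (S : X -> X) : X -> X :=
  fun x => \sum_(k < size f) f`_k *: iter k S x.

(* Only the values T t with 0 <= t matter. *)
Definition strongly_continuous_semigroup (R : realType)
    (X : normedModType R[i]) (T : R -> {linear X -> X}) : Prop :=
  [/\ forall t : R, 0 <= t -> continuous (T t),
      forall x, T 0 x = x,
      forall (s t : R) x, 0 <= s -> 0 <= t -> T (s + t) x = T s (T t x) &
      forall x, {within `[0, +oo[, continuous (fun t : R => T t x)}].

(* {z <> 0 : |arg z| < delta}, for delta <= pi *)
Definition sector (R : realType) (delta : R) : set R[i] :=
  [set z | exists r theta : R, [/\ 0 < r, `|theta| < delta &
     z = ((r * cos theta) +i* (r * sin theta))%C]].

(* Complex differentiability at every point of the open set U, for the operator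
   norm, of a function with values in the bounded operators. *)
Definition holomorphic_on (R : realType) (X : normedModType R[i])
    (U : set R[i]) (F : R[i] -> {linear X -> X}) : Prop :=
  forall z, U z -> continuous (F z) /\
    exists D : {linear X -> X}, continuous D /\
      opnorm (fun x => h^-1 *: (F (z + h) x - F z x) - D x)
        @[h --> (0 : R[i]^o)^'] --> 0%E.

(* As usual for holomorphic C_0-semigroups, the extension is required to stay
   strongly continuous at 0, where it takes the value T 0 = id, along every
   smaller sector.  This does not follow from holomorphy on the open sector:
   T = \bigoplus_n exp (t n^3 h(S_n)), with S_n the nilpotent shift on C^n and
   h(w) = - (1 - w) / (1 + w), is a contraction C_0-semigroup on a Hilbert space
   which extends holomorphically to Re z > 0, but is unbounded near 0 on every
   sector and satisfies limsup_(t -> 0+) |f(T t)| = |f|_D for all f. *)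
Definition holomorphic_semigroup (R : realType) (X : normedModType R[i])
    (T : R -> {linear X -> X}) : Prop :=
  exists (delta : R) (H : R[i] -> {linear X -> X}),
    [/\ 0 < delta <= pi / 2,
        holomorphic_on (sector delta) H,
        forall (t : R) x, 0 < t -> H (t%:C)%C x = T t x &
        forall (delta' : R) x, 0 < delta' < delta ->
          H z x @[z --> within (sector delta') (nbhs (0 : R[i]^o))] --> x].

(* Main.v *)
(* If T extends holomorphically to a sector, the Cauchy estimate gives
   |T((n+1)t) - T(nt)| <= C/n for small t, so f = z^n (z - 1) with n large has
   limsup |f(T(t))| < 2 = |f(-1)| <= |f|_D.

   Conversely, the hypothesis and the maximum principle give a point z on the unit
   circle such that z - T(t) is invertible, with a uniform bound, for all small t.
   By Dirichlet's theorem every u on the circle has a power u^m close to z with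
   m <= C / |u^p - 1|, for a fixed p; then u^m - T(mt) is invertible and u - T(t)
   divides it.  Partial fractions over p-th roots turn this into Kato's condition
   |(v - T(t))^-1| <= C / |v - 1| for |v| = 1 and 0 < t <= c |v - 1|.  Discrete
   Fourier inversion over the N-th roots of -1, summed by parts twice, gives
   |T(s)(T(h) - 1)| <= C h / s, i.e. the generator A satisfies |A T(s)| <= C / s, and
   the Taylor series \sum_n (ib)^n / n! A^n T(a) then extends T to a + ib in a sector. *)
From HB Require Import structures.
Require Import Defs.
From mathcomp Require Import ring lra zify.
Import Order.TTheory GRing.Theory Num.Theory.
Import numFieldNormedType.Exports.
Local Open Scope classical_set_scope.
Local Open Scope ring_scope.

Set Implicit Arguments.
Unset Strict Implicit.
Unset Printing Implicit Defensive.

(** * Norms *)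

(** No integral occurs. Contour integrals of resolvents become sums over roots of unity or of -1,
    which are polynomial identities in any commutative ring; so the resolvent part is done in an
    abstract ring [B] with a predicate [bdB a K] for norm bounds. The instance is the bicommutant of
    the semigroup, which is commutative and yet contains the inverses of its elements.

    The obstacle to Dirichlet's theorem is roots of unity of small order: the powers of u = -1 never
    approach z = i. Therefore v - T(t) is treated as v - T(t/p)^p, and the points u are the p-th
    roots of v. They all satisfy u^p = v, so the bound m <= C / |v - 1| is common to them, and m t /
    p stays small as soon as t <= c |v - 1|.

    Two summations by parts are needed: the terms are merely bounded; one difference gains |v -
    1|^-1 / N, whose sum leaves a logarithm; two gain |v - 1|^-2 / N^2, and the sum of |v - 1|^-2
    over the N-th roots v of -1 is exactly N^2 / 4. *)

Section Norms.
Context {R : realType}.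
Local Notation C := R[i].

Definition cabs (c : C) : R := complex.Re `|c|.

Lemma cabsE (c : C) : `|c| = ((cabs c)%:C)%C.
Proof. by rewrite /cabs normc_def. Qed.

Lemma cabs_sqrt (c : C) : cabs c = Num.sqrt (complex.Re c ^+ 2 + complex.Im c ^+ 2).
Proof. by rewrite /cabs normc_def. Qed.

Lemma cabs_ge0 (c : C) : 0 <= cabs c.
Proof. by rewrite cabs_sqrt sqrtr_ge0. Qed.

Lemma sqr_cabs (c : C) : cabs c ^+ 2 = complex.Re c ^+ 2 + complex.Im c ^+ 2.
Proof. by rewrite cabs_sqrt sqr_sqrtr// addr_ge0// sqr_ge0. Qed.

Lemma cabsM (c d : C) : cabs (c * d) = cabs c * cabs d.
Proof. by apply: (@complexI R); rewrite rmorphM/= -!cabsE normrM. Qed.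

Lemma cabs1 : cabs 1 = 1.
Proof. by apply: (@complexI R); rewrite -cabsE normr1. Qed.

Lemma cabs0 : cabs 0 = 0.
Proof. by apply: (@complexI R); rewrite -cabsE normr0. Qed.

Lemma cabsN (c : C) : cabs (- c) = cabs c.
Proof. by rewrite /cabs normrN. Qed.

Lemma cabsB (c d : C) : cabs (c - d) = cabs (d - c).
Proof. by rewrite /cabs distrC. Qed.

Lemma ler_cabsD (c d : C) : cabs (c + d) <= cabs c + cabs d.
Proof. by rewrite -lecR rmorphD/= -!cabsE ler_normD. Qed.

Lemma ler_cabsB (c d : C) : cabs (c - d) <= cabs c + cabs d.
Proof. by rewrite -(cabsN d) ler_cabsD. Qed.

Lemma ler_cabs_subr (c d : C) : cabs c - cabs d <= cabs (c - d).
Proof. by rewrite lerBlDr; have := ler_cabsD (c - d) d; rewrite subrK. Qed.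

Lemma cabsX (c : C) n : cabs (c ^+ n) = cabs c ^+ n.
Proof. by elim: n => [|n ih]; rewrite ?expr0 ?cabs1// !exprS cabsM ih. Qed.

Lemma cabsV (c : C) : cabs c^-1 = (cabs c)^-1.
Proof. by apply: (@complexI R); rewrite fmorphV/= -!cabsE normfV. Qed.

Lemma cabs_eq0 (c : C) : (cabs c == 0) = (c == 0).
Proof. by rewrite -(normr_eq0 c) cabsE eq_complex/= eqxx andbT. Qed.

Lemma cabs_gt0 (c : C) : (0 < cabs c) = (c != 0).
Proof. by rewrite lt_def cabs_ge0 andbT cabs_eq0. Qed.

Lemma cabs_nat n : cabs n%:R = n%:R.
Proof. by apply: (@complexI R); rewrite -cabsE normr_nat rmorph_nat. Qed.

Lemma cabs_real (x : R) : cabs (x%:C)%C = `|x|.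
Proof. by rewrite cabs_sqrt/= expr0n addr0 sqrtr_sqr. Qed.

Lemma cabs_sum (I : Type) (r : seq I) (P : pred I) (F : I -> C) :
  cabs (\sum_(i <- r | P i) F i) <= \sum_(i <- r | P i) cabs (F i).
Proof.
elim/big_ind2 : _ => [|c x d y cx dy|//]; first by rewrite cabs0.
by rewrite (le_trans (ler_cabsD _ _))// lerD.
Qed.

Lemma ler_Re_cabs (c : C) : `|complex.Re c| <= cabs c.
Proof.
by rewrite -[leLHS]sqrtr_sqr cabs_sqrt ler_wsqrtr// lerDl sqr_ge0.
Qed.

Lemma ler_Im_cabs (c : C) : `|complex.Im c| <= cabs c.
Proof.
by rewrite -[leLHS]sqrtr_sqr cabs_sqrt ler_wsqrtr// lerDr sqr_ge0.
Qed.

Lemma ler_cabs_ReIm (c : C) : cabs c <= `|complex.Re c| + `|complex.Im c|.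
Proof.
rewrite {1}(complexE c) (le_trans (ler_cabsD _ _))// cabsM !cabs_real.
suff -> : cabs ('i%C : C) = 1 by rewrite mul1r.
by rewrite cabs_sqrt/= expr0n add0r expr1n sqrtr1.
Qed.

Context {X : normedModType C}.
Implicit Types x y : X.
Local Notation N := (@rnorm R X).

Lemma rnormE x : `|x| = ((N x)%:C)%C.
Proof.
by rewrite [LHS]complexE /rnorm (ger0_Im (normr_ge0 x)) mulr0 addr0.
Qed.

Lemma rnorm_ge0 x : 0 <= N x.
Proof. by rewrite -ler0c -rnormE. Qed.

Lemma rnorm0 : N 0 = 0.
Proof. by rewrite /rnorm normr0. Qed.

Lemma rnormN x : N (- x) = N x.
Proof. by rewrite /rnorm normrN. Qed.

Lemma rnormB x y : N (x - y) = N (y - x).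
Proof. by rewrite /rnorm distrC. Qed.

Lemma ler_rnormD x y : N (x + y) <= N x + N y.
Proof. by rewrite -lecR rmorphD/= -!rnormE ler_normD. Qed.

Lemma ler_rnormB x y : N (x - y) <= N x + N y.
Proof. by rewrite -(rnormN y) ler_rnormD. Qed.

Lemma ler_rnorm_subr x y : N x - N y <= N (x - y).
Proof. by rewrite lerBlDr; have := ler_rnormD (x - y) y; rewrite subrK. Qed.

Lemma ler_rnorm_dist x y z : N (x - z) <= N (x - y) + N (y - z).
Proof. by have := ler_rnormD (x - y) (y - z); rewrite addrA subrK. Qed.

Lemma rnormZ c x : N (c *: x) = cabs c * N x.
Proof. by apply: (@complexI R); rewrite rmorphM/= -rnormE -cabsE normrZ rnormE. Qed.

Lemma rnorm_eq0 x : (N x == 0) = (x == 0).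
Proof. by rewrite -(normr_eq0 x) rnormE eq_complex/= eqxx andbT. Qed.

Lemma rnorm_gt0 x : (0 < N x) = (x != 0).
Proof. by rewrite lt_def rnorm_ge0 andbT rnorm_eq0. Qed.

Lemma rnorm_sum (I : Type) (r : seq I) (P : pred I) (F : I -> X) :
  N (\sum_(i <- r | P i) F i) <= \sum_(i <- r | P i) N (F i).
Proof.
elim/big_ind2 : _ => [|c x d y cx dy|//]; first by rewrite rnorm0.
by rewrite (le_trans (ler_rnormD _ _))// lerD.
Qed.

Lemma rnorm_le0_eq x y : (forall e : R, 0 < e -> N (x - y) <= e) -> x = y.
Proof.
move=> h; apply/eqP; rewrite -subr_eq0 -rnorm_eq0 eq_le rnorm_ge0 andbT.
by apply/ler_addgt0Pr => e e0; rewrite add0r h.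
Qed.

Lemma cvg_rnormP {T : Type} (F : set_system T) {FF : Filter F} (f : T -> X) y :
  f x @[x --> F] --> y <->
  forall e : R, 0 < e -> \forall x \near F, N (y - f x) < e.
Proof.
split => [/cvgrPdist_lt h e e0|h].
  have := h (e%:C)%C; rewrite ltcR => /(_ e0).
  by apply: filterS => x; rewrite rnormE ltcR.
apply/cvgrPdist_lt => e e0.
have ee : e = ((complex.Re e)%:C)%C.
  by rewrite [LHS]complexE (ger0_Im (ltW e0)) mulr0 addr0.
have e1 : 0 < complex.Re e by move: e0; rewrite ee ltcR.
by have := h _ e1; apply: filterS => x; rewrite rnormE ee ltcR.
Qed.

End Norms.

Section Complete.
Context {R : realType} {X : completeNormedModType R[i]}.
Local Notation N := (@rnorm R X).

(** The modulus [e] survives in the limit, so that limits in [X] come with their rate of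
    convergence. *)
Lemma seq_complete (u : nat -> X) (e : nat -> R) :
  (forall n m, (n <= m)%N -> N (u m - u n) <= e n) ->
  (forall d : R, 0 < d -> exists n, e n < d) ->
  exists l, forall n, N (l - u n) <= e n.
Proof.
move=> ue e0.
have cu : cauchy (u @ \oo).
  apply/cauchy_exP => d d0.
  have d1 : d = ((complex.Re d)%:C)%C.
    by rewrite [LHS]complexE (ger0_Im (ltW d0)) mulr0 addr0.
  move: (d0); rewrite d1 ltcR => {}d0; have [n nd] := e0 _ d0.
  exists (u n); exists n => // m /= nm; rewrite -ball_normE/= rnormE ltcR.
  by rewrite rnormB (le_lt_trans _ nd)// ue.
have cvu : cvg (u @ \oo) by exact: cauchy_cvg.
have {cvu} [l ul] : exists l : X, u x @[x --> \oo] --> l by exists (lim (u @ \oo)).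
exists l => n; apply/ler_addgt0Pr => d d0.
have /cvg_rnormP/(_ _ d0) := ul; move=> [m _ h].
rewrite (le_trans (ler_rnorm_dist _ (u (maxn n m)) _))// addrC lerD//.
  by rewrite ue// leq_maxl.
by apply/ltW/h => /=; rewrite leq_maxr.
Qed.

End Complete.

Lemma expr_small {R : realType} (q K d : R) : 0 <= q < 1 -> 0 < d -> exists n, K * q ^+ n < d.
Proof.
move=> /andP[q0 q1] d0.
have qc : (K * q ^+ n) @[n --> \oo] --> (0 : R).
  rewrite -(mulr0 K); apply: cvgM; first exact: cvg_cst.
  by apply: cvg_expr; rewrite ger0_norm.
have /cvgrPdist_lt/(_ _ d0)[n _ h] := qc.
exists n; have := h n (leqnn n); rewrite sub0r normrN; apply: le_lt_trans.
exact: ler_norm.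
Qed.

Lemma inv_small {R : realType} (K d : R) : 0 < d -> exists n : nat, K / n.+1%:R < d.
Proof.
move=> d0; exists (Num.truncn (K / d)).
rewrite ltr_pdivrMr// mulrC -ltr_pdivrMr//.
exact: truncnS_gt.
Qed.

Section Bounded.
Context {R : realType} {X : normedModType R[i]}.
Local Notation N := (@rnorm R X).
Implicit Types f g : X -> X.

Definition bd f (K : R) := forall x, N (f x) <= K * N x.

Lemma bd_le f K L : bd f K -> K <= L -> bd f L.
Proof. by move=> fK KL x; rewrite (le_trans (fK x))// ler_wpM2r// rnorm_ge0. Qed.

Lemma bd_comp f g K L : 0 <= K -> bd f K -> bd g L -> bd (f \o g) (K * L).
Proof.
by move=> K0 fK gL x; rewrite (le_trans (fK _))//= -mulrA ler_wpM2l.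
Qed.

Lemma bd_opnorm (f : {linear X -> X}) K :
  0 <= K -> bd f K <-> (opnorm f <= K%:E)%E.
Proof.
move=> K0; split=> [fK|h x].
  apply: ge_ereal_sup => _ [x/= x1 <-]; rewrite lee_fin (le_trans (fK x))//.
  by rewrite ler_piMr//; move: x1; rewrite rnormE -[1]/(1%:C)%C lecR.
have [->|x0] := eqVneq x 0; first by rewrite linear0 rnorm0 mulr0.
have nx0 : 0 < N x by rewrite rnorm_gt0.
have hx : ((N (f ((((N x)^-1)%:C)%C *: x)))%:E <= opnorm f)%E.
  apply: ereal_sup_ubound; exists ((((N x)^-1)%:C)%C *: x) => //=.
  rewrite rnormE -[1]/(1%:C)%C lecR rnormZ cabs_real gtr0_norm ?invr_gt0//.
  by rewrite mulVf ?gt_eqF.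
have := le_trans hx h; rewrite lee_fin linearZ/= rnormZ cabs_real gtr0_norm ?invr_gt0//.
by rewrite mulrC ler_pdivrMr.
Qed.

Lemma bd_continuous (f : {linear X -> X}) K : bd f K -> continuous f.
Proof.
move=> fK x; apply/cvg_rnormP => e e0.
have K0 : 0 < `|K| + 1 by rewrite ltr_wpDl.
have : (fun y => y) y @[y --> x] --> x by [].
move=> /cvg_rnormP/(_ _ (divr_gt0 e0 K0)); apply: filterS => y h.
rewrite -linearB (le_lt_trans (fK _))// (@le_lt_trans _ _ ((`|K| + 1) * N (x - y)))//.
  by rewrite ler_wpM2r ?rnorm_ge0// ler_wpDr// ler_norm.
by rewrite mulrC -ltr_pdivlMr.
Qed.

Lemma continuous_bd (f : {linear X -> X}) : continuous f -> exists2 K, 0 <= K & bd f K.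
Proof.
move=> cf; have /cvg_rnormP/(_ 1 ltr01) := cf 0.
rewrite linear0 => /nbhs_ballP[d/= d0 h].
have ed : d = ((complex.Re d)%:C)%C.
  by rewrite [LHS]complexE (ger0_Im (ltW d0)) mulr0 addr0.
move: d0 h; rewrite ed ltcR; set r := complex.Re d => r0 h.
exists (2 / r); first by rewrite divr_ge0 ?ltW.
move=> x; have [->|x0] := eqVneq x 0; first by rewrite linear0 rnorm0 mulr0.
have nx0 : 0 < N x by rewrite rnorm_gt0.
have p0 : 0 < r / 2 / N x by rewrite !divr_gt0.
have hx : N (f (((r / 2 / N x)%:C)%C *: x)) < 1.
  rewrite -rnormN -sub0r; apply: h; rewrite -ball_normE/= sub0r normrN rnormE.
  rewrite rnormZ cabs_real gtr0_norm// ltcR mulfVK ?gt_eqF//.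
  by rewrite ltr_pdivrMr// ltr_pMr// ltr1n.
move: hx; rewrite linearZ/= rnormZ cabs_real gtr0_norm// => /ltW.
rewrite mulrAC ler_pdivrMr// mul1r mulrC -ler_pdivlMr ?divr_gt0// => /le_trans; apply.
by rewrite invf_div mulrC.
Qed.

End Bounded.

Lemma eq_ler {R : realType} (x y : R) : x = y -> x <= y.
Proof. by move->. Qed.

Lemma mul_div_succ_le {R : realType} (c a : R) : 0 <= c -> 0 <= a -> c * (a / (c + 1)) <= a.
Proof.
move=> c0 a0; have c1 : 0 < c + 1 by rewrite ltr_wpDl.
by rewrite mulrCA ler_piMr// ler_pdivrMr// mul1r lerDl.
Qed.

(** * Uniform boundedness and the Neumann series *)

Section GeomTail.
Context {R : realType} {X : normedModType R[i]}.
Local Notation N := (@rnorm R X).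

Lemma geometric_tail (u : nat -> X) (K q : R) : 0 <= K -> 0 <= q < 1 ->
  (forall n, N (u n.+1 - u n) <= K * q ^+ n) ->
  forall n m, (n <= m)%N -> N (u m - u n) <= K / (1 - q) * q ^+ n.
Proof.
move=> K0 /andP[q0 q1] h n m nm; have q10 : 0 < 1 - q by rewrite subr_gt0.
(* Keeping the subtracted [q ^+ m] makes the induction on [m - n] close exactly. *)
suff : N (u m - u n) <= K / (1 - q) * (q ^+ n - q ^+ m).
  move=> /le_trans; apply; rewrite ler_wpM2l ?divr_ge0 ?(ltW q10)//.
  by rewrite gerBl exprn_ge0.
rewrite -(subnK nm); elim: (m - n)%N => [|k ih].
  by rewrite add0n !subrr rnorm0 mulr0.
rewrite addSn (le_trans (ler_rnorm_dist _ (u (k + n)%N) _))//.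
apply: (le_trans (lerD (h _) ih)); rewrite exprS.
have := divfK (lt0r_neq0 q10) K; set c := K / (1 - q) => <-.
by apply: eq_ler; ring.
Qed.

End GeomTail.

Section BanachSteinhaus.
Context {R : realType} {X : completeNormedModType R[i]}.
Local Notation N := (@rnorm R X).

(** The supremum over the unit ball is a bound and is attained up to a factor 2; a zero supremum is
    treated apart because [sup_adherent] needs a positive margin. *)
Lemma almost_norming (f : {linear X -> X}) : (exists K, bd f K) ->
  exists K u, [/\ 0 <= K, bd f K, N u <= 1 & K <= 2 * N (f u)].
Proof.
move=> [K0 fK0]; pose S := [set N (f u) | u in [set u | N u <= 1]].
have S0 : S 0 by exists 0 => //=; rewrite ?linear0 rnorm0.
have hS : has_sup S.
  split; first by exists 0.
  exists `|K0| => _ [u/= u1 <-]; rewrite (le_trans (fK0 u))//.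
  rewrite (le_trans (ler_wpM2r (rnorm_ge0 _) (ler_norm K0)))//.
  by rewrite ler_piMr.
have supS0 : 0 <= sup S by exact: ub_le_sup (proj2 hS) _ S0.
have bS : bd f (sup S).
  apply/bd_opnorm => //; apply: ge_ereal_sup => _ [x/= x1 <-]; rewrite lee_fin.
  apply: ub_le_sup (proj2 hS) _ _; exists x => //=.
  by move: x1; rewrite rnormE -[1]/(1%:C)%C lecR.
have [|s0] := leP (sup S) 0.
  move=> s0; exists (sup S), 0; split => //; first by rewrite rnorm0.
  by rewrite linear0 rnorm0 mulr0.
have [_ [u/= u1 <-] hu] := sup_adherent (divr_gt0 s0 (ltr0n R 2)) hS.
by exists (sup S), u; split => //; lra.
Qed.

(* Gliding hump: either [x] or [x + 9^-n u_n] sees a quarter of the norm of the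
   n-th operator, and all the later corrections cannot undo this. *)
Lemma uniform_boundedness (I : Type) (F : I -> {linear X -> X}) :
  (forall i, exists K, bd (F i) K) ->
  (forall x, exists K, forall i, N (F i x) <= K) ->
  exists2 K, 0 <= K & forall i, bd (F i) K.
Proof.
move=> bF pF; apply: contrapT => hN.
have {hN}hN (K : R) : 0 <= K -> exists i, ~ bd (F i) K.
  by move=> K0; apply: contrapT => /forallNP h; apply: hN; exists K => // i; apply: contrapT (h i).
(* With ratio 1/9 the corrections after the n-th add up to at most 9^-n / 8, so of the quarter of
   [K n] 9^-n seen by the n-th operator an eighth survives; the threshold 8 n 9^n turns this eighth
   into n. *)
have step (n : nat) : exists p : I * R * X, [/\ bd (F p.1.1) p.1.2, N p.2 <= 1,
    p.1.2 <= 2 * N (F p.1.1 p.2) & 8 * n%:R * 9 ^+ n <= p.1.2].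
  have [|i hi] := hN (8 * n%:R * 9 ^+ n); first by rewrite !mulr_ge0// exprn_ge0.
  have [K [u [K0 FK u1 Ku]]] := almost_norming (bF i).
  exists (i, K, u); split => //=; rewrite leNgt; apply/negP => hK; apply: hi.
  exact: bd_le FK (ltW hK).
have [p hp] := choice step.
pose f n := F (p n).1.1; pose K n := (p n).1.2; pose v n := (p n).2.
pose q : R := 9^-1.
have q0 : 0 < q by rewrite invr_gt0.
pose fix x n := if n is n'.+1 then
   if `[< K n' * q ^+ n' / 4 <= N (f n' (x n')) >] then x n'
   else x n' + ((q ^+ n')%:C)%C *: v n' else 0.
have qn n : cabs ((q ^+ n)%:C)%C = q ^+ n by rewrite cabs_real gtr0_norm// exprn_gt0.
have xS n : N (x n.+1 - x n) <= 1 * q ^+ n.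
  rewrite /=; case: asboolP => _; first by rewrite subrr rnorm0 mul1r exprn_ge0// ltW.
  rewrite addrC addKr rnormZ qn mul1r ler_piMr//; first by rewrite exprn_ge0// ltW.
  by have [] := hp n.
have fx n : K n * q ^+ n / 4 <= N (f n (x n.+1)).
  rewrite /=; case: asboolP => // /negP; rewrite -ltNge => h.
  have [_ _ hK _] := hp n.
  rewrite linearD linearZ/= addrC -[X in _ + X]opprK.
  apply: le_trans (ler_rnorm_subr _ _).
  rewrite rnormN rnormZ qn; rewrite -/(f n) -/(K n) -/(v n) in hK.
  have := ler_wpM2l (exprn_ge0 n (ltW q0)) hK; lra.
have q1 : 0 <= q < 1 by rewrite ltW//= invf_lt1// ltr1n.
have [l hl] := seq_complete (geometric_tail ler01 q1 xS)
  (fun d d0 => expr_small (1 / (1 - q)) q1 d0).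
have [B hB] := pF l.
have B0 : 0 <= B by rewrite (le_trans _ (hB (p 0%N).1.1))// rnorm_ge0.
pose n := (Num.truncn B).+1.
have := hB (p n).1.1; apply/negP; rewrite -ltNge; rewrite -/(f n).
have [fK _ _ nK] := hp n; rewrite -/(K n) -/(f n) in fK nK.
have h1 : N (f n (l - x n.+1)) <= K n * (q ^+ n / 8).
  have K0 : 0 <= K n by rewrite (le_trans _ nK)// !mulr_ge0// exprn_ge0.
  apply: (le_trans (fK _)); rewrite ler_wpM2l//.
  rewrite (le_trans (hl _))// exprS /q.
  by apply: eq_ler; field.
have h2 : n%:R <= K n * q ^+ n / 8.
  rewrite ler_pdivlMr// /q exprVn ler_pdivlMr ?exprn_gt0//.
  by rewrite (mulrC n%:R).
have h3 : B < n%:R by exact: truncnS_gt.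
apply: (lt_le_trans h3); apply: (le_trans h2).
have -> : l = x n.+1 - (x n.+1 - l) by rewrite subKr.
rewrite linearB; apply: le_trans (ler_rnorm_subr _ _).
have := fx n; move: h1; rewrite -opprB linearN rnormN; lra.
Qed.

End BanachSteinhaus.

Section Neumann.
Context {R : realType} {X : completeNormedModType R[i]}.
Local Notation N := (@rnorm R X).

(** Only the right inverse is computed from partial sums. Linearity and the left inverse follow from
    uniqueness of the solution of [y - f y = x]. *)
Lemma neumann (f : {linear X -> X}) (q : R) : 0 <= q < 1 -> bd f q ->
  exists g : X -> X, [/\ linear g, forall x, g (x - f x) = x,
    forall x, g x - f (g x) = x & bd g (1 - q)^-1].
Proof.
move=> /[dup] q01 /andP[q0 q1] fq; have q10 : 0 < 1 - q by rewrite subr_gt0.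
have fk k x : N (iter k f x) <= q ^+ k * N x.
  elim: k => [|k ih]; first by rewrite expr0 mul1r.
  rewrite exprS -mulrA (le_trans (fq _))// ler_wpM2l//.
pose s x n := \sum_(k < n) iter k f x.
have hs x : exists l, forall n, N (l - s x n) <= N x / (1 - q) * q ^+ n.
  apply: seq_complete => [|d d0]; last exact: expr_small.
  apply: geometric_tail => //; first exact: rnorm_ge0.
  by move=> n; rewrite /s big_ord_recr/= addrAC subrr add0r mulrC.
have [g hg] := choice hs.
have sS x n : s x n.+1 = x + f (s x n).
  rewrite /s big_ord_recl/= linear_sum; congr (_ + _).
have inj y : y = f y -> y = 0.
  move=> yf; apply/eqP; rewrite -rnorm_eq0 eq_le rnorm_ge0 andbT.
  have := fq y; rewrite -yf -subr_le0 -{1}(mul1r (N y)) -mulrBl.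
  by rewrite pmulr_rle0.
have gr x : g x - f (g x) = x.
  apply: rnorm_le0_eq => e e0.
  have [n hn] := expr_small (2 * (N x / (1 - q))) q01 e0.
  rewrite (le_trans _ (ltW hn))//.
  have -> : g x - f (g x) - x = (g x - s x n.+1) - f (g x - s x n).
    by rewrite sS linearB/= opprB opprD !addrA addrNK addrAC.
  apply: (le_trans (ler_rnormB _ _)); rewrite -mulrA mulr2n mulrDl mul1r lerD//.
    apply: (le_trans (hg _ _)); rewrite exprS ler_wpM2l//.
      by rewrite divr_ge0 ?rnorm_ge0 ?(ltW q10).
    by rewrite ler_piMl ?exprn_ge0 ?(ltW q1).
  apply: (le_trans (fq _)); rewrite -[leRHS]mul1r ler_pM ?rnorm_ge0 ?(ltW q1)//.
have uniq x y : y - f y = x -> y = g x.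
  move=> yx; apply/eqP; rewrite -subr_eq0; apply/eqP/inj; rewrite linearB.
  have e1 : y = x + f y by rewrite -[in LHS](subrK (f y) y) yx.
  have e2 : g x = x + f (g x) by rewrite -[in LHS](subrK (f (g x)) (g x)) gr.
  by rewrite [in LHS]e1 [X in _ - X = _]e2 opprD addrACA subrr add0r.
exists g; split => //.
- move=> c x y; apply/esym/uniq; rewrite linearD linearZ/=.
  by rewrite opprD addrACA -scalerBr !gr.
- by move=> x; apply/esym/uniq.
- move=> x; rewrite mulrC ler_pdivlMr//.
  have := ler_rnorm_subr (g x) (f (g x)); rewrite gr.
  have := fq (g x); lra.
Qed.

End Neumann.

(** * Goursat and the Cauchy estimate *)

Section MidpointSums.
Context {R : realType} {X : lmodType R[i]}.
Local Notation C := R[i].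
Implicit Types (g : C -> X) (p q w a : C).

(* Dyadic midpoint sums stand in for path integrals: being additive under bisection and
   exact on affine functions is all that Goursat's argument needs. *)
Fixpoint midpoint_sum n p q g : X :=
  if n is n'.+1 then midpoint_sum n' p ((p + q) / 2) g + midpoint_sum n' ((p + q) / 2) q g
  else (q - p) *: g ((p + q) / 2).

Lemma midpoint_sum_sym n p q g : midpoint_sum n q p g = - midpoint_sum n p q g.
Proof.
elim: n p q => [|n ih] p q /=.
  by rewrite (addrC q) -scaleNr opprB.
rewrite (addrC q); set m := _ / _.
by rewrite (ih m q) (ih p m) -opprD addrC.
Qed.

Lemma midpoint_sumB n p q g h :
  midpoint_sum n p q (fun z => g z - h z) = midpoint_sum n p q g - midpoint_sum n p q h.
Proof.
elim: n p q => [|n ih] p q /=; first by rewrite scalerBr.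
by rewrite !ih opprD addrACA.
Qed.

Lemma midpoint_sum_affine n p q (c d : X) :
  midpoint_sum n p q (fun z => c + z *: d) = (q - p) *: c + ((q ^+ 2 - p ^+ 2) / 2) *: d.
Proof.
elim: n p q => [|n ih] p q /=.
  rewrite scalerDr scalerA; congr (_ + _ *: _); by field.
rewrite !ih [LHS]addrACA -[X in X + _]scalerDl -[X in _ + X]scalerDl; congr (_ *: _ + _ *: _); by field.
Qed.

(** The counterclockwise boundary of the square with corner [w] and side vector [a]. As [a] is
    complex, multiplying it by powers of i gives the four squares around [w]. *)
Definition boundary_sum n w a g := midpoint_sum n w (w + a) g + midpoint_sum n (w + a) (w + a + 'i%C * a) g
  + midpoint_sum n (w + a + 'i%C * a) (w + 'i%C * a) g + midpoint_sum n (w + 'i%C * a) w g.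

Lemma boundary_sumB n w a g h : boundary_sum n w a (fun z => g z - h z) = boundary_sum n w a g - boundary_sum n w a h.
Proof. by rewrite /boundary_sum !midpoint_sumB !opprD [LHS](AC (2*2*2*2) (1*3*5*7*(2*4*6*8)))/=. Qed.

Lemma boundary_sum_affine n w a (c d : X) : boundary_sum n w a (fun z => c + z *: d) = 0.
Proof.
rewrite /boundary_sum !midpoint_sum_affine.
have scDl (u1 v1 u2 v2 : C) : (u1 *: c + v1 *: d) + (u2 *: c + v2 *: d)
    = (u1 + u2) *: c + (v1 + v2) *: d by rewrite addrACA !scalerDl.
rewrite !scDl; set u := (X in X *: c + _); set v := (X in _ + X *: d).
have -> : u = 0 by rewrite /u; ring.
have -> : v = 0 by rewrite /v; field.
by rewrite !scale0r addr0.
Qed.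

(** An identity, not a limit: at level [n.+1] each edge splits at its midpoint into two edges of
    level [n], and the inner edges of the quarters cancel. *)
Lemma boundary_sum_split n w a g : boundary_sum n.+1 w a g =
  boundary_sum n w (a / 2) g + boundary_sum n (w + a / 2) (a / 2) g
  + boundary_sum n (w + a / 2 + 'i%C * (a / 2)) (a / 2) g + boundary_sum n (w + 'i%C * (a / 2)) (a / 2) g.
Proof.
rewrite /boundary_sum /=.
pose h := a / 2; have -> : a / 2 = h by [].
have -> : a = h + h by rewrite /h; field.
have -> : (w + (w + (h + h))) / 2 = w + h by field.
have -> : (w + (h + h) + (w + (h + h) + 'i%C * (h + h))) / 2 = w + h + h + 'i%C * h by field.
have -> : (w + (h + h) + 'i%C * (h + h) + (w + 'i%C * (h + h))) / 2
          = w + h + 'i%C * h + 'i%C * h by field.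
have -> : (w + 'i%C * (h + h) + w) / 2 = w + 'i%C * h by field.
have -> : w + (h + h) = w + h + h by ring.
have -> : w + h + h + 'i%C * (h + h) = w + h + 'i%C * h + h + 'i%C * h by ring.
have -> : w + 'i%C * (h + h) = w + 'i%C * h + 'i%C * h by ring.
have -> : w + 'i%C * h + h = w + h + 'i%C * h by ring.
have -> : w + h + h + 'i%C * h = w + h + 'i%C * h + h by ring.
rewrite (midpoint_sum_sym n (w + 'i%C * h) (w + h + 'i%C * h)).
rewrite (midpoint_sum_sym n (w + h + 'i%C * h) (w + h + 'i%C * h + h)).
rewrite (midpoint_sum_sym n (w + h) (w + h + 'i%C * h)).
rewrite (midpoint_sum_sym n (w + h + 'i%C * h) (w + h + 'i%C * h + 'i%C * h)).
rewrite [RHS](AC (4*4*4*4) (1*5*6*10*11*15*16*4*(2*8)*(3*13)*(7*9)*(12*14)))/=.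
by rewrite subrr !addNr !addr0 !addrA.
Qed.

End MidpointSums.

Section MidpointBounds.
Context {R : realType} {X : normedModType R[i]}.
Local Notation C := R[i].
Local Notation N := (@rnorm R X).
Implicit Types (g : C -> X) (p q w a : C).

Lemma midpoint_sum_bound n p q g (B : R) :
  (forall s : R, 0 <= s <= 1 -> N (g (p + (s%:C)%C * (q - p))) <= B) ->
  N (midpoint_sum n p q g) <= cabs (q - p) * B.
Proof.
elim: n p q => [|n ih] p q h /=.
  rewrite rnormZ ler_wpM2l ?cabs_ge0//.
  have := h 2^-1; rewrite invr_ge0 invf_le1 ?ler1n// ler0n => /(_ isT).
  rewrite fmorphV rmorph_nat; congr (N (g _) <= _); by field.
have hm : cabs (q - p) = cabs ((p + q) / 2 - p) + cabs (q - (p + q) / 2).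
  have -> : (p + q) / 2 - p = (q - p) / 2 by field.
  have -> : q - (p + q) / 2 = (q - p) / 2 by field.
  by rewrite cabsM cabsV cabs_nat; field.
rewrite hm [leRHS]mulrDl (le_trans (ler_rnormD _ _))// lerD//; apply: ih => s /andP[s0 s1].
  have := h (s / 2); rewrite divr_ge0//= => /(_ _)/(le_trans _); apply; last first.
    by rewrite ler_pdivrMr//; lra.
  by rewrite rmorphM fmorphV rmorph_nat; apply: eq_ler; congr (N (g _)); field.
have := h ((s + 1) / 2); rewrite divr_ge0 ?addr_ge0//= => /(_ _)/(le_trans _); apply; last first.
  by rewrite ler_pdivrMr//; lra.
by rewrite rmorphM rmorphD rmorph1 fmorphV rmorph_nat; apply: eq_ler; congr (N (g _)); field.
Qed.

Lemma ler_rnorm4 (x y z u : X) (a b c d : R) :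
  N x <= a -> N y <= b -> N z <= c -> N u <= d -> N (x + y + z + u) <= a + b + c + d.
Proof.
move=> xa yb zc ud; apply: (le_trans (ler_rnormD _ _)); apply: lerD => //.
apply: (le_trans (ler_rnormD _ _)); apply: lerD => //.
by apply: (le_trans (ler_rnormD _ _)); apply: lerD.
Qed.

Definition pt w a (s t : R) : C := w + (s +i* t)%C * a.

Lemma complexDi (s t : R) : (s +i* t)%C = (s%:C)%C + 'i%C * (t%:C)%C.
Proof. by rewrite [LHS]complexE. Qed.

Lemma boundary_sum_bound n w a g (B : R) :
  (forall s t : R, 0 <= s <= 1 -> 0 <= t <= 1 -> N (g (pt w a s t)) <= B) ->
  N (boundary_sum n w a g) <= 4 * (cabs a * B).
Proof.
move=> h; have ci : cabs ('i%C : C) = 1.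
  by rewrite cabs_sqrt/= expr0n add0r expr1n sqrtr1.
have h01 : 0 <= (0:R) <= 1 by rewrite lexx ler01.
have h11 : 0 <= (1:R) <= 1 by rewrite lexx ler01.
have -> : 4 * (cabs a * B) = cabs a * B + cabs a * B + cabs a * B + cabs a * B by ring.
rewrite /boundary_sum; apply: ler_rnorm4.
- have {2}-> : a = w + a - w by ring.
  apply: midpoint_sum_bound => s s01; have := h _ _ s01 h01.
  by rewrite /pt complexDi rmorph0; congr (N (g _) <= _); ring.
- have -> : cabs a = cabs (w + a + 'i%C * a - (w + a)).
    have -> : w + a + 'i%C * a - (w + a) = 'i%C * a by ring.
    by rewrite cabsM ci mul1r.
  apply: midpoint_sum_bound => s s01; have := h _ _ h11 s01.
  by rewrite /pt complexDi rmorph1; congr (N (g _) <= _); ring.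
- have -> : cabs a = cabs (w + 'i%C * a - (w + a + 'i%C * a)).
    by rewrite cabsB; congr cabs; ring.
  apply: midpoint_sum_bound => s s01; have := h (1 - s) 1.
  rewrite h11 => /(_ _ isT)/(le_trans _); apply; last by lra.
  by rewrite /pt complexDi rmorphB rmorph1; apply: eq_ler; congr (N (g _)); ring.
- have -> : cabs a = cabs (w - (w + 'i%C * a)).
    have -> : w - (w + 'i%C * a) = - ('i%C * a) by ring.
    by rewrite cabsN cabsM ci mul1r.
  apply: midpoint_sum_bound => s s01; have := h 0 (1 - s) h01 => /(_ _)/(le_trans _); apply; last by lra.
  by rewrite /pt complexDi rmorphB rmorph1 rmorph0; apply: eq_ler; congr (N (g _)); ring.
Qed.

(** Stated without division by [h], so that [h = 0] needs no exclusion. *)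
Definition cdiff g (z : C) (d : X) := forall e : R, 0 < e -> exists2 r : R, 0 < r &
  forall h : C, cabs h < r -> N (g (z + h) - g z - h *: d) <= e * cabs h.

Lemma nested_limit (x : nat -> R) :
  (forall k, x k <= x k.+1 <= x k + 2^-1 ^+ k.+1) ->
  exists l, forall k, x k <= l <= x k + 2^-1 ^+ k.
Proof.
move=> h; have mono k m : (k <= m)%N -> x k <= x m <= x k + (2^-1 ^+ k - 2^-1 ^+ m).
  move=> km; rewrite -(subnK km); elim: (m - k)%N => [|j].
    by rewrite add0n subrr addr0 lexx.
  rewrite addSn; have := h (j + k)%N; rewrite exprS.
  set b := 2^-1 ^+ _; set c := 2^-1 ^+ _; lra.
have p0 m : 0 <= (2^-1 : R) ^+ m by rewrite exprn_ge0// invr_ge0.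
have hs k : ubound (range x) (x k + 2^-1 ^+ k).
  move=> _ [m _ <-]; have [km|/ltnW mk] := leqP k m.
    by have := mono _ _ km; have := p0 m; lra.
  by have := mono _ _ mk; have := p0 k; lra.
exists (sup (range x)) => k; apply/andP; split.
  by apply: ub_le_sup; [exists (x 0%N + 2^-1 ^+ 0); exact: hs|exists k].
by apply: ge_sup; [exists (x 0%N); exists 0%N|exact: hs].
Qed.

End MidpointBounds.

Section Goursat.
Context {R : realType} {X : normedModType R[i]}.
Local Notation C := R[i].
Local Notation N := (@rnorm R X).
Implicit Types (g : C -> X) (p q w a z : C).

Lemma realcD (x y : R) : ((x + y)%:C)%C = (x%:C)%C + (y%:C)%C :> C.
Proof. exact: rmorphD. Qed.

Lemma realcB (x y : R) : ((x - y)%:C)%C = (x%:C)%C - (y%:C)%C :> C.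
Proof. exact: rmorphB. Qed.

Lemma realcM (x y : R) : ((x * y)%:C)%C = (x%:C)%C * (y%:C)%C :> C.
Proof. exact: rmorphM. Qed.

Lemma ptE w a (s t : R) : pt w a s t = w + ((s%:C)%C + 'i%C * (t%:C)%C) * a.
Proof. by rewrite /pt complexDi. Qed.

Lemma pt_sub w a (x y s t c : R) :
  pt (pt w a x y) ((c%:C)%C * a) s t = pt w a (x + c * s) (y + c * t).
Proof.
rewrite !ptE ?(realcD, realcM); ring.
Qed.

Lemma cabs_pt w a (x y l m : R) :
  cabs (pt w a x y - pt w a l m) <= (`|x - l| + `|y - m|) * cabs a.
Proof.
have -> : pt w a x y - pt w a l m = ((x - l) +i* (y - m))%C * a.
  rewrite !ptE (complexDi (x - l)) !realcB; ring.
rewrite cabsM; apply: ler_wpM2r; first exact: cabs_ge0.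
by have := ler_cabs_ReIm ((x - l) +i* (y - m))%C; rewrite [complex.Re _]/= [complex.Im _]/=.
Qed.

(** Bisection. The sums only tend to 0, so a subsquare counts as bad when its sums exceed its share
    of [e] for arbitrarily large [n]; this passes to one of the four quarters, the level dropping by
    one in [boundary_sum_split]. *)
Lemma goursat g w a :
  (forall s t : R, 0 <= s <= 1 -> 0 <= t <= 1 -> exists d, cdiff g (pt w a s t) d) ->
  forall e : R, 0 < e -> exists n0, forall n, (n0 <= n)%N -> N (boundary_sum n w a g) <= e.
Proof.
move=> hg e e0; apply: contrapT => hN.
pose b k : R := 2^-1 ^+ k.
have b0 k : 0 < b k by rewrite exprn_gt0// invr_gt0.
pose bad k (p : R * R) := forall n0, exists2 n, (n0 <= n)%N &
  e * 4^-1 ^+ k < N (boundary_sum n (pt w a p.1 p.2) (((b k)%:C)%C * a) g).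
have bS k : (((b k)%:C)%C * a) / 2 = ((b k.+1)%:C)%C * a.
  by rewrite /b exprS rmorphM fmorphV rmorph_nat; ring.
have step (kp : nat * (R * R)) : exists p' : R * R, bad kp.1 kp.2 ->
    [/\ bad kp.1.+1 p', kp.2.1 <= p'.1 <= kp.2.1 + b kp.1.+1
       & kp.2.2 <= p'.2 <= kp.2.2 + b kp.1.+1].
  case: kp => k [x y] /=; have := b0 k.+1; set c := b k.+1 => c0.
  apply: contrapT => /forallNP hp.
  have hbad : bad k (x, y) by apply: contrapT => h; apply: (hp (x, y)).
  have sub x' y' : x <= x' <= x + c -> y <= y' <= y + c -> exists n0, forall n,
      (n0 <= n)%N -> N (boundary_sum n (pt w a x' y') ((c%:C)%C * a) g) <= e * 4^-1 ^+ k.+1.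
    move=> hx hy; apply: contrapT => /forallNP h; apply: (hp (x', y')) => _; split => //.
    move=> n0; have /existsNP[n /not_implyP[nn /negP]] := h n0.
    by rewrite -ltNge; exists n.
  have hx1 : x <= x <= x + c by rewrite lexx lerDl ltW.
  have hx2 : x <= x + c <= x + c by rewrite lexx lerDl ltW.
  have hy1 : y <= y <= y + c by rewrite lexx lerDl ltW.
  have hy2 : y <= y + c <= y + c by rewrite lexx lerDl ltW.
  have [n1 h1] := sub _ _ hx1 hy1; have [n2 h2] := sub _ _ hx2 hy1.
  have [n3 h3] := sub _ _ hx2 hy2; have [n4 h4] := sub _ _ hx1 hy2.
  have [[|n]//= nn] := hbad (n1 + n2 + n3 + n4).+1; rewrite ltnS in nn.
  apply/negP; rewrite -leNgt boundary_sum_split bS -/c.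
  have -> : pt w a x y + (c%:C)%C * a = pt w a (x + c) y.
    by rewrite !ptE ?(realcD, realcM); ring.
  have -> : pt w a (x + c) y + 'i%C * ((c%:C)%C * a) = pt w a (x + c) (y + c).
    by rewrite !ptE ?(realcD, realcM); ring.
  have -> : pt w a x y + 'i%C * ((c%:C)%C * a) = pt w a x (y + c).
    by rewrite !ptE ?(realcD, realcM); ring.
  have -> : e * 4^-1 ^+ k = e * 4^-1 ^+ k.+1 + e * 4^-1 ^+ k.+1 + e * 4^-1 ^+ k.+1
     + e * 4^-1 ^+ k.+1 by rewrite exprS; field.
  by apply: ler_rnorm4; [apply: h1|apply: h2|apply: h3|apply: h4]; lia.
have [f hf] := choice step.
pose fix p k : R * R := if k is k'.+1 then f (k', p k') else (0, 0).
have badp k : bad k (p k).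
  elim: k => [n0|k ih]; last by have [] := hf (k, p k) ih.
  apply: contrapT => h; apply: hN; exists n0 => n nn.
  rewrite leNgt; apply/negP => hn; apply: h; exists n => //=.
  rewrite /b !expr0 mulr1 rmorph1 mul1r /pt.
  by rewrite (_ : (0 +i* 0)%C = 0)// mul0r addr0.
have [k|l hl] := @nested_limit _ (fun k => (p k).1).
  by have [] := hf (k, p k) (badp k).
have [k|m hm] := @nested_limit _ (fun k => (p k).2).
  by have [] := hf (k, p k) (badp k).
have l01 : 0 <= l <= 1 by have := hl 0%N; rewrite /= expr0; lra.
have m01 : 0 <= m <= 1 by have := hm 0%N; rewrite /= expr0; lra.
have [d hd] := hg l m l01 m01.
have c0 := cabs_ge0 a.
(* A perimeter 4 |a| 2^-k times a deviation taken at distance at most 2 |a| 2^-k costs 8 |a|^2 4^-k,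
   which leaves half of the share 4^-k of [e]; the added 1 covers [a = 0]. *)
have [|r r0 hr] := hd (e / (16 * (cabs a ^+ 2 + 1))).
  by rewrite divr_gt0// mulr_gt0// ltr_wpDl// sqr_ge0.
have [k hk] := @expr_small R 2^-1 (2 * cabs a) r ltac:(lra) r0.
have [n _] := badp k 0%N; apply/negP; rewrite -leNgt.
set z := pt w a l m in hd hr.
have <- : boundary_sum n (pt w a (p k).1 (p k).2) (((b k)%:C)%C * a)
    (fun u => g u - ((g z - z *: d) + u *: d)) =
  boundary_sum n (pt w a (p k).1 (p k).2) (((b k)%:C)%C * a) g.
  by rewrite (boundary_sumB n _ _ g) boundary_sum_affine subr0.
apply: (le_trans (@boundary_sum_bound _ _ n _ _ _
  (e / (16 * (cabs a ^+ 2 + 1)) * (2 * cabs a * b k)) _)) => [s t s01 t01|].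
  rewrite pt_sub; set u := pt w a _ _.
  have hu : cabs (u - z) <= 2 * cabs a * b k.
    rewrite (le_trans (cabs_pt _ _ _ _ _ _))// [leRHS]mulrAC ler_wpM2r//.
    have := b0 k; have := hl k; have := hm k; rewrite -/(b k); set bk := b k => h1 h2 h3.
    have part (v y c : R) : 0 <= v <= 1 -> y <= c <= y + bk -> `|y + bk * v - c| <= bk.
      move=> /andP[v0 v1] yc; have v2 : 0 <= bk * v <= bk.
        by rewrite mulr_ge0 ?(ltW h3)//= ler_piMr// ltW.
      by rewrite ler_norml; lra.
    have := part _ _ _ s01 h2; have := part _ _ _ t01 h1; clear; lra.
  have := hr (u - z) (le_lt_trans hu hk).
  rewrite [z + _]addrC subrK scalerBl => /le_trans hh.
  have -> : g u - (g z - z *: d + u *: d) = g u - g z - (u *: d - z *: d).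
    by rewrite -addrA (addrC (- _)) opprD addrA.
  apply: hh; rewrite ler_wpM2l// divr_ge0 ?(ltW e0)// mulr_ge0//.
  by rewrite addr_ge0// sqr_ge0.
rewrite cabsM cabs_real gtr0_norm//.
have -> : (4^-1 : R) ^+ k = b k ^+ 2.
  by rewrite /b -exprM mulnC exprM expr2 -invfM; congr (_^-1 ^+ _); rewrite -natrM.
have ne : cabs a ^+ 2 + 1 != 0 by rewrite gt_eqF// ltr_wpDl// sqr_ge0.
have -> : 4 * (b k * cabs a * (e / (16 * (cabs a ^+ 2 + 1)) * (2 * cabs a * b k)))
   = e * b k ^+ 2 * (cabs a ^+ 2 / (cabs a ^+ 2 + 1) / 2) by field.
have pos : 0 < cabs a ^+ 2 + 1 by rewrite ltr_wpDl// sqr_ge0.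
apply: ler_piMr; first by rewrite mulr_ge0 ?sqr_ge0// ltW.
rewrite ler_pdivrMr// ler_pdivrMr//.
have := sqr_ge0 (cabs a); lra.
Qed.

End Goursat.

(** * Boundaries of squares centred at a singular point *)

Section OuterDef.
Context {R : realType} {X : lmodType R[i]}.
Local Notation C := R[i].
Implicit Types (g : C -> X) (w a : C).

(** The two sides, not meeting [w], of the square with corner [w] and side [a]. Four rotated copies
    make up [outer], the boundary of the square centred at [w] with vertices w ± a ± ia. *)
Definition half_outer n w a g : X :=
  midpoint_sum n (w + a) (w + a + 'i%C * a) g + midpoint_sum n (w + a + 'i%C * a) (w + 'i%C * a) g.

Definition outer n w a g : X :=
  half_outer n w a g + half_outer n w ('i%C * a) g
  + half_outer n w ('i%C * ('i%C * a)) g + half_outer n w ('i%C * ('i%C * ('i%C * a))) g.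

Lemma mulii (z : C) : 'i%C * ('i%C * z) = - z.
Proof. by rewrite mulrA -expr2 sqr_i mulN1r. Qed.

(** The edges issuing from [w] are each run through in both directions and cancel. *)
Lemma outer_bs n w a g : outer n w a g = boundary_sum n w a g + boundary_sum n w ('i%C * a) g
  + boundary_sum n w ('i%C * ('i%C * a)) g + boundary_sum n w ('i%C * ('i%C * ('i%C * a))) g.
Proof.
rewrite /outer /half_outer /boundary_sum !(mulii, mulrN) !opprK.
rewrite (midpoint_sum_sym n w (w + 'i%C * a)) (midpoint_sum_sym n w (w - a)) (midpoint_sum_sym n w (w - 'i%C * a)).
rewrite (midpoint_sum_sym n w (w + a)).
rewrite [RHS](AC (4*4*4*4) ((2*3)*(6*7)*(10*11)*(14*15)*(1*16)*(4*5)*(8*9)*(12*13)))/=.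
by rewrite subrr !addNr !addr0.
Qed.

Lemma outerB n w a g h : outer n w a (fun z => g z - h z) = outer n w a g - outer n w a h.
Proof. by rewrite !outer_bs !boundary_sumB !opprD [LHS](AC (2*2*2*2) (1*3*5*7*(2*4*6*8)))/=. Qed.

End OuterDef.

Section Cauchy.
Context {R : realType} {X : normedModType R[i]}.
Local Notation C := R[i].
Local Notation N := (@rnorm R X).
Implicit Types (g : C -> X) (w a z : C).

Let ci : cabs ('i%C : C) = 1.
Proof. by rewrite cabs_sqrt/= expr0n add0r expr1n sqrtr1. Qed.

Lemma half_outer_bound n w a g (B : R) :
  (forall s : R, 0 <= s <= 1 -> N (g (w + a + (s%:C)%C * ('i%C * a))) <= B) ->
  (forall s : R, 0 <= s <= 1 -> N (g (w + a + 'i%C * a - (s%:C)%C * a)) <= B) ->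
  N (half_outer n w a g) <= 2 * (cabs a * B).
Proof.
move=> h1 h2; rewrite /half_outer mulr_natl mulr2n (le_trans (ler_rnormD _ _))// lerD//.
  have -> : cabs a = cabs (w + a + 'i%C * a - (w + a)).
    by rewrite [w + a + _]addrC addrK cabsM ci mul1r.
  by apply: midpoint_sum_bound => s s01; rewrite [w + a + _ - _]addrAC subrr add0r; exact: h1.
have -> : cabs a = cabs (w + 'i%C * a - (w + a + 'i%C * a)).
  by rewrite cabsB; congr cabs; ring.
apply: midpoint_sum_bound => s s01; have := h2 s s01; congr (N (g _) <= _); ring.
Qed.

Lemma outer_bound n w a g (B : R) :
  (forall z, cabs a <= cabs (z - w) <= 2 * cabs a -> N (g z) <= B) ->
  N (outer n w a g) <= 8 * (cabs a * B).
Proof.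
move=> h; have hb b : cabs b = cabs a -> N (half_outer n w b g) <= 2 * (cabs a * B).
  move=> ba; rewrite -ba; apply: half_outer_bound => s /andP[s0 s1]; apply: h.
    have -> : w + b + (s%:C)%C * ('i%C * b) - w = (1 +i* s)%C * b.
      rewrite (complexDi 1 s) rmorph1; ring.
    rewrite cabsM ba; have c0 := cabs_ge0 a; apply/andP; split.
      rewrite ler_peMl//; have := ler_Re_cabs (1 +i* s)%C; rewrite /= normr1; lra.
    apply: ler_wpM2r => //; have := ler_cabs_ReIm (1 +i* s)%C.
    by rewrite /= normr1 ger0_norm//; lra.
  have -> : w + b + 'i%C * b - (s%:C)%C * b - w = ((1 - s) +i* 1)%C * b.
    rewrite (complexDi (1 - s) 1) realcB rmorph1; ring.
  rewrite cabsM ba; have c0 := cabs_ge0 a; apply/andP; split.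
    rewrite ler_peMl//; have := ler_Im_cabs ((1 - s) +i* 1)%C; rewrite /= normr1; lra.
  apply: ler_wpM2r => //; have := ler_cabs_ReIm ((1 - s) +i* 1)%C.
  by rewrite /= normr1 ger0_norm ?subr_ge0//; lra.
have -> : 8 * (cabs a * B) = 2 * (cabs a * B) + 2 * (cabs a * B) + 2 * (cabs a * B)
  + 2 * (cabs a * B) by ring.
by apply: ler_rnorm4; apply: hb; rewrite ?cabsM ?ci ?mul1r.
Qed.

(** Each of the four squares at [w] consists of a quarter at [w] and three quarters away from it.
    [goursat] disposes of the latter, and the quarters at [w] form the same figure at half the
    size. *)
Lemma outer_step g w a :
  (forall z, z != w -> cabs (z - w) <= 2 * cabs a -> exists d, cdiff g z d) ->
  a != 0 ->
  forall e : R, 0 < e -> exists n0, forall n, (n0 <= n)%N ->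
    N (outer n.+1 w a g - outer n w (a / 2) g) <= e.
Proof.
move=> hg a0 e e0.
pose D n b := boundary_sum n (w + b / 2) (b / 2) g + boundary_sum n (w + b / 2 + 'i%C * (b / 2)) (b / 2) g
  + boundary_sum n (w + 'i%C * (b / 2)) (b / 2) g.
have hD n b : boundary_sum n.+1 w b g = boundary_sum n w (b / 2) g + D n b.
  by rewrite boundary_sum_split /D !addrA.
have hd b : cabs b = cabs a -> exists n0, forall n, (n0 <= n)%N -> N (D n b) <= e / 4.
  move=> ba; have b0 : b != 0 by rewrite -cabs_eq0 ba cabs_eq0.
  have e12 : 0 < e / 12 by rewrite divr_gt0.
  have pt_ne (x y s t : R) : 0 <= s <= 1 -> 0 <= t <= 1 ->
      (0 <= x <= 1) -> (0 <= y <= 1) -> (x == 1) || (y == 1) ->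
      exists d, cdiff g (pt (pt w b (x / 2) (y / 2)) (b / 2) s t) d.
    move=> /andP[s0 s1] /andP[t0 t1] /andP[x0 x1] /andP[y0 y1] xy.
    have -> : b / 2 = (((2^-1 : R)%:C)%C * b) by rewrite fmorphV rmorph_nat mulrC.
    rewrite pt_sub.
    have e1 u v : pt w b u v - w = (u +i* v)%C * b by rewrite /pt addrC addKr.
    apply: hg.
      rewrite -subr_eq0 e1 mulf_neq0//; apply/eqP => -[h1 h2].
      by move: xy; case/orP => /eqP ?; lra.
    rewrite e1 cabsM ba; apply: ler_wpM2r; first exact: cabs_ge0.
    have := ler_cabs_ReIm ((x / 2 + 2^-1 * s) +i* (y / 2 + 2^-1 * t))%C.
    rewrite [complex.Re _]/= [complex.Im _]/= !ger0_norm; lra.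
  have p00 : w = pt w b (0 / 2) (0 / 2).
    by rewrite ptE mul0r rmorph0; ring.
  have g1 (x y : R) : 0 <= x <= 1 -> 0 <= y <= 1 -> (x == 1) || (y == 1) ->
     exists n0, forall n, (n0 <= n)%N -> N (boundary_sum n (pt w b (x / 2) (y / 2)) (b / 2) g) <= e / 12.
    by move=> x01 y01 xy; apply: goursat => // s t s01 t01; apply: pt_ne.
  have i01 : 0 <= (0 : R) <= 1 by rewrite lexx ler01.
  have i11 : 0 <= (1 : R) <= 1 by rewrite lexx ler01.
  have [|n1 h1] := g1 1 0 i11 i01; first by rewrite eqxx.
  have [|n2 h2] := g1 1 1 i11 i11; first by rewrite eqxx.
  have [|n3 h3] := g1 0 1 i01 i11; first by rewrite eqxx orbT.
  exists (n1 + n2 + n3)%N => n nn; rewrite /D.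
  have half1 : (((1 / 2 : R)%:C)%C : C) = 2^-1 by rewrite mul1r fmorphV rmorph_nat.
  have half0 : (((0 / 2 : R)%:C)%C : C) = 0 by rewrite mul0r rmorph0.
  have -> : w + b / 2 = pt w b (1 / 2) (0 / 2) by rewrite ptE half1 half0; ring.
  have -> : pt w b (1 / 2) (0 / 2) + 'i%C * (b / 2) = pt w b (1 / 2) (1 / 2).
    by rewrite !ptE half1 half0; ring.
  have -> : w + 'i%C * (b / 2) = pt w b (0 / 2) (1 / 2) by rewrite ptE half1 half0; ring.
  have -> : e / 4 = e / 12 + e / 12 + e / 12 by field.
  rewrite (le_trans (ler_rnormD _ _))// lerD//; last by apply: h3; lia.
  by rewrite (le_trans (ler_rnormD _ _))// lerD//; [apply: h1|apply: h2]; lia.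
have [n1 h1] := hd a erefl.
have [|n2 h2] := hd ('i%C * a); first by rewrite !cabsM ci !mul1r.
have [|n3 h3] := hd ('i%C * ('i%C * a)); first by rewrite !cabsM ci !mul1r.
have [|n4 h4] := hd ('i%C * ('i%C * ('i%C * a))); first by rewrite !cabsM ci !mul1r.
exists (n1 + n2 + n3 + n4)%N => n nn.
rewrite !outer_bs !hD -!mulrA 3!opprD.
rewrite [X in N X](AC (2*2*2*2*4) ((1*9)*(3*10)*(5*11)*(7*12)*(2*4*6*8)))/= !subrr !add0r.
have -> : e = e / 4 + e / 4 + e / 4 + e / 4 by field.
by apply: ler_rnorm4; [apply: h1|apply: h2|apply: h3|apply: h4]; lia.
Qed.

(* The outer boundary sums shrink to the singular point without changing in the limit. *)
Lemma outer_vanish g w a :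
  (forall z, z != w -> cabs (z - w) <= 2 * cabs a -> exists d, cdiff g z d) ->
  a != 0 ->
  (forall e : R, 0 < e -> exists2 r, 0 < r &
     forall z, 0 < cabs (z - w) < r -> N (g z) * cabs (z - w) <= e) ->
  forall e : R, 0 < e -> exists n, N (outer n w a g) <= e.
Proof.
move=> hg a0 hs e e0; have ca : 0 < cabs a by rewrite cabs_gt0.
have [|r r0 hr] := hs (e / 32); first by rewrite divr_gt0.
have [k hk] := @expr_small R 2^-1 (2 * cabs a) r ltac:(lra) r0.
have pw j : cabs (a / 2 ^+ j) = cabs a * 2^-1 ^+ j.
  by rewrite cabsM cabsV cabsX cabs_nat exprVn.
have p0 j : 0 < (2^-1 : R) ^+ j by rewrite exprn_gt0// invr_gt0.
have small n : N (outer n w (a / 2 ^+ k) g) <= e / 2.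
  have c0 : 0 < cabs (a / 2 ^+ k) by rewrite pw mulr_gt0.
  have -> : e / 2 = 8 * (cabs (a / 2 ^+ k) * (e / 16 / cabs (a / 2 ^+ k))).
    by field; rewrite gt_eqF.
  apply: outer_bound => z /andP[z1 z2]; rewrite ler_pdivlMr//.
  have zw : 0 < cabs (z - w) by exact: lt_le_trans z1.
  have zr : cabs (z - w) < r by rewrite (le_lt_trans z2)// pw mulrA.
  have := hr z; rewrite zw zr => /(_ isT); have := ler_wpM2l (rnorm_ge0 (g z)) z1; lra.
have many j : (j <= k)%N -> forall d : R, 0 < d -> exists n0, forall n, (n0 <= n)%N ->
    N (outer (n + j) w a g - outer n w (a / 2 ^+ j) g) <= d.
  elim: j => [|j ih] jk d d0.
    by exists 0%N => n _; rewrite addn0 expr0 divr1 subrr rnorm0 ltW.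
  have [|n1 h1] := ih (ltnW jk) (d / 2); first by rewrite divr_gt0.
  have [|||n2 h2] := @outer_step g w (a / 2 ^+ j) _ _ (d / 2).
  - move=> z zw zj; apply: hg => //; rewrite (le_trans zj)// ler_wpM2l// pw.
    by rewrite ler_piMr ?(ltW ca)// exprn_ile1 ?invr_ge0// invf_le1// ler1n.
  - by rewrite mulf_neq0// invr_neq0// expf_neq0// pnatr_eq0.
  - by rewrite divr_gt0.
  exists (n1 + n2)%N => n nn.
  have := h1 n.+1 _; rewrite addSnnS => /(_ ltac:(lia)) q1.
  have := h2 n _ => /(_ ltac:(lia)); rewrite -mulrA -invfM -exprSr => q2.
  have := le_trans (ler_rnorm_dist _ _ _) (lerD q1 q2); rewrite -splitr; exact.
have [|n0 h0] := many k (leqnn k) (e / 2); first by rewrite divr_gt0.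
exists (n0 + k)%N; have := h0 n0 (leqnn _); have := small n0.
have := ler_rnorm_dist (outer (n0 + k) w a g) (outer n0 w (a / 2 ^+ k) g) 0.
rewrite !subr0; lra.
Qed.

End Cauchy.

(** * Rules of complex differentiation *)

Section ComplexDerivative.
Context {R : realType} {X : normedModType R[i]}.
Local Notation C := R[i].
Local Notation N := (@rnorm R X).
Implicit Types (f g : C -> X) (z w : C) (d : X).

Lemma cdiff_cst d0 z : cdiff (fun=> d0 : X) z 0.
Proof.
move=> e e0; exists 1 => // h _.
by rewrite subrr scaler0 subrr rnorm0 mulr_ge0 ?cabs_ge0// ltW.
Qed.

Lemma cdiff_lin w d z : cdiff (fun u => (u - w) *: d) z d.
Proof.
move=> e e0; exists 1 => // h _.
rewrite -scalerBl -scalerBl (_ : z + h - w - (z - w) - h = 0); last by ring.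
by rewrite scale0r rnorm0 mulr_ge0 ?cabs_ge0// ltW.
Qed.

Lemma cdiffB f g z d d' : cdiff f z d -> cdiff g z d' ->
  cdiff (fun u => f u - g u) z (d - d').
Proof.
move=> hf hg e e0; have e2 : 0 < e / 2 by rewrite divr_gt0.
have [r r0 hr] := hf _ e2; have [s s0 hs] := hg _ e2.
exists (Num.min r s) => [|h]; first by rewrite lt_min r0.
rewrite lt_min => /andP[h1 h2]; have := hr _ h1; have := hs _ h2.
have -> : f (z + h) - g (z + h) - (f z - g z) - h *: (d - d')
  = (f (z + h) - f z - h *: d) - (g (z + h) - g z - h *: d').
  rewrite scalerBr !opprD !opprK.
  by rewrite [RHS](AC (3*3) ((1*4)*(2*5)*(3*6)))/=.
move=> q1 q2; have := ler_rnormB (f (z + h) - f z - h *: d) (g (z + h) - g z - h *: d').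
by move=> /le_trans; apply; rewrite addrC (le_trans (lerD q1 q2))// -mulrDl -splitr.
Qed.

Lemma cdiff_scale (phi : C -> C^o) f z (p : C^o) d : cdiff phi z p -> cdiff f z d ->
  cdiff (fun u => (phi u : C) *: f u) z ((phi z : C) *: d + (p : C) *: f z).
Proof.
move=> hp hf e e0.
pose K := cabs (phi z) + cabs p + N (f z) + N d + 2.
have [c1 c2] := (cabs_ge0 (phi z), cabs_ge0 p).
have [c3 c4] := (rnorm_ge0 (f z), rnorm_ge0 d).
have K0 : 0 < K by rewrite /K; lra.
have e1 : 0 < Num.min 1 (e / (3 * K)) by rewrite lt_min ltr01 divr_gt0// mulr_gt0.
have [r r0 hr] := hp _ e1; have [s s0 hs] := hf _ e1.
exists (Num.min (Num.min r s) (Num.min 1 (e / (3 * K ^+ 2)))) => [|h].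
  by rewrite !lt_min r0 s0 ltr01 divr_gt0// mulr_gt0// exprn_gt0.
rewrite !lt_min => /andP[/andP[h1 h2] /andP[h3 h4]].
have c5 := cabs_ge0 h.
have := hr _ h1; have := hs _ h2; rewrite -![rnorm (_ : C^o)]/(cabs _).
set E := Num.min _ _ in e1 *; have [E1 E2] : E <= 1 /\ E <= e / (3 * K).
  by rewrite /E !ge_min !lexx ?orbT.
set A := phi (z + h); set B := f (z + h).
move=> q1 q2; have q3 : cabs (A - phi z) <= K * cabs h.
  have -> : A - phi z = (A - phi z - h *: p) + h * p by rewrite subrK.
  rewrite (le_trans (ler_cabsD _ _))// cabsM (mulrC (cabs h)).
  have := ler_wpM2r c5 E1; have : cabs p * cabs h <= (K - 1) * cabs h.
    by apply: ler_wpM2r => //; rewrite /K; lra.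
  by move: q2; lra.
have q4 : cabs A <= K.
  have := ler_cabs_subr A (phi z); have : cabs p * cabs h <= cabs p.
    by rewrite ler_piMr// ltW.
  have : E * cabs h <= 1 by rewrite mulr_ile1// ltW.
  have : cabs (A - phi z) <= E * cabs h + cabs p * cabs h.
    have -> : A - phi z = (A - phi z - h *: p) + h * p by rewrite subrK.
    by rewrite (le_trans (ler_cabsD _ _))// cabsM (mulrC (cabs h)) lerD2r.
  rewrite /K; lra.
have -> : A *: B - phi z *: f z - h *: (phi z *: d + p *: f z) =
  A *: (B - f z - h *: d) + (A - phi z - h * p) *: f z + (h * (A - phi z)) *: d.
  rewrite !scalerBr !scalerBl !scalerDr !scalerA mulrBr scalerBl.
  rewrite [RHS](AC (3*3*2) (1*5*6*8*(2*4)*(3*7)))/= (mulrC A h) addNr addr0 addNr addr0.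
  by rewrite opprD -!addrA; congr (_ + (_ + _)); rewrite addrC.
have K3 : 0 < 3 * K by rewrite mulr_gt0.
have -> : e * cabs h = e / (3 * K) * cabs h * K + e / (3 * K) * cabs h * K
   + e / (3 * K ^+ 2) * (K ^+ 2 * cabs h) by field; rewrite gt_eqF.
apply: (le_trans (ler_rnormD _ _)); apply: lerD.
  apply: (le_trans (ler_rnormD _ _)); apply: lerD.
    rewrite rnormZ mulrC ler_pM ?rnorm_ge0 ?cabs_ge0//.
    by rewrite (le_trans q1)// ler_wpM2r.
  rewrite rnormZ ler_pM ?rnorm_ge0 ?cabs_ge0//; last by rewrite /K; lra.
  by rewrite (le_trans q2)// ler_wpM2r.
rewrite rnormZ cabsM -mulrA ler_pM ?mulr_ge0 ?rnorm_ge0 ?cabs_ge0//; first exact: ltW.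
by rewrite expr2 -mulrA [leRHS]mulrCA [leRHS]mulrC ler_pM ?rnorm_ge0 ?cabs_ge0//; rewrite /K; lra.
Qed.

Lemma cdiff_inv w z : z != w ->
  cdiff (fun u => (u - w)^-1 : C^o) z (- ((z - w)^-1 * (z - w)^-1)).
Proof.
rewrite -subr_eq0 => z0 e e0; have zp : 0 < cabs (z - w) by rewrite cabs_gt0.
set c := cabs (z - w) in zp *.
exists (Num.min (c / 2) (e * c ^+ 3 / 2)) => [|h].
  by rewrite lt_min !divr_gt0// mulr_gt0// exprn_gt0.
rewrite lt_min => /andP[h1 h2].
have q : c / 2 <= cabs (z + h - w).
  have := ler_cabs_subr (z - w) (- h); rewrite cabsN -/c opprK (addrAC z); lra.
have zh : z + h - w != 0 by rewrite -cabs_gt0 (lt_le_trans _ q)// divr_gt0.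
rewrite -[rnorm _]/(cabs _).
have -> : (z + h - w)^-1 - (z - w)^-1 - h *: (- ((z - w)^-1 * (z - w)^-1) : C^o)
   = h * (h * ((z - w)^-1 ^+ 2 * (z + h - w)^-1)).
  rewrite -[_ *: _]/(_ * _); field; exact/andP.
rewrite cabsM [leLHS]mulrC ler_wpM2r ?cabs_ge0//.
have -> : cabs (h * ((z - w)^-1 ^+ 2 * (z + h - w)^-1)) = cabs h * (c^-1 ^+ 2 * (cabs (z + h - w))^-1).
  by rewrite cabsM [cabs (_ * (_)^-1)]cabsM cabsX !cabsV.
have cq : (cabs (z + h - w))^-1 <= 2 / c.
  by rewrite -invf_div lef_pV2// posrE ?divr_gt0// (lt_le_trans _ q)// divr_gt0.
apply: (@le_trans _ _ (e * c ^+ 3 / 2 * (c^-1 ^+ 2 * (2 / c)))).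
  apply: ler_pM => //; rewrite ?cabs_ge0 ?(ltW h2)// ?mulr_ge0 ?sqr_ge0 ?invr_ge0 ?cabs_ge0//.
  by apply: ler_wpM2l => //; exact: sqr_ge0.
by apply: eq_ler; field; rewrite gt_eqF.
Qed.

End ComplexDerivative.

Section CauchyEstimate.
Context {R : realType} {X : normedModType R[i]}.
Local Notation C := R[i].
Local Notation N := (@rnorm R X).
Implicit Types (f g : C -> X) (p q z w a : C) (d : X).

Lemma midpoint_sum_scale n p q (k : C -> C^o) d :
  midpoint_sum n p q (fun z => (k z : C) *: d) = (midpoint_sum n p q k : C) *: d.
Proof.
elim: n p q => [|n ih] p q /=; first by rewrite scalerA.
by rewrite !ih scalerDl.
Qed.

Lemma midpoint_sum_Im n p q (k : C -> C^o) (c : R) :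
  (forall s : R, 0 <= s <= 1 -> c <= complex.Im ((q - p) * k (p + (s%:C)%C * (q - p)))) ->
  c <= complex.Im (midpoint_sum n p q k).
Proof.
have ImD (u v : C) : complex.Im (u + v) = complex.Im u + complex.Im v by case: u v => [? ?] [].
have half (u v : C) : complex.Im (u / 2 * v) = complex.Im (u * v) / 2.
  rewrite mulrAC -[2]/(2%:R) -(rmorph_nat (real_complex R)) -fmorphV.
  by case: (u * v) => x y /=; rewrite mulr0 add0r.
elim: n p q c => [|n ih] p q c h /=.
  have := h 2^-1; rewrite invr_ge0 invf_le1 ?ler1n// ler0n => /(_ isT).
  rewrite fmorphV rmorph_nat; congr (_ <= complex.Im (_ * k _)); by field.
rewrite ImD [c]splitr lerD//; apply: ih => s /andP[s0 s1].
  have -> : (p + q) / 2 - p = (q - p) / 2 by field.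
  rewrite half ler_wpM2r ?invr_ge0//.
  have := h (s / 2); rewrite divr_ge0//= => /(_ _)/le_trans; apply; last first.
    by apply: eq_ler; rewrite realcM fmorphV rmorph_nat; congr (complex.Im (_ * k _)); field.
  by rewrite ler_pdivrMr//; lra.
have -> : q - (p + q) / 2 = (q - p) / 2 by field.
rewrite half ler_wpM2r ?invr_ge0//.
have := h ((s + 1) / 2); rewrite divr_ge0 ?addr_ge0//= => /(_ _)/le_trans; apply; last first.
  apply: eq_ler; rewrite realcM realcD rmorph1 fmorphV rmorph_nat; congr (complex.Im (_ * k _)).
  by field.
by rewrite ler_pdivrMr//; lra.
Qed.

Lemma outer_scale n w a (k : C -> C^o) d :
  outer n w a (fun z => (k z : C) *: d) = (outer n w a k : C) *: d.
Proof. by rewrite /outer /half_outer !midpoint_sum_scale !scalerDl. Qed.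

(** A lower bound takes the place of the value 2 pi i: on each of the eight edges the integrand is i
    / (1 + is) or -1 / ((1 - s) + i), with imaginary part at least 1/2. *)
Lemma winding_lower n w a : a != 0 -> 4 <= cabs (outer n w a (fun z => (z - w)^-1 : C^o)).
Proof.
move=> a0; have ImD (u v : C) : complex.Im (u + v) = complex.Im u + complex.Im v.
  by case: u v => [? ?] [].
have hb (b : C) : b != 0 -> 1 <= complex.Im (half_outer n w b (fun z => (z - w)^-1 : C^o)).
  move=> b0; rewrite /half_outer ImD [leLHS]splitr.
  have i0 : 'i%C != 0 :> C by rewrite eq_complex/= oner_eq0 andbF.
  apply: lerD; apply: midpoint_sum_Im => s /andP[s0 s1]; cbv beta.
    have -> : (w + b + 'i%C * b - (w + b)) *
        (w + b + (s%:C)%C * (w + b + 'i%C * b - (w + b)) - w)^-1 = 'i%C * (1 +i* s)%C^-1.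
      have s1n : (1 +i* s)%C != 0 by rewrite eq_complex/= oner_eq0.
      have -> : w + b + 'i%C * b - (w + b) = 'i%C * b by ring.
      have -> : w + b + (s%:C)%C * ('i%C * b) - w = (1 +i* s)%C * b.
        rewrite (complexDi 1 s) rmorph1; ring.
      by field; rewrite s1n.
    rewrite [leRHS]/= mul0r !mul1r add0r expr1n lef_pV2 ?posrE//; last first.
      by rewrite ltr_wpDr// sqr_ge0.
    by have := exprn_ile1 2 s0 s1; lra.
  have -> : (w + 'i%C * b - (w + b + 'i%C * b)) *
      (w + b + 'i%C * b + (s%:C)%C * (w + 'i%C * b - (w + b + 'i%C * b)) - w)^-1
      = - ((1 - s) +i* 1)%C^-1.
    have s1n : ((1 - s) +i* 1)%C != 0 by rewrite eq_complex/= oner_eq0 andbF.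
    have -> : w + 'i%C * b - (w + b + 'i%C * b) = - b by ring.
    have -> : w + b + 'i%C * b + (s%:C)%C * - b - w = ((1 - s) +i* 1)%C * b.
      rewrite (complexDi (1 - s) 1) realcB rmorph1; ring.
    by field; rewrite s1n.
  rewrite [leRHS]/= opprK expr1n !mul1r lef_pV2 ?posrE//; last first.
    by rewrite ltr_wpDl// sqr_ge0.
  by have := @exprn_ile1 _ 2 (1 - s) ltac:(lra) ltac:(lra); lra.
have i0 : 'i%C != 0 :> C by rewrite eq_complex/= oner_eq0 andbF.
have := ler_Im_cabs (outer n w a (fun z => (z - w)^-1 : C^o)); apply: le_trans.
apply: le_trans (ler_norm _); rewrite /outer 3!ImD.
have -> : 4 = 1 + 1 + 1 + 1 :> R by lra.
by rewrite !lerD// hb ?mulf_neq0.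
Qed.

(** The function [h], namely (f(z) - f(w) - (z - w) d) / (z - w)^2, is o(1 / |z - w|) at [w], so its
    outer sums become arbitrarily small. Hence [d] times the winding sum, which is at least 4 in
    modulus, is nearly the outer sum of (f(z) - f(w)) / (z - w)^2, which is at most 8 |a| 2M /
    |a|^2. *)
Lemma cauchy_estimate f w a d (M : R) : a != 0 ->
  (forall z, cabs (z - w) <= 2 * cabs a -> N (f z) <= M) ->
  (forall z, cabs (z - w) <= 2 * cabs a -> exists d, cdiff f z d) ->
  cdiff f w d -> N d <= 4 * M / cabs a.
Proof.
move=> a0 fM fd fw; have ca : 0 < cabs a by rewrite cabs_gt0.
pose k z : C^o := (z - w)^-1.
pose h z : X := (k z * k z) *: (f z - f w - (z - w) *: d).
have hd z : z != w -> cabs (z - w) <= 2 * cabs a -> exists d, cdiff h z d.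
  move=> zw za; have [d' fz] := fd _ za; eexists.
  apply: (@cdiff_scale _ _ (fun u => k u * k u)).
    exact: (cdiff_scale (cdiff_inv zw) (cdiff_inv zw)).
  exact: cdiffB (cdiffB fz (cdiff_cst _ _)) (cdiff_lin _ _ _).
have hs (e : R) : 0 < e -> exists2 r, 0 < r &
     forall z, 0 < cabs (z - w) < r -> N (h z) * cabs (z - w) <= e.
  move=> e0; have [r r0 hr] := fw e e0; exists r => // z /andP[z0 zr].
  have := hr _ zr; rewrite [w + _]addrC subrK => hz.
  rewrite /h rnormZ cabsM !cabsV; move: z0 hz; set c := cabs (z - w); set m := N _ => z0 hz.
  have -> : c^-1 * c^-1 * m * c = m / c by field; rewrite gt_eqF.
  by rewrite ler_pdivrMr.
apply/ler_addgt0Pr => e e0.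
have e4 : 0 < 4 * e by rewrite mulr_gt0.
have [n hn] := outer_vanish hd a0 hs e4.
have hE : h = (fun z => (k z * k z) *: (f z - f w) - (k z : C) *: d).
  apply/funext => z; rewrite /h scalerBr scalerA; congr (_ - _ *: _).
  (* At [z = w] the identity rests on the convention that the inverse of 0 is 0. *)
  have [->|zw] := eqVneq z w; first by rewrite /k subrr mulr0 invr0.
  by rewrite mulfVK// subr_eq0.
move: hn; rewrite hE outerB outer_scale.
set A := outer n w a _; set B := outer n w a _ => hn.
have M0 : 0 <= M.
  by rewrite (le_trans _ (fM w _)) ?rnorm_ge0// subrr cabs0 mulr_ge0// ltW.
have hA : N A <= 8 * (cabs a * (2 * M / cabs a ^+ 2)).
  apply: outer_bound => z /andP[z1 z2]; rewrite rnormZ cabsM cabsV mulrC.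
  apply: ler_pM => //; rewrite ?rnorm_ge0 ?mulr_ge0 ?invr_ge0 ?cabs_ge0//.
    rewrite (le_trans (ler_rnormB _ _))// mulr_natl mulr2n lerD// fM//.
    by rewrite subrr cabs0 mulr_ge0// ltW.
  have z0 : 0 < cabs (z - w) by exact: lt_le_trans z1.
  by rewrite -invfM lef_pV2 ?posrE ?mulr_gt0 ?exprn_gt0// expr2 ler_pM ?cabs_ge0.
have hB := winding_lower n w a0; rewrite -/k -/B in hB.
have := ler_rnorm_subr (B *: d) A; rewrite rnormB rnormZ.
have : 4 * N d <= cabs B * N d by rewrite ler_wpM2r ?rnorm_ge0.
have -> : 4 * M / cabs a = (8 * (cabs a * (2 * M / cabs a ^+ 2))) / 4.
  by field; rewrite gt_eqF.
lra.
Qed.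

End CauchyEstimate.

(** * Holomorphic semigroups satisfy the polynomial condition *)

Section Filters.
Context {R : realType}.
Local Notation C := R[i].

Lemma nbhs_cabsP (z : C) (P : set C) :
  nbhs (z : C^o) P -> exists2 r : R, 0 < r & forall u, cabs (u - z) < r -> P u.
Proof.
move=> /nbhs_ballP[d/= d0 h].
have d1 : d = ((complex.Re d)%:C)%C.
  by rewrite [LHS]complexE (ger0_Im (ltW d0)) mulr0 addr0.
exists (complex.Re d) => [|u uz]; first by move: d0; rewrite d1 ltcR.
by apply: h; rewrite -ball_normE/= d1 -[Num.norm _]/(Num.norm (z - u)) cabsE ltcR cabsB.
Qed.

Lemma cabs_nbhs (z : C) (P : set C) (r : R) : 0 < r ->
  (forall u, cabs (u - z) < r -> P u) -> nbhs (z : C^o) P.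
Proof.
move=> r0 h; apply/nbhs_ballP; exists ((r%:C)%C); first by rewrite /= ltcR.
by move=> u; rewrite -ball_normE/= -[Num.norm _]/(Num.norm (z - u)) cabsE ltcR cabsB; exact: h.
Qed.

(** The argument of x + iy is atan (y / x). In the disc x >= t / 2, so |y / x| <= 2c, and continuity
    of [atan] at 0 gives an admissible c. *)
Lemma sector_disc (delta : R) : 0 < delta -> exists2 c : R, 0 < c < 1 &
  forall (t : R) (z : C), 0 < t -> cabs (z - (t%:C)%C) <= c * t -> sector delta z.
Proof.
move=> d0; have /cvgrPdist_lt/(_ _ d0) := @continuous_atan R 0.
rewrite atan0 => /nbhs_ballP[e/= e0 he].
have eta y : `|y| < e -> `|atan y| < delta.
  by move=> ye; have := he y; rewrite -ball_normE/= sub0r normrN => /(_ ye); rewrite sub0r normrN.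
exists (Num.min 2^-1 (e / 4)) => [|t z t0].
  rewrite lt_min gt_min; apply/andP; split; first by apply/andP; split; lra.
  by apply/orP; left; lra.
set c := Num.min _ _; have [c1 c2] : c <= 2^-1 /\ c <= e / 4.
  by rewrite /c !ge_min !lexx ?orbT.
move=> zt; case: z zt => x y zt.
have xt : `|x - t| <= c * t.
  by apply: (le_trans _ zt); have := ler_Re_cabs ((x +i* y)%C - (t%:C)%C); rewrite [complex.Re _]/=.
have yt : `|y| <= c * t.
  apply: (le_trans _ zt); have := ler_Im_cabs ((x +i* y)%C - (t%:C)%C).
  by rewrite [complex.Im _]/= subr0.
have q1 := ler_wpM2r (ltW t0) c1; have q2 := ler_wpM2r (ltW t0) c2.
have x0 : t / 2 <= x by move: xt; rewrite ler_norml; lra.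
have xp : 0 < x by rewrite (lt_le_trans _ x0)// divr_gt0.
pose th := atan (y / x).
have cth : 0 < cos th by rewrite cos_gt0_pihalf// atan_gtNpi2 atan_ltpi2.
exists (x / cos th), th; split; first by rewrite divr_gt0.
  apply: eta; rewrite normrM normfV (gtr0_norm xp) ltr_pdivrMr//.
  have := ler_wpM2l (ltW e0) x0; have := mulr_gt0 e0 t0; lra.
rewrite divfK ?gt_eqF//; congr (_ +i* _)%C.
rewrite mulrAC -mulrA -/(tan th) /th atanK mulrC divfK// gt_eqF//.
Qed.

End Filters.

Section HolomorphicPart.
Context {R : realType} {X : completeNormedModType R[i]}.
Local Notation C := R[i].
Local Notation N := (@rnorm R X).

Lemma opnorm_ge (S : X -> X) x : N x <= 1 -> ((N (S x))%:E <= opnorm S)%E.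
Proof.
move=> x1; apply: ereal_sup_ubound; exists x => //=.
by rewrite rnormE -[1]/(1%:C)%C lecR.
Qed.

Lemma holomorphic_cdiff (U : set C) (F : C -> {linear X -> X}) z x :
  holomorphic_on U F -> U z -> N x <= 1 -> exists d, cdiff (fun u => F u x) z d.
Proof.
move=> hF Uz x1; have [_ [D [_ hD]]] := hF z Uz; exists (D x) => e e0.
have ne : nbhs (0%E : \bar R) [set y | (y < e%:E)%E].
  by apply: open_ereal_lt'; rewrite lte_fin.
have /nbhs_cabsP[r r0 hr] := hD _ ne; exists r => // h hh.
have [->|h0] := eqVneq h 0; first by rewrite addr0 subrr scale0r subrr rnorm0 cabs0 mulr0.
have := hr h; rewrite subr0 => /(_ hh h0) /= hlt.
have := le_lt_trans (opnorm_ge _ x1) hlt; rewrite lte_fin => /ltW q.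
have -> : F (z + h) x - F z x - h *: D x = h *: (h^-1 *: (F (z + h) x - F z x) - D x).
  by rewrite scalerBr scalerA divff// scale1r.
by rewrite rnormZ mulrC ler_wpM2r// cabs_ge0.
Qed.

(** Otherwise some z_n tending to 0 in [A] violate the bound n, although each orbit [F (z n) x]
    converges and is bounded; this contradicts uniform boundedness. It serves the extension on a
    sector and also [T] itself on the half line. *)
Lemma locally_bounded (A : set C) (F : C -> {linear X -> X}) :
  (forall z, A z -> continuous (F z)) ->
  (forall x, F z x @[z --> within A (nbhs (0 : C^o))] --> x) ->
  exists2 r : R, 0 < r & exists2 M : R, 0 <= M &
    forall z, A z -> cabs z < r -> bd (F z) M.
Proof.
move=> cF F0; apply: contrapT => hN.
have step (n : nat) : exists z, [/\ A z, cabs z < n.+1%:R^-1 & ~ bd (F z) n%:R].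
  apply: contrapT => /forallNP h; apply: hN; exists n.+1%:R^-1; first by rewrite invr_gt0.
  exists n%:R => // z sz zn; apply: contrapT => hz; exact: (h z).
have [z hz] := choice step.
have [i|x|K K0 hK] := @uniform_boundedness R X nat (fun n => F (z n)).
- have [sz _ _] := hz i; have [K K0 hK] := continuous_bd (cF _ sz); by exists K.
- have /cvg_rnormP/(_ 1 ltr01)/nbhs_cabsP[r r0 hr] := F0 x.
  have [n hn] := @inv_small R 1 r r0.
  exists (\sum_(i < n) N (F (z i) x) + (N x + 1)) => i.
  have [ni|] := ltnP i n.
    rewrite (bigD1 (Ordinal ni))//= -addrA lerDl addr_ge0 ?addr_ge0 ?rnorm_ge0//.
    by apply: sumr_ge0 => j _; exact: rnorm_ge0.
  move=> ni; have [sz zi _] := hz i.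
  have := hr (z i); rewrite subr0 => /(_ _ sz) /= q.
  have : N (x - F (z i) x) < 1.
    apply: q; rewrite (lt_trans zi)// (le_lt_trans _ hn)// mul1r.
    by rewrite lef_pV2 ?posrE// ler_nat.
  have := ler_rnorm_subr (F (z i) x) x; rewrite rnormB.
  have : 0 <= \sum_(i < n) N (F (z i) x) by apply: sumr_ge0 => j _; exact: rnorm_ge0.
  lra.
- have [_ _] := hz (Num.truncn K).+1; apply; apply: bd_le (hK _) _.
  exact/ltW/truncnS_gt.
Qed.

End HolomorphicPart.

Section Forward.
Context {R : realType} {X : completeNormedModType R[i]}.
Local Notation C := R[i].
Local Notation N := (@rnorm R X).
Context (T : R -> {linear X -> X}) (hT : strongly_continuous_semigroup T).

Lemma semigroupD s t x : 0 <= s -> 0 <= t -> T (s + t) x = T s (T t x).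
Proof. by case: hT => _ _ h _ s0 t0; exact: h. Qed.

Lemma semigroup0 x : T 0 x = x.
Proof. by case: hT. Qed.

Lemma iter_semigroup n t x : 0 <= t -> iter n (T t) x = T (n%:R * t) x.
Proof.
move=> t0; elim: n => [|n ih]; first by rewrite mul0r semigroup0.
by rewrite /= ih -semigroupD// ?mulr_ge0// -natr1 mulrDl mul1r addrC.
Qed.

Lemma semigroup_telescope m k x : 0 <= k ->
  T (m%:R * k) x - x = \sum_(i < m) T (i%:R * k) (T k x - x).
Proof.
move=> k0; elim: m => [|m ih]; first by rewrite mul0r semigroup0 subrr big_ord0.
rewrite big_ord_recr/= -ih linearB/= -semigroupD ?mulr_ge0//.
by rewrite -natr1 mulrDl mul1r [RHS]addrC addrA subrK.
Qed.

End Forward.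

Section PolyOp.
Context {R : realType} {X : normedModType R[i]}.
Local Notation C := R[i].
Local Notation N := (@rnorm R X).

Lemma poly_op_widen (f : {poly C}) (S : X -> X) m x : (size f <= m)%N ->
  poly_op f S x = \sum_(k < m) f`_k *: iter k S x.
Proof.
move=> fm; rewrite /poly_op (big_ord_widen _ (fun k => f`_k *: iter k S x) fm).
rewrite [RHS](bigID (fun k : 'I_m => (k < size f)%N))/= [X in _ + X]big1 ?addr0//.
by move=> k; rewrite -leqNgt => fk; rewrite nth_default// scale0r.
Qed.

Lemma poly_op_Xn_sub (S : X -> X) n (x : X) :
  poly_op (('X^(n.+1) - 'X^n)%R : {poly C}) S x = iter n.+1 S x - iter n S x.
Proof.
rewrite (@poly_op_widen _ _ n.+2); last first.
  rewrite (leq_trans (size_polyD _ _))// size_polyN !size_polyXn geq_max leqnn/=.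
  exact: leqnSn.
rewrite !big_ord_recr/= big1 => [|k _].
  rewrite !coefB !coefXn !eqxx (ltn_eqF (ltnSn n)) (gtn_eqF (ltnSn n))/=.
  by rewrite subr0 sub0r add0r scaleN1r scale1r addrC.
have kn := ltn_ord k.
by rewrite coefB !coefXn (ltn_eqF kn) (ltn_eqF (leqW kn)) subrr scale0r.
Qed.

Lemma limf_esup_le (f : R -> \bar R) (K : \bar R) (r : R) : 0 < r ->
  (forall t, 0 < t < r -> (f t <= K)%E) -> (limf_esup f (0 : R)^'+ <= K)%E.
Proof.
move=> r0 h; apply: (@le_trans _ _ (ereal_sup (f @` [set t | 0 < t < r]))).
  apply: ereal_inf_lbound; exists [set t | 0 < t < r] => //=.
  by near=> t; apply/andP; split; near: t; [exact: nbhs_right_gt|exact: nbhs_right_lt].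
by apply: ge_ereal_sup => _ [t/= tr <-]; exact: h.
Unshelve. all: by end_near. Qed.

End PolyOp.

Section Forward.
Context {R : realType} {X : completeNormedModType R[i]}.
Local Notation C := R[i].
Local Notation N := (@rnorm R X).
Context (T : R -> {linear X -> X}) (hT : strongly_continuous_semigroup T).

(** The derivative at the single time [t] suffices: the increment over [h] telescopes into
    translates, by bounded operators [T (i k)], of the increment over a short step k, which is
    nearly k d. *)
Lemma semigroup_lipschitz (M K t h : R) x d : 0 < t -> 0 <= h ->
  (forall s, 0 <= s <= h -> bd (T s) M) -> 0 <= M ->
  N d <= K ->
  (forall e : R, 0 < e -> exists2 r : R, 0 < r & forall k : R, 0 <= k < r ->
     N (T (t + k) x - T t x - (k%:C)%C *: d) <= e * k) ->
  N (T (t + h) x - T t x) <= M * K * h.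
Proof.
move=> t0 h0 TM M0 dK hd; apply/ler_addgt0Pr => e e0.
have [|r r0 hr] := hd (e / ((M + 1) * (h + 1))).
  by rewrite divr_gt0// mulr_gt0// ltr_wpDl.
have [m hm] := @inv_small R h r r0.
pose k := h / m.+1%:R; have k0 : 0 <= k by rewrite divr_ge0.
have hmk : h = m.+1%:R * k by rewrite /k mulrC divfK// pnatr_eq0.
have q : N (T (t + k) x - T t x) <= k * (K + e / ((M + 1) * (h + 1))).
  have := hr k; rewrite k0 hm => /(_ isT).
  have := ler_rnorm_subr (T (t + k) x - T t x) ((k%:C)%C *: d).
  rewrite rnormZ cabs_real ger0_norm//; have := ler_wpM2l k0 dK; lra.
rewrite [t + h]addrC {1}hmk (semigroupD hT) ?mulr_ge0 ?(ltW t0)//.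
rewrite (semigroup_telescope hT)// (le_trans (rnorm_sum _ _ _))//.
apply: (@le_trans _ _ (\sum_(i < m.+1) M * (k * (K + e / ((M + 1) * (h + 1)))))).
  apply: ler_sum => i _.
  have im : 0 <= i%:R * k <= h.
    by rewrite mulr_ge0//= hmk ler_wpM2r// ler_nat ltnW.
  rewrite (le_trans (TM _ im _))// ler_wpM2l//.
  by rewrite -(semigroupD hT) ?(ltW t0)// [k + t]addrC.
rewrite sumr_const card_ord -mulr_natl.
have -> : m.+1%:R * (M * (k * (K + e / ((M + 1) * (h + 1))))) =
  M * K * (m.+1%:R * k) + e * ((M / (M + 1)) * (m.+1%:R * k / (h + 1))).
  by field; rewrite !gt_eqF// ltr_wpDl.
rewrite -hmk lerD2l ler_piMr ?(ltW e0)// mulr_ile1 ?divr_ge0 ?addr_ge0//.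
  by rewrite ler_pdivrMr ?ltr_wpDl// mul1r lerDl.
by rewrite ler_pdivrMr ?ltr_wpDl// mul1r lerDl.
Qed.

Lemma holomorphic_semigroup_bound : holomorphic_semigroup T ->
  exists2 r : R, 0 < r & exists2 K : R, 0 <= K & forall t h : R, 0 < t -> 0 < h ->
    t + h < r -> forall x, N x <= 1 -> N (T (t + h) x - T t x) <= K * h / t.
Proof.
move=> [delta [H [/andP[d0 dpi] hol HT H0]]].
(* Strong continuity at 0 is granted only along sectors strictly smaller than [delta]. *)
have d20 : 0 < delta / 2 by rewrite divr_gt0.
have sub z : sector (delta / 2) z -> sector delta z.
  move=> [r [th [r0 th0 ->]]]; exists r, th; split => //.
  by rewrite (lt_le_trans th0)// ler_pdivrMr// ler_pMr// ler1n.
have [|x|r r0 [M M0 HM]] := @locally_bounded _ _ (sector (delta / 2)) H.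
- by move=> z /sub/hol[].
- by apply: H0; rewrite d20/= ltr_pdivrMr// ltr_pMr// ltr1n.
have [c /andP[c0 c1] hc] := sector_disc d20.
(* The added 1 accounts for [T 0 = id], as 0 is not in the sector. *)
pose M1 := M + 1.
have TM s : 0 <= s < r -> bd (T s) M1.
  move=> /andP[s0 sr]; have [->|sn] := eqVneq s 0.
    by move=> x; rewrite (semigroup0 hT) ler_peMl ?rnorm_ge0// /M1 lerDr.
  have sp : 0 < s by rewrite lt_def sn.
  have sH : sector (delta / 2) ((s%:C)%C).
    by apply: (hc s) => //; rewrite subrr cabs0 mulr_ge0// ltW.
  move=> x; rewrite -HT// (le_trans (HM _ sH _ _))//.
    by rewrite cabs_real gtr0_norm.
  by rewrite ler_wpM2r ?rnorm_ge0// /M1 lerDl.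
have M10 : 0 <= M1 by rewrite /M1 addr_ge0.
exists (r / 2); first by rewrite divr_gt0.
exists (M1 * (4 * M / (c / 2))).
  have c2 : 0 <= c / 2 by rewrite divr_ge0// ltW.
  by rewrite mulr_ge0// divr_ge0// mulr_ge0.
move=> t h t0 h0 thr x x1.
have tC : cabs ((t%:C)%C : C) = t by rewrite cabs_real gtr0_norm.
have disc z : cabs (z - (t%:C)%C) <= c * t -> sector (delta / 2) z /\ cabs z < r.
  move=> zt; split; first exact: hc zt.
  have := ler_cabs_subr z ((t%:C)%C); rewrite tC.
  have : c * t <= t by rewrite ler_piMl ?(ltW t0)// ltW.
  lra.
(* The Cauchy estimate lives on the disc of radius 2 |a|, here [c * t]. *)
pose a : C := (((c * t / 2) : R)%:C)%C.
have ct : 0 < c * t / 2 by rewrite divr_gt0// mulr_gt0.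
have ca : cabs a = c * t / 2 by rewrite cabs_real gtr0_norm.
have ca2 : 2 * cabs a = c * t by rewrite ca mulrC divfK.
have st : sector (delta / 2) ((t%:C)%C).
  by have [] := disc ((t%:C)%C); rewrite ?subrr ?cabs0 ?mulr_ge0// ltW.
have [d hd] := holomorphic_cdiff hol (sub _ st) x1.
have dn : N d <= 4 * M / cabs a.
  apply: (cauchy_estimate _ _ _ hd); first by rewrite -cabs_eq0 ca gt_eqF.
    move=> z; rewrite ca2 => /disc[sz zr]; rewrite (le_trans (HM _ sz zr _))//.
    by rewrite ler_piMr.
  by move=> z; rewrite ca2 => /disc[sz zr]; exact: holomorphic_cdiff hol (sub _ sz) x1.
have -> : M1 * (4 * M / (c / 2)) * h / t = M1 * (4 * M / cabs a) * h.
  by rewrite ca; field; rewrite !gt_eqF.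
apply: (semigroup_lipschitz t0 (ltW h0) _ M10 dn).
  by move=> s /andP[s0 sh]; apply: TM; rewrite s0; lra.
move=> e e0; have [s s0 hs] := hd e e0; exists s => // k /andP[k0 ks].
have := hs ((k%:C)%C); rewrite cabs_real ger0_norm// => /(_ ks).
by rewrite -realcD !HT// ltr_wpDr.
Qed.

Lemma holomorphic_semigroup_limsup : holomorphic_semigroup T ->
  exists f : {poly C},
    (limf_esup (fun t : R => opnorm (poly_op f (T t))) (0 : R)^'+ < disk_norm f)%E.
Proof.
move=> /holomorphic_semigroup_bound[r r0 [K K0 hK]].
have [n hn] := @inv_small R K 1 ltr01.
exists ('X^(n.+2) - 'X^(n.+1))%R; apply: (@le_lt_trans _ _ 1%E).
  apply: (@limf_esup_le _ _ _ (r / n.+2%:R)); first by rewrite divr_gt0.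
  move=> t /andP[t0 tr]; apply: ge_ereal_sup => _ [x/= x1 <-]; rewrite lee_fin.
  have {}x1 : N x <= 1 by move: x1; rewrite rnormE -[1]/(1%:C)%C lecR.
  rewrite poly_op_Xn_sub !(iter_semigroup hT) ?(ltW t0)//.
  rewrite -[n.+2%:R]natr1 mulrDl mul1r.
  have nt : 0 < n.+1%:R * t by rewrite mulr_gt0.
  rewrite (le_trans (hK _ _ nt t0 _ _ x1))//.
    by rewrite -{2}[t]mul1r -mulrDl natr1 mulrC -ltr_pdivlMr.
  have -> : K * t / (n.+1%:R * t) = K / n.+1%:R.
    rewrite -[n.+1%:R]natr1; set m : R := n%:R.
    by field; rewrite gt_eqF// gt_eqF// ltr_wpDl// ler0n.
  exact: ltW.
apply: (@lt_le_trans _ _ 2%:E); first by rewrite lte_fin ltr1n.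
apply: ereal_sup_ubound; exists (-1) => /=; first by rewrite normrN normr1.
congr (_%:E); apply: (_ : cabs _ = 2).
rewrite hornerD hornerN !hornerXn exprS mulN1r -opprD cabsN.
have -> : (-1) ^+ n.+1 + (-1) ^+ n.+1 = 2%:R * (-1) ^+ n.+1 :> C by rewrite mulr_natl mulr2n.
by rewrite cabsM cabs_nat cabsX cabsN cabs1 expr1n mulr1.
Qed.

End Forward.

(** * Powers on the unit circle *)

Section UnitCircle.
Context {R : realType}.
Local Notation C := R[i].
Implicit Types (x y : R) (z : C).

Definition expi x : C := (cos x +i* sin x)%C.

Lemma expiD x y : expi (x + y) = expi x * expi y.
Proof. by rewrite /expi cosD sinD; apply/eqP; rewrite eq_complex/= addrC eqxx/= addrC. Qed.

Lemma expi0 : expi 0 = 1.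
Proof. by rewrite /expi cos0 sin0. Qed.

Lemma expi_pi : expi pi = -1.
Proof. by rewrite /expi cospi sinpi; apply/eqP; rewrite eq_complex/= oppr0 !eqxx. Qed.

Lemma cabs_expi x : cabs (expi x) = 1.
Proof. by rewrite cabs_sqrt/= cos2Dsin2 sqrtr1. Qed.

Lemma expi_natM n x : expi (n%:R * x) = expi x ^+ n.
Proof.
elim: n => [|n ih]; first by rewrite mul0r expi0.
by rewrite -natr1 mulrDl mul1r expiD ih exprSr.
Qed.

Lemma expiN x : expi (- x) * expi x = 1.
Proof. by rewrite -expiD addNr expi0. Qed.

Lemma expi_2pi : expi (2 * pi) = 1.
Proof. by rewrite expi_natM expi_pi expr2 mulrNN mulr1. Qed.

Lemma expi_2piz (s : int) : expi (2 * pi * s%:~R) = 1.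
Proof.
have h n : expi (2 * pi * n%:R) = 1 by rewrite mulrC expi_natM expi_2pi expr1n.
case: s => n; first exact: h.
by rewrite NegzE mulrNz mulrN -[LHS]mulr1 -[X in _ * X](h n.+1) expiN.
Qed.

Lemma sin_le x : `|sin x| <= `|x|.
Proof.
suff h y : 0 <= y -> `|sin y| <= y.
  have [x0|x0] := leP 0 x; first by rewrite (ger0_norm x0) h.
  by rewrite -normrN -sinN (ltr0_norm x0) h// oppr_ge0 ltW.
move=> y0; have [|c _] := @MVT_segment R sin cos 0 y y0 (fun t _ => is_derive_sin t).
  by apply: continuous_subspaceT; exact: continuous_sin.
by rewrite sin0 !subr0 => ->; rewrite normrM (ger0_norm y0) ler_piMl// cos_max.
Qed.

Lemma cabs_expi_sub1 x : cabs (expi x - 1) <= `|x|.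
Proof.
rewrite -(@ler_pXn2r _ 2)// ?nnegrE ?cabs_ge0//.
have -> : cabs (expi x - 1) ^+ 2 = 4 * sin (x / 2) ^+ 2.
  rewrite sqr_cabs/= subr0 {1 2}(_ : x = x / 2 *+ 2); last first.
    by rewrite -mulr_natr divfK.
  rewrite cos_mulr2n sin_mulr2n.
  have := cos2Dsin2 (x / 2); set c := cos _; set s := sin _ => cs.
  have -> : c ^+ 2 = 1 - s ^+ 2 by rewrite -cs addrK.
  have -> : (c * s *+ 2) ^+ 2 = 4 * c ^+ 2 * s ^+ 2 by rewrite -mulr_natr; ring.
  have -> : c ^+ 2 = 1 - s ^+ 2 by rewrite -cs addrK.
  by rewrite -mulr_natr; ring.
rewrite -(real_normK (num_real (sin _))).
have -> : `|x| ^+ 2 = 4 * `|x / 2| ^+ 2.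
  by rewrite normrM normfV (ger0_norm (ler0n R 2)); field.
rewrite ler_wpM2l// ler_pXn2r ?nnegrE//; exact: sin_le.
Qed.

Lemma cabs_expiB x y : cabs (expi x - expi y) <= `|x - y|.
Proof.
have -> : expi x - expi y = (expi (x - y) - 1) * expi y.
  by rewrite mulrBl -expiD subrK mul1r.
by rewrite cabsM cabs_expi mulr1 cabs_expi_sub1.
Qed.

Lemma expi_neq1 x : 0 < x < 2 * pi -> expi x != 1.
Proof.
move=> /andP[x0 x2]; apply/eqP => -[h1 h2].
have [xp|xp|xp] := ltgtP x pi.
- by have := @sin_gt0_pi R x; rewrite x0 xp h2 ltxx => /(_ isT).
- have := @sin_gt0_pi R (x - pi); rewrite subr_gt0 xp ltrBlDr -mulr2n -mulr_natl x2.
  move=> /(_ isT); have := sinDpi (x - pi); rewrite subrK h2 => /esym/eqP.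
  by rewrite oppr_eq0 => /eqP ->; rewrite ltxx.
- by move: h1; rewrite xp cospi; lra.
Qed.

Lemma expi_surj z : cabs z = 1 -> exists2 x, 0 <= x < 2 * pi & z = expi x.
Proof.
move=> z1; case: z z1 => a b z1.
have ab : a ^+ 2 + b ^+ 2 = 1 by have := sqr_cabs (a +i* b)%C; rewrite z1 expr1n.
have a1 : -1 <= a <= 1.
  by have := ler_Re_cabs (a +i* b)%C; rewrite z1 ler_norml.
have pi0 := pi_gt0 R.
have [th0 thp] := (acos_ge0 a1, acos_lepi a1).
have cth : cos (acos a) = a by apply: acosK; rewrite in_itv.
have sth : sin (acos a) = `|b|.
  by rewrite sin_acos// -sqrtr_sqr -ab addrAC subrr add0r.
have [b0|b0] := leP 0 b.
  exists (acos a); first by apply/andP; split => //; lra.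
  by rewrite /expi cth sth ger0_norm.
have tp : 0 < acos a.
  rewrite lt_def th0 andbT; apply/eqP => t0.
  by move: sth; rewrite t0 sin0 => /esym/eqP; rewrite normr_eq0 (lt_eqF b0).
exists (2 * pi - acos a); first by apply/andP; split; lra.
rewrite expiD expi_2pi mul1r.
by rewrite /expi cosN sinN cth sth ltr0_norm// opprK.
Qed.

Lemma cabs_expr_sub1 z n : cabs z = 1 -> cabs (z ^+ n - 1) <= n%:R * cabs (z - 1).
Proof.
move=> z1; rewrite subrX1 cabsM mulrC ler_wpM2r ?cabs_ge0//.
rewrite (le_trans (cabs_sum _ _ _))//.
rewrite (eq_bigr (fun=> 1)); last by move=> i _; rewrite cabsX z1 expr1n.
by rewrite sumr_const card_ord.
Qed.

(** Pigeonhole: the fractional parts of 0, y, ..., Q y fall into Q boxes. *)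
Lemma dirichlet y Q : (0 < Q)%N ->
  exists q (s : int), (0 < q <= Q)%N /\ `|q%:R * y - s%:~R| <= Q%:R^-1.
Proof.
move=> Q0; have Qr : 0 < Q%:R :> R by rewrite ltr0n.
pose fr (i : nat) : R := i%:R * y - (Num.floor (i%:R * y))%:~R.
have fr01 i : 0 <= fr i < 1.
  have := floor_itv (i%:R * y); rewrite intrD /fr; lra.
have trQ i : (Num.truncn (Q%:R * fr i) < Q)%N.
  have /andP[f0 f1] := fr01 i; have Qf : 0 <= Q%:R * fr i by rewrite mulr_ge0// ltW.
  rewrite -(ltr_nat R); have /andP[/le_lt_trans + _] := truncn_itv Qf; apply.
  by rewrite -[ltRHS]mulr1 ltr_pM2l.
pose g (i : 'I_Q.+1) : 'I_Q := Ordinal (trQ i).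
have /injectivePn[i [j ij gij]] : ~~ injectiveb g.
  apply/negP => /injectiveP/leq_card; rewrite !card_ord ltnn//.
wlog ji : i j ij gij / (j < i)%N.
  move=> h; have := ij; rewrite neq_ltn => /orP[ij'|ij'].
    by apply: (h j i) => //; rewrite eq_sym.
  exact: (h i j).
exists (i - j)%N, (Num.floor (i%:R * y) - Num.floor (j%:R * y)); split.
  by rewrite subn_gt0 ji/= (leq_trans (leq_subr _ _))// -ltnS.
rewrite natrB ?(ltnW ji)// intrB.
have -> : (i%:R - j%:R) * y - ((Num.floor (i%:R * y))%:~R - (Num.floor (j%:R * y))%:~R)
  = fr i - fr j by rewrite /fr; ring.
have e : Num.truncn (Q%:R * fr i) = Num.truncn (Q%:R * fr j).
  by have := congr1 val gij.
have [/andP[i0 _] /andP[j0 _]] := (fr01 i, fr01 j).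
have := truncn_itv (mulr_ge0 (ltW Qr) i0); have := truncn_itv (mulr_ge0 (ltW Qr) j0).
rewrite e -natr1 => h1 h2; rewrite -[leRHS]mul1r ler_pdivlMr//.
rewrite -[X in _ * X]gtr0_norm// -normrM mulrBl ler_norml; lra.
Qed.

(* Every root of unity of order at most [Q] is killed by [p = Q!]; the remaining
   points of the circle have powers that wind around it in steps of length at most
   [kappa], by Dirichlet's theorem. *)
Lemma circle_power_near (kappa : R) : 0 < kappa ->
  exists p (C1 : R), [/\ (0 < p)%N, 0 < C1 & forall z u : C, cabs z = 1 -> cabs u = 1 ->
    u ^+ p != 1 -> exists m, [/\ (0 < m)%N, m%:R <= C1 / cabs (u ^+ p - 1)
      & cabs (u ^+ m - z) <= kappa]].
Proof.
move=> k0; have pi0 := pi_gt0 R.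
have [n hn] := inv_small (2 * pi) k0; pose Q := n.+1; pose p := Q`!.
have Qr : 0 < Q%:R :> R by rewrite ltr0n.
exists p, (Q%:R * (2 * pi * p%:R + 2)); split; first exact: fact_gt0.
  by rewrite mulr_gt0// ltr_wpDl// !mulr_ge0// pi_ge0.
move=> z u z1 u1 up; have [b _ ub] := expi_surj u1.
have [q [s [/andP[q0 qQ] hq]]] := @dirichlet (b / (2 * pi)) Q (ltn0Sn n).
pose al := q%:R * b - 2 * pi * s%:~R.
have alE : al = 2 * pi * (q%:R * (b / (2 * pi)) - s%:~R).
  by move: pi0; rewrite /al; generalize (@pi R) => P P0; field; exact: lt0r_neq0.
have eal : expi al = u ^+ q.
  by rewrite ub -expi_natM /al expiD -mulrN -mulrNz expi_2piz mulr1.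
have al_k : `|al| <= kappa.
  rewrite alE normrM gtr0_norm ?mulr_gt0// (le_trans _ (ltW hn))//.
  by rewrite ler_wpM2l// mulr_ge0// ltW.
have [k pk] : exists k, p = (q * k)%N.
  by have /dvdnP[k hk] := @dvdn_fact q Q ltac:(lia); exists k; rewrite /p hk mulnC.
(* This bounds the step length [al] from below by d / p, and hence the number of steps needed to
   reach z. *)
have d1 : cabs (u ^+ p - 1) <= p%:R * `|al|.
  rewrite pk exprM -eal (le_trans (cabs_expr_sub1 _ (cabs_expi _)))//.
  rewrite ler_pM ?cabs_ge0 ?cabs_expi_sub1// ler_nat leq_pmull//.
set d := cabs _ in d1 *.
have d0 : 0 < d by rewrite cabs_gt0 subr_eq0.
have d2 : d <= 2.
  have := ler_cabsB (u ^+ p) 1; rewrite -/d cabsX u1 expr1n cabs1; lra.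
have al0 : 0 < `|al|.
  rewrite normr_gt0; apply/eqP => al0; move: d1; rewrite al0 normr0 mulr0; lra.
(* An argument of z on the same side as [al], so that positive multiples of [al] move towards it. *)
have [th [th1 th2 zth]] : exists th : R, [/\ 0 <= th / al, `|th| <= 2 * pi & z = expi th].
  have [x /andP[x0 x2] zx] := expi_surj z1.
  have [a0|a0] := ltP 0 al.
    by exists x; split => //; rewrite ?divr_ge0 ?(ltW a0)// ger0_norm// ltW.
  exists (x - 2 * pi); split.
  - by rewrite mulr_le0// ?invr_le0//; lra.
  - by rewrite ler0_norm; lra.
  - by rewrite expiD -zx -[expi (- _)]mulr1; have := expiN (2 * pi); rewrite expi_2pi => ->; rewrite mulr1.
(* Overshooting by at most one step keeps [j] positive. The extra step is paid for by [1 <= 2 / d],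
   the source of the 2 added in the constant; the factor [Q] bounds [q]. *)
pose j := (Num.truncn (th / al)).+1.
have /andP[j1 j2] := truncn_itv th1.
have aln : al != 0 by rewrite -normr_gt0.
exists (q * j)%N; split; [by rewrite muln_gt0 q0| |]; last first.
  rewrite exprM -eal -expi_natM zth (le_trans (cabs_expiB _ _))// (le_trans _ al_k)//.
  have -> : j%:R * al - th = (j%:R - th / al) * al by field.
  rewrite normrM ler_piMl// ger0_norm ?subr_ge0 ?(ltW j2)// /j -natr1; lra.
have jb : j%:R <= (2 * pi * p%:R + 2) / d.
  have h1 : th / al <= 2 * pi * p%:R / d.
    rewrite (le_trans (ler_norm _))// normrM normfV -[leRHS]mulrA.
    apply: ler_pM => //; rewrite ?invr_ge0//.
    rewrite ler_pdivlMr// mulrC ler_pdivrMr//.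
  have h2 : 1 <= 2 / d by rewrite ler_pdivlMr// mul1r.
  rewrite mulrDl /j -natr1; lra.
by rewrite natrM -mulrA ler_pM// ler_nat.
Qed.

End UnitCircle.

(** * Partial fractions and the maximum principle *)

Section PartialFractions.
Context {R : realType}.
Local Notation C := R[i].

Definition root_of_unity (N : nat) : C := expi (2 * pi / N%:R).

Lemma root_of_unityX N : (0 < N)%N -> root_of_unity N ^+ N = 1.
Proof.
by move=> N0; rewrite /root_of_unity -expi_natM mulrC divfK ?expi_2pi// pnatr_eq0 -lt0n.
Qed.

Lemma root_of_unity_neq1 N j : (0 < j < N)%N -> root_of_unity N ^+ j != 1.
Proof.
move=> /andP[j0 jN]; rewrite /root_of_unity -expi_natM.
have N0 : 0 < N%:R :> R by rewrite ltr0n (leq_trans _ jN).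
have pi0 : 0 < 2 * pi :> R by rewrite mulr_gt0// pi_gt0.
apply: expi_neq1; apply/andP; split.
  by rewrite mulr_gt0 ?ltr0n// divr_gt0.
by rewrite mulrCA gtr_pMr// ltr_pdivrMr// mul1r ltr_nat.
Qed.

(** The range [m < 2 * N] is that of the exponents [N + j - i] in [partial_fractions]. *)
Lemma root_power_sum N (z mu0 : C) m : (0 < m < 2 * N)%N -> mu0 ^+ N = z ->
  \sum_(k < N) (mu0 * root_of_unity N ^+ k) ^+ m = if m == N then N%:R * z else 0.
Proof.
move=> /andP[m0 m2] muN; have N0 : (0 < N)%N by case: N m2 {muN} => //; rewrite muln0.
under eq_bigr => k _ do rewrite exprMn exprAC.
rewrite -big_distrr/=; case: eqP => [->|mN].
  by rewrite root_of_unityX// (eq_bigr (fun=> 1)) ?sumr_const ?card_ord ?muN 1?mulrC// => k _; rewrite expr1n.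
have w1 : root_of_unity N ^+ m != 1.
  have [mN'|Nm] := ltnP m N; first by rewrite root_of_unity_neq1// m0.
  rewrite -(subnK Nm) exprD root_of_unityX// mulr1 root_of_unity_neq1//; lia.
suff -> : \sum_(k < N) (root_of_unity N ^+ m) ^+ k = 0 by rewrite mulr0.
apply: (@mulfI _ (root_of_unity N ^+ m - 1)); first by rewrite subr_eq0.
by rewrite -subrX1 exprAC root_of_unityX// expr1n subrr mulr0.
Qed.

Context {B : comPzRingType} (iota : {rmorphism C -> B}).

(** Discrete Fourier inversion: each term is the geometric sum (mu^N - S^N) / (mu - S), and summing
    over the N-th roots mu of z kills every power of S but the j-th. With [B] the complex numbers it
    acts as Cauchy's formula, with [j = 0] it gives the resolvent of a power, and with [j = l - 1],
    [N = 2 l] it gives the Fourier inversion of [ritt_estimate]. *)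
Lemma partial_fractions N (z mu0 : C) (S : B) (r : nat -> B) j : (j < N)%N ->
  mu0 ^+ N = z ->
  (forall k, r k * (iota (mu0 * root_of_unity N ^+ k) - S) = 1) ->
  (\sum_(k < N) iota ((mu0 * root_of_unity N ^+ k) ^+ j.+1) * r k) * (iota z - S ^+ N)
  = iota (N%:R * z) * S ^+ j.
Proof.
move=> jN muN hr; have N0 : (0 < N)%N by rewrite (leq_trans _ jN).
pose mu k := mu0 * root_of_unity N ^+ k.
have mukN k : mu k ^+ N = z.
  by rewrite /mu exprMn muN exprAC root_of_unityX// expr1n mulr1.
rewrite big_distrl/=.
have e (k : 'I_N) : iota ((mu0 * root_of_unity N ^+ k) ^+ j.+1) * r k * (iota z - S ^+ N)
   = \sum_(i < N) iota (mu k ^+ (N + j - i)) * S ^+ i.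
  have -> : iota z - S ^+ N = iota (mu k) ^+ N - S ^+ N by rewrite -rmorphXn/= mukN.
  rewrite subrXX -/(mu k) -mulrA (mulrA (r k)) hr mul1r.
  rewrite mulr_sumr; apply: eq_bigr => i _; rewrite mulrA; congr (_ * _).
  rewrite -rmorphXn/= -rmorphM/= -exprD; congr (iota (_ ^+ _)); have := ltn_ord i; lia.
rewrite (eq_bigr _ (fun k _ => e k)) exchange_big/=.
have e2 (i : 'I_N) : \sum_(k < N) iota (mu k ^+ (N + j - i)) * S ^+ i
   = (if i == Ordinal jN then iota (N%:R * z) * S ^+ j else 0).
  rewrite -mulr_suml -rmorph_sum/= (@root_power_sum _ z)//; last by have := ltn_ord i; lia.
  case: (i =P Ordinal jN) => [->|ij] /=; first by rewrite addnK eqxx.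
  rewrite ifF ?rmorph0 ?mul0r//; apply/eqP => h; apply: ij; apply: val_inj => /=.
  by have := ltn_ord i; lia.
by rewrite (eq_bigr _ (fun k _ => e2 k)) -big_mkcond/= big_pred1_eq.
Qed.

End PartialFractions.

Section MaximumPrinciple.
Context {R : realType}.
Local Notation C := R[i].

(** A discrete Cauchy formula, exact because [N] exceeds the degree: N f(z) is the sum of f(w^k) w^k
    (1 - z^N) / (w^k - z). The 2 bounds |1 - z^N|. *)
Lemma poly_circle_bound (f : {poly C}) (z : C) (L : R) : cabs z < 1 ->
  (forall u, cabs u = 1 -> cabs f.[u] <= L) -> cabs f.[z] <= 2 * L / (1 - cabs z).
Proof.
move=> z1 fL; pose N := (size f).+1.
have Nr : (N%:R : C) != 0 by rewrite pnatr_eq0.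
pose w : C := root_of_unity N.
have w1 k : cabs (w ^+ k) = 1 by rewrite cabsX cabs_expi expr1n.
have d0 : 0 < 1 - cabs z by rewrite subr_gt0.
have wz k : 1 - cabs z <= cabs (w ^+ k - z) by have := ler_cabs_subr (w ^+ k) z; rewrite w1.
have wz0 k : w ^+ k - z != 0 by rewrite -cabs_gt0 (lt_le_trans d0).
have hr k : (w ^+ k - z)^-1 * (idfun (1 * w ^+ k) - z) = 1 by rewrite mul1r mulVf.
have pf (j : 'I_N) := @partial_fractions R C idfun N 1 1 z (fun k => (w ^+ k - z)^-1) j (ltn_ord j)
  (expr1n _ _) hr.
have e : \sum_(k < N) f.[w ^+ k] * (w ^+ k / (w ^+ k - z)) * (1 - z ^+ N) = N%:R * f.[z].
  rewrite (horner_coef_wide z (leqnSn (size f))) mulr_sumr.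
  under [RHS]eq_bigr => j _.
    have -> : N%:R * (f`_j * z ^+ j) = f`_j * (N%:R * 1 * z ^+ j) by ring.
    have /= <- := pf j; rewrite mulr_suml mulr_sumr.
    over.
  rewrite exchange_big/=; apply: eq_bigr => k _.
  rewrite (horner_coef_wide _ (leqnSn (size f))) 2!mulr_suml; apply: eq_bigr => j _.
  by rewrite mul1r exprSr exprAC exprAC; ring.
suff : cabs (N%:R * f.[z]) <= N%:R * (2 * L / (1 - cabs z)).
  by rewrite cabsM cabs_nat ler_pM2l// ltr0n.
rewrite -e (le_trans (cabs_sum _ _ _))//.
apply: (@le_trans _ _ (\sum_(k < N) 2 * L / (1 - cabs z))); last first.
  by rewrite sumr_const card_ord [leRHS]mulr_natl.
apply: ler_sum => k _; rewrite !cabsM w1 mul1r cabsV.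
have -> : 2 * L / (1 - cabs z) = L * (1 - cabs z)^-1 * 2 by ring.
have L0 : 0 <= L by rewrite (le_trans _ (fL 1 cabs1))// cabs_ge0.
apply: ler_pM; rewrite ?mulr_ge0 ?invr_ge0 ?cabs_ge0//.
  apply: ler_pM; rewrite ?invr_ge0 ?cabs_ge0//; first exact: fL.
  by rewrite lef_pV2// posrE (lt_le_trans d0).
rewrite (le_trans (ler_cabsB _ _))// cabs1 cabsX -[leRHS]/(1 + 1) lerD2l.
by rewrite exprn_ile1 ?cabs_ge0// ltW.
Qed.

(* The bound [poly_circle_bound] for all powers of [f] removes the constant. *)
Lemma maximum_principle (f : {poly C}) (z : C) (L : R) : 0 <= L -> cabs z <= 1 ->
  L < cabs f.[z] -> exists2 u, cabs u = 1 & L < cabs f.[u].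
Proof.
move=> L0; rewrite le_eqVlt => /orP[/eqP z1 fz|z1 fz]; first by exists z.
apply: contrapT => hN.
have fL u : cabs u = 1 -> cabs f.[u] <= L.
  by move=> u1; rewrite leNgt; apply/negP => h; apply: hN; exists u.
have fz0 : 0 < cabs f.[z] by exact: le_lt_trans fz.
have hm m : cabs f.[z] ^+ m <= 2 / (1 - cabs z) * L ^+ m.
  rewrite -cabsX -horner_exp [leRHS]mulrAC; apply: poly_circle_bound => // u u1.
  by rewrite horner_exp cabsX; apply: lerXn2r; rewrite ?nnegrE ?cabs_ge0// fL.
have [n] := @expr_small R (L / cabs f.[z]) (2 / (1 - cabs z)) 1
  ltac:(by rewrite divr_ge0 ?cabs_ge0//= ltr_pdivrMr// mul1r) ltr01.
apply/negP; rewrite -leNgt exprMn exprVn mulrA ler_pdivlMr ?exprn_gt0// mul1r.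
exact: hm.
Qed.

End MaximumPrinciple.

(** * From invertibility at one point to difference bounds *)

Section Resolvents.
Context {R : realType}.
Local Notation C := R[i].
Context {B : comPzRingType} (iota : {rmorphism C -> B}) (bdB : B -> R -> Prop).
Context (bdB_iota : forall c, bdB (iota c) (cabs c)).
Context (bdBD : forall a b K L, bdB a K -> bdB b L -> bdB (a + b) (K + L)).
Context (bdBM : forall a b K L, 0 <= K -> bdB a K -> bdB b L -> bdB (a * b) (K * L)).
Context (bdB_le : forall a K L, bdB a K -> K <= L -> bdB a L).
Context (bdB_neumann : forall a q, 0 <= q < 1 -> bdB a q ->
  exists2 v, v * (1 - a) = 1 & bdB v (1 - q)^-1).

Implicit Types (mu nu z : C) (S a b r : B) (K M : R).

Definition has_res mu S K := exists2 r, r * (iota mu - S) = 1 & bdB r K.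

Lemma bdBN a K : bdB a K -> bdB (- a) K.
Proof.
move=> aK; have h : bdB (-1) 1 by have := bdB_iota (-1); rewrite rmorphN rmorph1 cabsN cabs1.
by rewrite -mulN1r -[X in bdB _ X]mul1r; exact: bdBM.
Qed.

Lemma bdB1 : bdB 1 1.
Proof. by have := bdB_iota 1; rewrite rmorph1 cabs1. Qed.

Lemma bdB0 : bdB 0 0.
Proof. by have := bdB_iota 0; rewrite rmorph0 cabs0. Qed.

Lemma bdB_sum n (F : nat -> B) (k : nat -> R) : (forall i, (i < n)%N -> bdB (F i) (k i)) ->
  bdB (\sum_(i < n) F i) (\sum_(i < n) k i).
Proof.
elim: n => [|n ih] h; first by rewrite !big_ord0; exact: bdB0.
rewrite !big_ord_recr/=; apply: bdBD; last exact: h.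
by apply: ih => i ni; apply: h; exact: ltnW.
Qed.

(** With r the inverse of z - S, one has mu - S = (z - S) (1 - (z - mu) r), and the last factor is
    inverted by the Neumann series. *)
Lemma res_perturb z mu S K : 0 <= K -> cabs (mu - z) * K <= 2^-1 ->
  has_res z S K -> has_res mu S (2 * K).
Proof.
move=> K0 h [r rz rK].
have [||v v1 v2] := @bdB_neumann (iota (z - mu) * r) 2^-1.
- by apply/andP; split; lra.
- apply: bdB_le h; rewrite cabsB.
  by apply: bdBM => //; exact: cabs_ge0.
exists (v * r).
  rewrite -{}v1 -[in RHS]rz rmorphB.
  transitivity (v * r * (iota mu - S) + v * (r * (iota z - S))
    - v * (r * (iota z - S))); first by ring.
  ring.
apply: bdBM => //; apply: bdB_le v2 _.
by rewrite (_ : 1 - 2^-1 = 2^-1 :> R) ?invrK//; lra.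
Qed.

Lemma res_pow m nu S K M : cabs nu = 1 -> 0 <= K -> 
  (forall i, (i < m)%N -> bdB (S ^+ i) M) ->
  has_res (nu ^+ m) (S ^+ m) K -> has_res nu S (K * (m%:R * M)).
Proof.
move=> nu1 K0 hS [r rm rK]; exists (r * \sum_(i < m) iota nu ^+ (m.-1 - i) * S ^+ i).
  by rewrite -rm rmorphXn/= subrXX; ring.
apply: bdBM => //.
have -> : m%:R * M = \sum_(i < m) 1 * M by rewrite sumr_const card_ord mul1r mulr_natl.
apply: (@bdB_sum m (fun i => iota nu ^+ (m.-1 - i) * S ^+ i) (fun=> 1 * M)) => i im.
apply: bdBM => //; last exact: hS.
by rewrite -rmorphXn/=; have := bdB_iota (nu ^+ (m.-1 - i)); rewrite cabsX nu1 expr1n.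
Qed.

(** The resolvent of S^p at mu is 1 / (p mu) times the sum of nu (nu - S)^-1 over the p-th roots nu
    of mu: an average up to unimodular factors, so [K] does not grow. *)
Lemma res_root p mu mu0 S K : (0 < p)%N -> cabs mu = 1 -> mu0 ^+ p = mu -> 0 <= K ->
  (forall nu, nu ^+ p = mu -> has_res nu S K) -> has_res mu (S ^+ p) K.
Proof.
move=> p0 mu1 mu0p K0 h; pose nu k := mu0 * root_of_unity p ^+ k.
have nup k : nu k ^+ p = mu by rewrite exprMn mu0p exprAC root_of_unityX// expr1n mulr1.
have nu1 k : cabs (nu k) = 1.
  apply/eqP; rewrite -(@eqrXn2 _ p)// ?cabs_ge0// -cabsX nup mu1 expr1n//.
have hk k : exists r, r * (iota (nu k) - S) = 1 /\ bdB r K.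
  by have [r r1 rK] := h _ (nup k); exists r.
have [r hr] := choice hk.
have := @partial_fractions R B iota p mu mu0 S r 0 p0 mu0p (fun k => proj1 (hr k)).
rewrite mulr1 => pf.
have pm0 : p%:R * mu != 0.
  by rewrite mulf_neq0 ?pnatr_eq0 -?lt0n// -cabs_eq0 mu1 oner_eq0.
exists (iota (p%:R * mu)^-1 * \sum_(k < p) iota (nu k ^+ 1) * r k).
  by rewrite -mulrA pf -rmorphM mulVf// rmorph1.
have -> : K = cabs (p%:R * mu)^-1 * \sum_(k < p) 1 * K.
  rewrite sumr_const card_ord cabsV cabsM cabs_nat mu1 mulr1 mul1r -[K *+ p]mulr_natl mulrA.
  by rewrite mulVf ?mul1r// pnatr_eq0 -lt0n.
apply: bdBM; [exact: cabs_ge0|exact: bdB_iota|].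
apply: (@bdB_sum p (fun k => iota (nu k ^+ 1) * r k) (fun=> 1 * K)) => k _.
by apply: bdBM => //; [rewrite expr1 -(nu1 k); exact: bdB_iota|exact: (proj2 (hr k))].
Qed.

Lemma periodic_sum_shift (V : zmodType) N (F : nat -> V) : F N = F 0%N ->
  \sum_(k < N) F k.+1 = \sum_(k < N) F k.
Proof.
move=> FN; apply: (@addrI _ (F 0%N)); rewrite -[LHS](big_ord_recl N (fun k : 'I_N.+1 => F k)).
by rewrite big_ord_recr/= FN addrC.
Qed.

(* Parseval, for the N-th roots of -1: [2 / (1 - mu)] is the geometric sum
   [\sum_(i < N) mu ^+ i]. *)
Lemma sum_inv_sqr_dist N mu0 : mu0 ^+ N = -1 ->
  \sum_(k < N) (cabs (mu0 * root_of_unity N ^+ k - 1))^-1 ^+ 2 = N%:R ^+ 2 / 4 :> R.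
Proof.
move=> muN; case: (posnP N) => [->|N0]; first by rewrite big_ord0 expr0n mul0r.
pose mu k := mu0 * root_of_unity N ^+ k.
have mukN k : mu k ^+ N = -1 by rewrite exprMn muN exprAC root_of_unityX// expr1n mulr1.
have N1 : (-1 : C) != 1 by rewrite -subr_eq0 -opprD oppr_eq0 -[1 + 1]/(2%:R) pnatr_eq0.
have mu_ne k : mu k - 1 != 0.
  by apply/eqP => /subr0_eq h; move: (mukN k) N1; rewrite h expr1n => <-; rewrite eqxx.
have mu1 k : cabs (mu k) = 1.
  by apply/eqP; rewrite -(@eqrXn2 _ N)// ?cabs_ge0// -cabsX mukN cabsN cabs1 expr1n.
have conjmu k : (mu k)^*%C * mu k = 1.
  by rewrite mulrC -sqr_normc cabsE mu1 expr1n.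
have key k : (((cabs (mu k - 1))^-1 ^+ 2)%:C)%C
    = - 4^-1 * \sum_(i < N) \sum_(j < N) mu k ^+ (i + N - j) :> C.
  have g1 : \sum_(i < N) mu k ^+ i = - 2 / (mu k - 1).
    apply: (@mulfI _ (mu k - 1)) => //; rewrite -subrX1 mukN mulrC divfK//.
    by rewrite -opprD -[1 + 1]/(2%:R).
  (* Conjugation inverts points of the circle, and mu^N = -1 turns the conjugate of mu^j into -mu^(N
     - j); the squared modulus thus becomes a double sum of pure powers. *)
  have g2 : \sum_(j < N) mu k ^+ (N - j) = - ((\sum_(i < N) mu k ^+ i)^*)%C.
    rewrite rmorph_sum/= -sumrN; apply: eq_bigr => j _.
    rewrite rmorphXn/= -mulN1r -(mukN k) -[LHS]mulr1 -(expr1n _ j) -(conjmu k) [X in _ * X]exprMn.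
    by rewrite mulrCA -exprD subnK 1?mulrC// ltnW.
  have -> : \sum_(i < N) \sum_(j < N) mu k ^+ (i + N - j)
     = (\sum_(i < N) mu k ^+ i) * \sum_(j < N) mu k ^+ (N - j).
    rewrite mulr_suml; apply: eq_bigr => i _; rewrite mulr_sumr; apply: eq_bigr => j _.
    by rewrite -exprD addnBA// ltnW// ltn_ord.
  rewrite g2 mulrN -sqr_normc g1 normrM normfV normrN normr_nat cabsE.
  rewrite rmorphXn fmorphV; set c := ((_)%:C)%C.
  have c0 : c != 0 by rewrite /c -cabsE normr_eq0.
  by field.
apply: (@complexI R); rewrite rmorph_sum/=.
transitivity (\sum_(k < N) (- 4^-1 * \sum_(i < N) \sum_(j < N) mu k ^+ (i + N - j))).
  by apply: eq_bigr => k _; exact: key.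
rewrite -mulr_sumr exchange_big/=.
have e (i : 'I_N) : \sum_(k < N) \sum_(j < N) mu k ^+ (i + N - j) = - N%:R.
  rewrite exchange_big/= (bigD1 i)//= [X in _ + X]big1 => [|j ji].
    rewrite addr0 addnC addnK (@root_power_sum _ _ (-1))//; last by lia.
    by rewrite eqxx mulrN1.
  rewrite (@root_power_sum _ _ (-1))//; last by have := ltn_ord i; have := ltn_ord j; lia.
  rewrite ifF//; apply/eqP => h; move/eqP: ji; apply; apply: val_inj => /=.
  by have := ltn_ord i; have := ltn_ord j; lia.
rewrite (eq_bigr _ (fun i _ => e i)) sumr_const card_ord rmorphM fmorphV rmorphXn !rmorph_nat.
by rewrite -[_ *+ N]mulr_natr; field.
Qed.

(** With [N = 2 l], the exponent [l] makes the Fourier coefficients alternate in sign, as w^l = -1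
    for the primitive N-th root w. The terms (S - 1) (mu - S)^-1 are bounded by 1 + K, and second
    differences contribute |w - 1|^2 <= (pi / l)^2 times K^2 over a product of two distances to 1;
    by [sum_inv_sqr_dist] the alternating sum is bounded independently of [l], and the factor 1 / N
    remains. *)
Lemma ritt_estimate l S K M M1 : (0 < l)%N -> 1 <= K -> 0 <= M -> 0 <= M1 ->
  bdB S M -> bdB (1 + S ^+ (2 * l)) M1 ->
  (forall mu, mu ^+ (2 * l) = -1 -> has_res mu S (K / cabs (mu - 1))) ->
  bdB (S ^+ l.-1 * (S - 1)) ((1 + K) * K ^+ 2 * (1 + M) * pi ^+ 2 * M1 / 8 / l%:R).
Proof.
move=> l0 K1 M0 M10 SM SM1 hres; set N := (2 * l)%N in SM1 hres.
have N0 : (0 < N)%N by rewrite /N; lia.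
have Nr : 0 < N%:R :> R by rewrite ltr0n.
have lr : 0 < l%:R :> R by rewrite ltr0n.
have NlR : N%:R = 2 * l%:R :> R by rewrite /N natrM.
pose w : C := root_of_unity N; pose mu0 : C := expi (pi / N%:R).
have mu0N : mu0 ^+ N = -1 by rewrite -expi_natM mulrC divfK ?expi_pi// gt_eqF.
have wl : w ^+ l = -1.
  rewrite -expi_natM -expi_pi; congr expi; rewrite NlR; field; exact: lt0r_neq0.
have wN : w ^+ N = 1 by exact: root_of_unityX.
pose mu k := mu0 * w ^+ k.
have mukN k : mu k ^+ N = -1 by rewrite exprMn mu0N exprAC wN expr1n mulr1.
have mu1 k : cabs (mu k) = 1 by rewrite cabsM cabsX !cabs_expi expr1n mul1r.
(* Resolvents are chosen per point of the circle and not per index, so that [r] inherits the period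
   [N] of [mu]. Off the roots of -1 the value is the default 0. *)
have hch (m : C) : exists x : B, m ^+ N = -1 ->
    x * (iota m - S) = 1 /\ bdB x (K / cabs (m - 1)).
  have [mN|mN] := pselect (m ^+ N = -1); last by exists 0.
  by have [r r1 r2] := hres _ mN; exists r.
have [rho hrho] := choice hch.
pose r k := rho (mu k).
pose d k := cabs (mu k - 1).
have hr k : r k * (iota (mu k) - S) = 1 by exact: (hrho _ (mukN k)).1.
have rK k : bdB (r k) (K / d k) by exact: (hrho _ (mukN k)).2.
have muP k : mu (k + N)%N = mu k by rewrite /mu exprD wN mulr1.
have muN' : mu N = mu 0%N by rewrite -(muP 0%N).
have muN1 : mu N.+1 = mu 1%N by rewrite -(muP 1%N).
have d0 k : 0 < d k.
  rewrite cabs_gt0; apply/eqP => /subr0_eq h; have /eqP := mukN k.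
  by rewrite h expr1n eq_sym -subr_eq0 -opprD oppr_eq0 -[1 + 1]/(2%:R) pnatr_eq0.
pose a k := (S - 1) * r k.
have pf := @partial_fractions R B iota N (-1) mu0 S r l.-1 ltac:(lia) mu0N hr.
rewrite prednK// in pf.
have mukl k : mu k ^+ l = mu0 ^+ l * (-1) ^+ k by rewrite exprMn exprAC wl.
pose A := \sum_(k < N) (-1) ^+ k * a k.
have SA : S ^+ l.-1 * (S - 1) = iota (N%:R^-1 * mu0 ^+ l) * (A * (1 + S ^+ N)).
  have e1 : \sum_(k < N) iota ((mu0 * root_of_unity N ^+ k) ^+ l) * r k * (S - 1)
     = iota (mu0 ^+ l) * A.
    rewrite /A mulr_sumr; apply: eq_bigr => k _; rewrite -/w -/(mu k) mukl rmorphM.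
    rewrite [iota ((-1) ^+ _)]rmorphXn/=.
    by rewrite rmorphN1 /a; ring.
  have e2 : iota (mu0 ^+ l) * A * (1 + S ^+ N) = iota N%:R * (S ^+ l.-1 * (S - 1)).
    rewrite -e1 -mulr_suml; have -> : iota N%:R = - iota (N%:R * -1) by rewrite mulrN1 rmorphN opprK.
    have <- : - (iota (-1) - S ^+ N) = 1 + S ^+ N by rewrite rmorphN1 opprB opprK addrC.
    by rewrite mulNr mulrA -pf; ring.
  rewrite rmorphM -mulrA (mulrA (iota (mu0 ^+ l))) e2 mulrA -rmorphM mulVf ?rmorph1 ?mul1r//.
  by rewrite pnatr_eq0 -lt0n.
have Neven : (-1) ^+ N = 1 :> B by rewrite /N exprM sqrrN expr1n expr1n.
(* An index shift in an N-periodic alternating sum changes its sign, [N] being even; so the weights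
   1, -2, 1 add up to 4 instead of 0. *)
have A4 : A *+ 4 = \sum_(k < N) (-1) ^+ k * (a k - a k.+1 *+ 2 + a k.+2).
  pose b k := (-1) ^+ k * a k.
  have aN : a N = a 0%N by rewrite /a /r muN'.
  have aN1 : a N.+1 = a 1%N by rewrite /a /r muN1.
  have s1 : \sum_(k < N) b k.+1 = A by apply: periodic_sum_shift; rewrite /b Neven aN expr0.
  have s2 : \sum_(k < N) b k.+2 = A.
    rewrite -s1; apply: (periodic_sum_shift (F := fun k => b k.+1)).
    by rewrite /b aN1 exprS Neven expr1 mulr1.
  have -> : \sum_(k < N) (-1) ^+ k * (a k - a k.+1 *+ 2 + a k.+2)
    = \sum_(k < N) b k + (\sum_(k < N) b k.+1) *+ 2 + \sum_(k < N) b k.+2.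
    rewrite -sumrMnl -!big_split/=; apply: eq_bigr => k _; rewrite /b !exprS.
    by rewrite !mulr2n; ring.
  by rewrite s1 s2 -/A; ring.
pose eta : C := w - 1.
have eta_le : cabs eta <= pi / l%:R.
  rewrite (le_trans (cabs_expi_sub1 _))// ger0_norm ?divr_ge0 ?mulr_ge0 ?pi_ge0//.
  by rewrite NlR; apply: eq_ler; field; exact: lt0r_neq0.
(* Second-order resolvent identity; the points form a geometric instead of an arithmetic
   progression, whence the factor [mu k.+1 + S]. One of the three resolvents stays inside the
   bounded [a k], so only two distances appear in the denominator. *)
have D2 k : a k - a k.+1 *+ 2 + a k.+2 =
    (iota (eta ^+ 2 * mu k) * a k) * ((r k.+1 * r k.+2) * (iota (mu k.+1) + S)).
  have m1 : mu k.+1 = mu k * w by rewrite /mu exprSr mulrA.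
  have m2 : mu k.+2 = mu k * w ^+ 2 by rewrite /mu -mulrA -exprD addn2.
  have := (hr k, hr k.+1, hr k.+2); rewrite /a m1 m2 /eta.
  set x := r k; set y := r k.+1; set z := r k.+2.
  move: (mu k) => m0; rewrite !(rmorphM, rmorphXn, rmorphB, rmorph1)/=.
  set m := iota m0; set v := iota w.
  move=> [[hx hy] hz].
  have -> : (S - 1) * x - ((S - 1) * y) *+ 2 + (S - 1) * z
    = (S - 1) * (x * (y * (m * v - S)) * (z * (m * v ^+ 2 - S))
       - (y * (x * (m - S)) * (z * (m * v ^+ 2 - S))) *+ 2
       + z * (x * (m - S)) * (y * (m * v - S))).
    by rewrite hx hy hz !mulr1 !mulr2n; ring.
  by rewrite !mulr2n; ring.
have ak k : bdB (a k) (1 + K).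
  have -> : a k = - 1 + iota (mu k - 1) * r k.
    by rewrite -[in - 1](hr k) /a rmorphB rmorph1; ring.
  apply: bdBD; first exact/bdBN/bdB1.
  have -> : K = d k * (K / d k) by rewrite mulrC divfK// gt_eqF.
  by apply: bdBM; [exact: ltW|exact: bdB_iota|exact: rK].
pose c0 := (pi / l%:R) ^+ 2 * (1 + K) * (K ^+ 2 * (1 + M)).
have pl0 : 0 <= pi / l%:R :> R by rewrite divr_ge0 ?pi_ge0.
have c00 : 0 <= c0.
  by apply: mulr_ge0; apply: mulr_ge0; rewrite ?sqr_ge0//; lra.
have D2b k : bdB ((-1) ^+ k * (a k - a k.+1 *+ 2 + a k.+2))
   (c0 * (((d k.+1)^-1 ^+ 2 + (d k.+2)^-1 ^+ 2) / 2)).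
  have x0 := d0 k.+1; have y0 := d0 k.+2.
  set u := d k.+1 in x0 *; set v := d k.+2 in y0 *.
  have uv : u^-1 * v^-1 <= (u^-1 ^+ 2 + v^-1 ^+ 2) / 2.
    have := sqr_ge0 (u^-1 - v^-1); rewrite sqrrB mulr2n; lra.
  apply: (@bdB_le _ (1 * (c0 * (u^-1 * v^-1)))); last first.
    by rewrite mul1r ler_wpM2l.
  apply: bdBM => //.
    have -> : (-1) ^+ k = iota ((-1) ^+ k) by rewrite rmorphXn rmorphN1.
    by have := bdB_iota ((-1) ^+ k); rewrite cabsX cabsN cabs1 expr1n.
  rewrite D2; have -> : c0 * (u^-1 * v^-1) =
    (pi / l%:R) ^+ 2 * (1 + K) * ((K / u) * (K / v) * (1 + M)) by rewrite /c0; ring.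
  have K0 : 0 <= K by lra.
  apply: bdBM; first by rewrite mulr_ge0 ?sqr_ge0//; lra.
    apply: bdBM => //; first exact: sqr_ge0.
    apply: bdB_le (bdB_iota _) _; rewrite cabsM mu1 mulr1 cabsX.
    by apply: lerXn2r; rewrite ?nnegrE ?cabs_ge0.
  apply: bdBM; first by rewrite !mulr_ge0// invr_ge0 ltW.
    by apply: bdBM; [rewrite mulr_ge0// invr_ge0 ltW|exact: rK|exact: rK].
  by apply: bdBD => //; rewrite -(mu1 k.+1); exact: bdB_iota.
have Ab : bdB A (c0 * (N%:R ^+ 2 / 4) / 4).
  have -> : A = iota 4^-1 * (A *+ 4).
    rewrite -[A *+ 4]mulr_natl mulrA -(rmorph_nat iota 4) -rmorphM mulVf ?rmorph1 ?mul1r//.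
  have -> : c0 * (N%:R ^+ 2 / 4) / 4 = cabs (4^-1 : C) * (c0 * (N%:R ^+ 2 / 4)).
    by rewrite cabsV cabs_nat mulrC.
  apply: bdBM; [exact: cabs_ge0|exact: bdB_iota|rewrite A4].
  have e : \sum_(k < N) c0 * (((d k.+1)^-1 ^+ 2 + (d k.+2)^-1 ^+ 2) / 2) = c0 * (N%:R ^+ 2 / 4).
    rewrite -mulr_sumr; congr (_ * _); rewrite -mulr_suml big_split/=.
    have <- := sum_inv_sqr_dist mu0N.
    have s1 : \sum_(k < N) (d k.+1)^-1 ^+ 2 = \sum_(k < N) (d k)^-1 ^+ 2.
      by apply: (periodic_sum_shift (F := fun k => (d k)^-1 ^+ 2)); rewrite /d muN'.
    have s2 : \sum_(k < N) (d k.+2)^-1 ^+ 2 = \sum_(k < N) (d k.+1)^-1 ^+ 2.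
      by apply: (periodic_sum_shift (F := fun k => (d k.+1)^-1 ^+ 2)); rewrite /d muN1.
    by rewrite s2 s1 -/w; set x := \sum_(k < N) _; field.
  rewrite -e; apply: (@bdB_sum N (fun k => (-1) ^+ k * (a k - a k.+1 *+ 2 + a k.+2))
    (fun k => c0 * (((d k.+1)^-1 ^+ 2 + (d k.+2)^-1 ^+ 2) / 2))) => k _.
  exact: D2b.
rewrite SA.
have -> : (1 + K) * K ^+ 2 * (1 + M) * pi ^+ 2 * M1 / 8 / l%:R
  = N%:R^-1 * ((c0 * (N%:R ^+ 2 / 4) / 4) * M1).
  by rewrite /c0 NlR; field; exact: lt0r_neq0.
apply: bdBM; first by rewrite invr_ge0 ltW.
  apply: bdB_le (bdB_iota _) _.
  by rewrite cabsM cabsV cabs_nat cabsX cabs_expi expr1n mulr1.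
apply: bdBM => //.
by rewrite divr_ge0// mulr_ge0// divr_ge0// sqr_ge0.
Qed.

End Resolvents.

(** * Kato's condition and the resulting difference bound *)

Section Kato.
Context {R : realType}.
Local Notation C := R[i].
Context {B : comPzRingType} (iota : {rmorphism C -> B}) (bdB : B -> R -> Prop).
Context (bdB_iota : forall c, bdB (iota c) (cabs c)).
Context (bdBD : forall a b K L, bdB a K -> bdB b L -> bdB (a + b) (K + L)).
Context (bdBM : forall a b K L, 0 <= K -> bdB a K -> bdB b L -> bdB (a * b) (K * L)).
Context (bdB_le : forall a K L, bdB a K -> K <= L -> bdB a L).
Context (bdB_neumann : forall a q, 0 <= q < 1 -> bdB a q ->
  exists2 v, v * (1 - a) = 1 & bdB v (1 - q)^-1).
Context (T : R -> B) (T0 : T 0 = 1).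
Context (TD : forall s t, 0 <= s -> 0 <= t -> T (s + t) = T s * T t).

Lemma semigroup_exp n t : 0 <= t -> T t ^+ n = T (n%:R * t).
Proof.
move=> t0; elim: n => [|n ih]; first by rewrite mul0r T0.
by rewrite exprS ih -TD ?mulr_ge0// -natr1 mulrDl mul1r addrC.
Qed.

Lemma unimodular_resolvent (z : C) (delta K M : R) : 0 < delta -> 1 <= K -> 0 <= M ->
  cabs z = 1 ->
  (forall t, 0 <= t <= delta -> bdB (T t) M) ->
  (forall t, 0 < t <= delta -> has_res iota bdB z (T t) K) ->
  exists (c0 K1 : R), [/\ 0 < c0, 1 <= K1 & forall mu t, cabs mu = 1 -> mu != 1 ->
    0 < t <= c0 * cabs (mu - 1) -> has_res iota bdB mu (T t) (K1 / cabs (mu - 1))].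
Proof.
move=> d0 K1 M0 z1 TM hres; have K0 : 0 < K by lra.
(* Within distance 1 / (2K) of [z] the bound at [z] can be perturbed by [res_perturb]. *)
have [|p [C1 [p0 C10 hC]]] := @circle_power_near R (2^-1 / K); first by rewrite divr_gt0.
have pr : 0 < p%:R :> R by rewrite ltr0n.
(* Chosen so that [m <= C1 / |mu - 1|] and [t <= c0 |mu - 1|] give m (t / p) <= delta, where the
   hypotheses on [T] are available. The added 1 only ensures [1 <= K1]. *)
exists (delta * p%:R / C1), (2 * K * (C1 * M) + 1); split.
- by rewrite divr_gt0// mulr_gt0.
- by rewrite lerDr !mulr_ge0// ltW.
move=> mu t mu1 mun /andP[t0 td]; have m0 : 0 < cabs (mu - 1) by rewrite cabs_gt0 subr_eq0.
have tp0 : 0 < t / p%:R by rewrite divr_gt0.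
have -> : T t = T (t / p%:R) ^+ p.
  by rewrite semigroup_exp 1?ltW// mulrC divfK// gt_eqF.
have [b _ mub] := expi_surj mu1.
apply: (res_root bdB_iota bdBD bdBM p0 mu1 (mu0 := expi (b / p%:R))).
- by rewrite -expi_natM mulrC divfK ?gt_eqF.
- by rewrite divr_ge0 ?(ltW m0)// addr_ge0// !mulr_ge0// ltW.
move=> nu nup.
have nu1 : cabs nu = 1.
  by apply/eqP; rewrite -(@eqrXn2 _ p)// ?cabs_ge0// -cabsX nup mu1 expr1n.
have [|m [m0' mC mz]] := hC z nu z1 nu1; first by rewrite nup.
rewrite nup in mC.
have mt : m%:R * (t / p%:R) <= delta.
  apply: (@le_trans _ _ (C1 / cabs (mu - 1) * (delta * p%:R / C1 * cabs (mu - 1) / p%:R))).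
    apply: ler_pM => //; first exact: ltW.
    by rewrite ler_pM2r ?invr_gt0.
  by apply: eq_ler; field; rewrite !gt_eqF.
have it i : (i <= m)%N -> 0 <= i%:R * (t / p%:R) <= delta.
  move=> im; rewrite mulr_ge0 ?(ltW tp0)//= (le_trans _ mt)// ler_wpM2r ?(ltW tp0)//.
  by rewrite ler_nat.
have bi i : (i < m)%N -> bdB (T (t / p%:R) ^+ i) M.
  by move=> im; rewrite semigroup_exp 1?ltW//; apply: TM; apply: it; exact: ltnW.
have h1 : has_res iota bdB (nu ^+ m) (T (t / p%:R) ^+ m) (2 * K).
  rewrite semigroup_exp 1?ltW//.
  apply: (res_perturb bdB_iota bdBM bdB_le bdB_neumann (z := z)); first exact: ltW.
    by move: mz; rewrite ler_pdivlMr.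
  by apply: hres; rewrite mulr_gt0 ?ltr0n.
have h2 := res_pow bdB_iota bdBD bdBM nu1 _ bi h1.
have [|r r1 r2] := h2; first by rewrite mulr_ge0// ltW.
exists r => //; apply: bdB_le r2 _.
rewrite [leRHS]mulrDl; apply: (@le_trans _ _ (2 * K * (C1 * M) / cabs (mu - 1))).
  have -> : 2 * K * (C1 * M) / cabs (mu - 1) = 2 * K * (C1 / cabs (mu - 1) * M) by ring.
  by apply: ler_wpM2l; [rewrite mulr_ge0// ltW|apply: ler_wpM2r].
by rewrite lerDl divr_ge0// ltW.
Qed.

(** If mu^(2l) = -1 then 2 = |mu^(2l) - 1| <= 2l |mu - 1|, so mu keeps distance 1 / l from 1 and
    [l t <= c0] implies t <= c0 |mu - 1|. The other restriction, delta / 2, is for bounding the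
    power 2l. *)
Lemma kato_difference_bound (z : C) (delta K M : R) : 0 < delta -> 1 <= K -> 0 <= M ->
  cabs z = 1 ->
  (forall t, 0 <= t <= delta -> bdB (T t) M) ->
  (forall t, 0 < t <= delta -> has_res iota bdB z (T t) K) ->
  exists (t0 C2 : R), [/\ 0 < t0, 0 <= C2 & forall l t, (0 < l)%N -> 0 < t ->
    l%:R * t <= t0 -> bdB (T (l.-1%:R * t) * (T t - 1)) (C2 / l%:R)].
Proof.
move=> d0 K1 M0 z1 TM hres.
have [c0 [K2 [c00 K21 hr]]] := unimodular_resolvent d0 K1 M0 z1 TM hres.
exists (Num.min (delta / 2) c0), ((1 + K2) * K2 ^+ 2 * (1 + M) * pi ^+ 2 * (1 + M) / 8).
have K20 : 0 <= K2 by lra.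
split.
- by rewrite lt_min c00 divr_gt0.
- rewrite divr_ge0// mulr_ge0 ?addr_ge0// mulr_ge0 ?sqr_ge0// mulr_ge0 ?addr_ge0//.
  by rewrite mulr_ge0 ?sqr_ge0 ?addr_ge0.
move=> l t l0 t0; rewrite le_min => /andP[lt1 lt2].
have lr : 1 <= l%:R :> R by rewrite ler1n.
have tl : t <= l%:R * t by rewrite ler_peMl// ltW.
have tpos := ltW t0.
rewrite -semigroup_exp//.
apply: (ritt_estimate bdB_iota bdBD bdBM bdB_le l0 K21 M0) => //.
- by rewrite addr_ge0.
- by apply: TM; apply/andP; split => //; lra.
- apply: bdBD; first by have := bdB_iota 1; rewrite rmorph1 cabs1.
  rewrite semigroup_exp// natrM; apply: TM; apply/andP; split; first by rewrite !mulr_ge0.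
  by rewrite -mulrA; lra.
move=> mu mul; have N0 : (0 < 2 * l)%N by lia.
have mu1 : cabs mu = 1.
  by apply/eqP; rewrite -(@eqrXn2 _ (2 * l))// ?cabs_ge0// -cabsX mul cabsN cabs1 expr1n.
have N1 : cabs (-1 - 1 : C) = 2 by rewrite -opprD cabsN -[1 + 1]/(2%:R) cabs_nat.
have mun : mu != 1.
  have N1' : (-1 : C) != 1 by rewrite -subr_eq0 -cabs_eq0 N1 pnatr_eq0.
  by apply: contraNneq N1' => h; rewrite -mul h expr1n.
apply: hr => //; rewrite t0/=.
have := @cabs_expr_sub1 _ mu (2 * l) mu1; rewrite mul N1 natrM => h.
have h2 : 1 <= l%:R * cabs (mu - 1) by lra.
have h3 := ler_wpM2l tpos h2.
have h4 := ler_wpM2r (cabs_ge0 (mu - 1)) lt2; lra.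
Qed.

End Kato.

(** * The commutative ring of a semigroup *)

Definition commuting {R : realType} {X : normedModType R[i]} (T : R -> {linear X -> X}) :=
  forall s t x, 0 <= s -> 0 <= t -> T s (T t x) = T t (T s x).

(* The bounded operators commuting with everything that commutes with all the [T t]:
   a commutative ring which contains the inverses of its elements. *)
Record bicommutant {R : realType} {X : normedModType R[i]} (T : R -> {linear X -> X})
    (cT : commuting T) := Bicommutant {
  bop :> X -> X;
  bop_linear : linear bop;
  bop_bounded : exists K, bd bop K;
  bop_commute : forall W : X -> X, linear W ->
    (forall t x, 0 <= t -> W (T t x) = T t (W x)) -> forall x, bop (W x) = W (bop x) }.

HB.instance Definition _ {R : realType} {X : normedModType R[i]} (T : R -> {linear X -> X})
  (cT : commuting T) := gen_eqMixin (bicommutant cT).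
HB.instance Definition _ {R : realType} {X : normedModType R[i]} (T : R -> {linear X -> X})
  (cT : commuting T) := gen_choiceMixin (bicommutant cT).

Section BicommutantRing.
Context {R : realType} {X : normedModType R[i]} (T : R -> {linear X -> X}) (cT : commuting T).
Local Notation C := R[i].
Local Notation N := (@rnorm R X).
Local Notation B := (bicommutant cT).
Implicit Types (U V W : B) (x y : X).

Lemma bicommutant_eq U V : (forall x, U x = V x) -> U = V.
Proof.
case: U V => [f f1 f2 f3] [g g1 g2 g3] /= fg.
have {}fg : f = g by apply/funext.
move: f1 f2 f3; rewrite fg => f1 f2 f3.
by rewrite (Prop_irrelevance f1 g1) (Prop_irrelevance f2 g2) (Prop_irrelevance f3 g3).
Qed.

Lemma bopD U x y : U (x + y) = U x + U y.
Proof. by have := bop_linear U 1 x y; rewrite !scale1r. Qed.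

Lemma bopZ U c x : U (c *: x) = c *: U x.
Proof.
have U0 : U 0 = 0 by apply: (@addrI _ (U 0)); rewrite -bopD !addr0.
by have := bop_linear U c x 0; rewrite U0 !addr0.
Qed.

Lemma commutant0 (W : X -> X) : linear W -> W 0 = 0.
Proof.
move=> Wl; apply: (@addrI _ (W 0)); rewrite addr0.
by have := Wl 1 0 0; rewrite !scale1r addr0.
Qed.

Definition bicommutant_scal (c : C) : B.
Proof.
apply: (@Bicommutant _ _ _ cT (fun x => c *: x)).
- by move=> d x y; rewrite scalerDr !scalerA mulrC.
- by exists (cabs c) => x; rewrite rnormZ.
- by move=> W Wl _ x; have := Wl c x 0; rewrite (commutant0 Wl) !addr0.
Defined.

Definition bicommutant_opp U : B.
Proof.
apply: (@Bicommutant _ _ _ cT (fun x => - U x)).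
- by move=> c x y; rewrite bopD bopZ opprD scalerN.
- by have [K UK] := bop_bounded U; exists K => x; rewrite rnormN.
- move=> W Wl WT x; rewrite (bop_commute U Wl WT).
  by have := Wl (-1) (U x) 0; rewrite !scaleN1r (commutant0 Wl) !addr0.
Defined.

Definition bicommutant_add U V : B.
Proof.
apply: (@Bicommutant _ _ _ cT (fun x => U x + V x)).
- by move=> c x y; rewrite !bopD !bopZ scalerDr addrACA.
- have [K UK] := bop_bounded U; have [L VL] := bop_bounded V; exists (K + L) => x.
  by rewrite (le_trans (ler_rnormD _ _))// mulrDl lerD.
- move=> W Wl WT x; rewrite (bop_commute U Wl WT) (bop_commute V Wl WT).
  by have := Wl 1 (U x) (V x); rewrite !scale1r.
Defined.

Definition bicommutant_mul U V : B.
Proof.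
apply: (@Bicommutant _ _ _ cT (fun x => U (V x))).
- by move=> c x y; rewrite !bopD !bopZ.
- have [K UK] := bop_bounded U; have [L VL] := bop_bounded V; exists (`|K| * L).
  have UK' : bd U `|K| by exact: bd_le UK (ler_norm _).
  exact: (bd_comp (normr_ge0 K) UK' VL).
- by move=> W Wl WT x; rewrite (bop_commute V Wl WT) (bop_commute U Wl WT).
Defined.

Definition bicommutant_op (s : R) (s0 : 0 <= s) (cs : continuous (T s)) : B.
Proof.
apply: (@Bicommutant _ _ _ cT (T s)).
- by move=> c x y; rewrite linearD linearZ.
- by have [K _ h] := continuous_bd cs; exists K.
- by move=> W Wl WT x; rewrite WT.
Defined.

Local Notation bicommutant_zero := (bicommutant_scal 0).

Lemma bicommutant_addA : associative bicommutant_add.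
Proof. by move=> U V W; apply: bicommutant_eq => x /=; rewrite addrA. Qed.
Lemma bicommutant_addC : commutative bicommutant_add.
Proof. by move=> U V; apply: bicommutant_eq => x /=; rewrite addrC. Qed.
Lemma bicommutant_add0 : left_id bicommutant_zero bicommutant_add.
Proof. by move=> U; apply: bicommutant_eq => x /=; rewrite scale0r add0r. Qed.
Lemma bicommutant_addN : left_inverse bicommutant_zero bicommutant_opp bicommutant_add.
Proof. by move=> U; apply: bicommutant_eq => x /=; rewrite scale0r addNr. Qed.

HB.instance Definition _ := GRing.isZmodule.Build B
  bicommutant_addA bicommutant_addC bicommutant_add0 bicommutant_addN.

Lemma bicommutant_mulA : associative bicommutant_mul.
Proof. by move=> U V W; apply: bicommutant_eq. Qed.
Lemma bicommutant_mulC : commutative bicommutant_mul.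
Proof.
move=> U V; apply: bicommutant_eq => x /=.
(* [V] may itself serve as a test operator for [U]: it commutes with each [T t], because each [T t]
   commutes with the whole family. *)
apply: (bop_commute U (bop_linear V)) => t y t0.
by rewrite (bop_commute V)// => [c z z'|s z s0]; [rewrite linearD linearZ|exact: cT].
Qed.
Lemma bicommutant_mul1 : left_id (bicommutant_scal 1) bicommutant_mul.
Proof. by move=> U; apply: bicommutant_eq => x /=; rewrite scale1r. Qed.
Lemma bicommutant_mulDl : left_distributive bicommutant_mul bicommutant_add.
Proof. by move=> U V W; apply: bicommutant_eq. Qed.

HB.instance Definition _ := GRing.Zmodule_isComPzRing.Build B
  bicommutant_mulA bicommutant_mulC bicommutant_mul1 bicommutant_mulDl.

Lemma bicommutant_scal_zmod : zmod_morphism bicommutant_scal.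
Proof. by move=> c d; apply: bicommutant_eq => x; rewrite /= scalerBl. Qed.
Lemma bicommutant_scal_monoid : monoid_morphism bicommutant_scal.
Proof. by split => // c d; apply: bicommutant_eq => x; rewrite /= scalerA. Qed.

HB.instance Definition _ := GRing.isZmodMorphism.Build C B bicommutant_scal bicommutant_scal_zmod.
HB.instance Definition _ := GRing.isMonoidMorphism.Build C B bicommutant_scal bicommutant_scal_monoid.

Lemma bop_sum n (F : nat -> B) x : (\sum_(i < n) F i) x = \sum_(i < n) F i x.
Proof.
elim: n => [|n ih]; first by rewrite !big_ord0 /= scale0r.
by rewrite !big_ord_recr/= -ih.
Qed.

Lemma bop_exp n U x : (U ^+ n) x = iter n U x.
Proof. by elim: n => [|n ih]; [rewrite expr0 /= scale1r|rewrite exprS /= -ih]. Qed.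

End BicommutantRing.

(** * The semigroup inside the ring and its resolvent at one point *)

Section Application.
Context {R : realType} {X : completeNormedModType R[i]} (T : R -> {linear X -> X}).
Context (hT : strongly_continuous_semigroup T).
Local Notation C := R[i].
Local Notation N := (@rnorm R X).

Lemma semigroup_commuting : commuting T.
Proof. by move=> s t x s0 t0; rewrite -!(semigroupD hT)// addrC. Qed.

Local Notation B := (bicommutant semigroup_commuting).
Local Notation iota := (bicommutant_scal semigroup_commuting).

Lemma bicommutant_neumann (U : B) (q : R) : 0 <= q < 1 -> bd U q ->
  exists2 V : B, V * (1 - U) = 1 & bd V (1 - q)^-1.
Proof.
move=> q01 Uq.
pose Ul : {linear X -> X} := HB.pack (bop U) (GRing.isLinear.Build _ _ _ _ _ (bop_linear U)).
have [g [gl gL gR gb]] := @neumann R X Ul q q01 Uq.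
have gc (W : X -> X) : linear W -> (forall t x, 0 <= t -> W (T t x) = T t (W x)) ->
    forall x, g (W x) = W (g x).
  move=> Wl WT x; have WB y z : W (y - z) = W y - W z.
    by rewrite [y - z]addrC [RHS]addrC; have := Wl (-1) z y; rewrite !scaleN1r.
  rewrite -{1}(gR x) WB /= -(bop_commute U Wl WT); exact: gL.
have gbd : exists K, bd g K by exists (1 - q)^-1.
exists (@Bicommutant _ _ _ semigroup_commuting g gl gbd gc) => //.
by apply: bicommutant_eq => x /=; rewrite !scale1r; exact: gL.
Qed.

Lemma right_continuous0 x (e : R) : 0 < e ->
  exists2 r : R, 0 < r & forall t, 0 <= t < r -> N (T t x - x) < e.
Proof.
case: hT => _ T0 _ /(_ x)/continuous_within_itvcyP[_ h] e0.
rewrite T0 in h; have /cvg_rnormP/(_ _ e0) := h.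
rewrite near_withinE => /nbhs_ballP[r/= r0 hr]; exists r => // t /andP[t0 tr].
have [->|tn] := eqVneq t 0; first by rewrite T0 subrr rnorm0.
rewrite rnormB; apply: hr; last by rewrite lt_def tn.
by rewrite -ball_normE/= sub0r normrN ger0_norm.
Qed.

(** Reuses [locally_bounded] with the nonnegative half line of the complex plane in place of a
    sector. *)
Lemma semigroup_bounded0 : exists2 d : R, 0 < d & exists2 M : R, 1 <= M &
  forall t, 0 <= t <= d -> bd (T t) M.
Proof.
have [||r r0 [M M0 hM]] := @locally_bounded R X
  [set z : C | z = ((complex.Re z)%:C)%C /\ 0 <= complex.Re z] (fun z => T (complex.Re z)).
- by move=> z [_ z0]; case: hT => h _ _ _; exact: h.
- move=> x; apply/cvg_rnormP => e e0; have [r r0 hr] := right_continuous0 x e0.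
  apply: (cabs_nbhs r0) => z; rewrite subr0 => zr /= [_ z0].
  rewrite rnormB; apply: hr; rewrite z0/=; apply: le_lt_trans zr.
  by rewrite (le_trans (ler_norm _))// ler_Re_cabs.
exists (r / 2); first by rewrite divr_gt0.
exists (M + 1) => [|t /andP[t0 tr]]; first by rewrite lerDr.
apply: (@bd_le _ _ _ M); last by rewrite lerDl.
by apply: (hM ((t%:C)%C)) => //=; rewrite cabs_real ger0_norm//; lra.
Qed.

Lemma semigroup_bounded (L : R) : exists2 M : R, 1 <= M & forall t, 0 <= t <= L -> bd (T t) M.
Proof.
have [d d0 [M M1 hM]] := semigroup_bounded0.
have [n hn] := @inv_small R L d d0.
have M0 : 0 <= M by rewrite (le_trans ler01).
exists (M ^+ n.+1) => [|t /andP[t0 tL]]; first by rewrite exprn_ege1.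
have tn0 : 0 <= t / n.+1%:R by rewrite divr_ge0.
have tn : bd (T (t / n.+1%:R)) M.
  apply: hM; rewrite tn0/= (le_trans _ (ltW hn))// ler_wpM2r ?invr_ge0//.
have h m x : N (iter m (T (t / n.+1%:R)) x) <= M ^+ m * N x.
  elim: m => [|m ih] /=; first by rewrite expr0 mul1r.
  by rewrite (le_trans (tn _))// exprS -mulrA ler_wpM2l.
by move=> x; have := h n.+1 x; rewrite (iter_semigroup hT)// mulrC divfK// pnatr_eq0.
Qed.

(** The absolute value gives a ring element for every [t] without a proof of [0 <= t] among the
    arguments. *)
Definition semigroup_op (t : R) : B :=
  bicommutant_op semigroup_commuting (normr_ge0 t) (let: And4 h _ _ _ := hT in h _ (normr_ge0 t)).

Lemma semigroup_opE t x : 0 <= t -> semigroup_op t x = T t x.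
Proof. by move=> t0; rewrite /= ger0_norm. Qed.

Lemma limf_esup_lt (f : R -> \bar R) (K : \bar R) : (limf_esup f (0 : R)^'+ < K)%E ->
  exists2 L, (L < K)%E & exists2 r : R, 0 < r & forall t, 0 < t < r -> (f t <= L)%E.
Proof.
move=> /ereal_inf_lt[_ [A /= A0 <-] AK]; exists (ereal_sup (f @` A)) => //.
move: A0 => /nbhs_ballP[r/= r0 hr]; exists r => // t /andP[t0 tr].
apply: ereal_sup_ubound; exists t => //; apply: hr => //.
by rewrite -ball_normE/= sub0r normrN gtr0_norm.
Qed.

(** For small t one has |f(T(t))| <= L < |f(z)| at some z, which the maximum principle moves to the
    unit circle. So f(z) - f(T(t)) is invertible by the Neumann series, and z - T(t) divides it with
    a quotient bounded through the coefficients of f. *)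
Lemma limsup_resolvent (f : {poly C}) :
  (limf_esup (fun t : R => opnorm (poly_op f (T t))) (0 : R)^'+ < disk_norm f)%E ->
  exists (z : C) (delta K : R), [/\ 0 < delta, 1 <= K, cabs z = 1 &
    forall t, 0 < t <= delta -> has_res iota (fun U : B => bd U) z (semigroup_op t) K].
Proof.
move=> /limf_esup_lt[L Lf [r r0 hr]].
have [_ [z0 /= z01 <-] Lz] := ereal_sup_gt Lf.
have {}z01 : cabs z0 <= 1 by move: z01; rewrite cabsE -[1]/(1%:C)%C lecR.
have L0 : (0 <= L)%E.
  have := hr (r / 2); rewrite divr_gt0//= ltr_pdivrMr// ltr_pMr// ltr1n => /(_ isT).
  apply: le_trans; apply: (le_trans _ (opnorm_ge _ (x := 0) _)); last by rewrite rnorm0.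
  by rewrite lee_fin rnorm_ge0.
case: L L0 Lz hr {Lf} => [L| |]; rewrite ?lee_fin ?lte_fin// => L0 Lz hr.
have [z z1 Lfz] := maximum_principle L0 z01 Lz.
have [d d0 [M M1 hM]] := semigroup_bounded0.
set c := f.[z]; have c0 : 0 < cabs c by exact: le_lt_trans L0 Lfz.
have q01 : 0 <= L / cabs c < 1.
  by rewrite divr_ge0 ?(ltW c0)//= ltr_pdivrMr// mul1r.
pose S t := semigroup_op t.
pose G : R := \sum_(k < size f) cabs f`_k * \sum_(i < k) 1 * M ^+ i.
have M0 : 0 <= M by rewrite (le_trans ler01).
have G0 : 0 <= G.
  apply: sumr_ge0 => k _; rewrite mulr_ge0 ?cabs_ge0//; apply: sumr_ge0 => i _.
  by rewrite mulr_ge0// exprn_ge0.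
have qc : 0 < 1 - L / cabs c by rewrite subr_gt0; case/andP: q01.
pose K := (cabs c)^-1 * (1 - L / cabs c)^-1 * G + 1.
have bdD (U V : B) (k l : R) : bd U k -> bd V l -> bd (U + V) (k + l).
  by move=> hU hV x; rewrite /= (le_trans (ler_rnormD _ _))// mulrDl lerD.
have bdM (U V : B) (k l : R) : 0 <= k -> bd U k -> bd V l -> bd (U * V) (k * l).
  by move=> k0 hU hV; exact: (bd_comp k0 hU hV).
have bdi (a : C) : bd (iota a) (cabs a) by move=> x; rewrite /= rnormZ.
have bdS := @bdB_sum R B iota (fun U : B => bd U) bdi bdD.
exists z, (Num.min (r / 2) d), K; split => //.
- by rewrite lt_min d0 divr_gt0.
- by rewrite /K lerDr !mulr_ge0 ?invr_ge0 ?cabs_ge0// ltW.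
move=> t /andP[t0]; rewrite le_min => /andP[tr td].
pose fS := \sum_(k < size f) iota f`_k * S t ^+ k.
have fSE x : fS x = poly_op f (T t) x.
  rewrite /fS (bop_sum _ (fun k => iota f`_k * S t ^+ k)) /poly_op; apply: eq_bigr => k _.
  rewrite /= bop_exp; congr (_ *: _); elim: (k : nat) => //= n ->.
  by rewrite ger0_norm// ltW.
have fSL : bd fS L.
  move=> x; rewrite fSE.
  pose fl : {linear X -> X} := HB.pack (bop fS) (GRing.isLinear.Build _ _ _ _ _ (bop_linear fS)).
  have /bd_opnorm : (opnorm fl <= L%:E)%E.
    rewrite (_ : (fl : X -> X) = poly_op f (T t)); last by apply/funext => y; exact: fSE.
    by apply: hr; rewrite t0/=; lra.
  by move=> /(_ L0)/(_ x); rewrite /= fSE.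
have c0' : c != 0 by rewrite -cabs_gt0.
have [V V1 Vb] := @bicommutant_neumann (iota c^-1 * fS) (L / cabs c) q01
  ltac:(by rewrite mulrC -cabsV; apply: (bdM _ _ _ _) => //; exact: cabs_ge0).
pose g := \sum_(k < size f) iota f`_k * \sum_(i < k) iota z ^+ (k.-1 - i) * S t ^+ i.
have gE : g * (iota z - S t) = iota c - fS.
  rewrite /c horner_coef rmorph_sum/= -sumrB mulr_suml; apply: eq_bigr => k _.
  by rewrite rmorphM -mulrBr rmorphXn/= subrXX; ring.
have gG : bd g G.
  apply: (bdS (size f) (fun k => iota f`_k * \sum_(i < k) iota z ^+ (k.-1 - i) * S t ^+ i)
     (fun k => cabs f`_k * \sum_(i < k) 1 * M ^+ i)) => k _.
  apply: (bdM _ _ _ _); [exact: cabs_ge0|exact: bdi|].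
  apply: (bdS k (fun i => iota z ^+ (k.-1 - i) * S t ^+ i) (fun i => 1 * M ^+ i)) => i _.
  apply: (bdM _ _ _ _) => //.
    by rewrite -rmorphXn/=; have := bdi (z ^+ (k.-1 - i)); rewrite cabsX z1 expr1n.
  have Sb : bd (S t) M.
    by move=> x; rewrite semigroup_opE ?(ltW t0)//; apply: hM; rewrite td ltW.
  elim: i => [|i ih]; first by move=> x; rewrite !expr0 /= scale1r mul1r.
  by rewrite !exprS; apply: (bdM _ _ _ _).
exists (iota c^-1 * V * g).
  rewrite -/(S t) -!mulrA gE -V1 mulrCA; congr (_ * _).
  by rewrite mulrBr -rmorphM mulVf// rmorph1.
have -> : K = (cabs c)^-1 * (1 - L / cabs c)^-1 * G + 1 by [].
apply: (@bd_le _ _ _ ((cabs c)^-1 * (1 - L / cabs c)^-1 * G)); last by rewrite lerDl.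
apply: (bdM _ _ _ _) => //; first by rewrite mulr_ge0 ?invr_ge0 ?cabs_ge0// ltW.
by apply: (bdM _ _ _ _) => //; rewrite ?invr_ge0 ?cabs_ge0// -cabsV.
Qed.

End Application.

Section DifferenceBound.
Context {R : realType} {X : completeNormedModType R[i]} (T : R -> {linear X -> X}).
Context (hT : strongly_continuous_semigroup T).
Local Notation C := R[i].
Local Notation N := (@rnorm R X).
Local Notation B := (bicommutant (semigroup_commuting hT)).
Local Notation iota := (bicommutant_scal (semigroup_commuting hT)).

Lemma limsup_difference_bound (f : {poly C}) :
  (limf_esup (fun t : R => opnorm (poly_op f (T t))) (0 : R)^'+ < disk_norm f)%E ->
  exists2 s0 : R, 0 < s0 & exists2 C1 : R, 0 <= C1 &
    forall s h x, 0 < h <= s -> s <= s0 -> N (T s (T h x - x)) <= C1 * h / s * N x.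
Proof.
move=> /(limsup_resolvent hT)[z [d1 [K [d10 K1 z1 hres]]]].
have [d2 d20 [M M1 hM]] := semigroup_bounded0 hT.
have M0 : 0 <= M by rewrite (le_trans ler01).
pose S := semigroup_op hT.
have bdi (a : C) : bd (iota a) (cabs a) by move=> x; rewrite /= rnormZ.
have bdD (U V : B) (k l : R) : bd U k -> bd V l -> bd (U + V) (k + l).
  by move=> hU hV x; rewrite /= (le_trans (ler_rnormD _ _))// mulrDl lerD.
have bdM (U V : B) (k l : R) : 0 <= k -> bd U k -> bd V l -> bd (U * V) (k * l).
  by move=> k0 hU hV; exact: (bd_comp k0 hU hV).
have bdle (U : B) (k l : R) : bd U k -> k <= l -> bd U l by exact: bd_le.
have S0 : S 0 = 1 by apply: bicommutant_eq => x; rewrite semigroup_opE// (semigroup0 hT) /= scale1r.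
have SD s t : 0 <= s -> 0 <= t -> S (s + t) = S s * S t.
  move=> s0 t0; apply: bicommutant_eq => x.
  by rewrite semigroup_opE ?addr_ge0// (semigroupD hT)//= !ger0_norm.
have dm : 0 < Num.min d1 d2 by rewrite lt_min d10.
have SM t : 0 <= t <= Num.min d1 d2 -> bd (S t) M.
  move=> /andP[t0]; rewrite le_min => /andP[_ td] x.
  by rewrite semigroup_opE//; apply: hM; rewrite t0.
have Sres t : 0 < t <= Num.min d1 d2 -> has_res iota (fun U : B => bd U) z (S t) K.
  by move=> /andP[t0]; rewrite le_min => /andP[td _]; apply: hres; rewrite t0.
have [t0 [C2 [t00 C20 hC]]] := kato_difference_bound bdi bdD bdM bdle
  (@bicommutant_neumann _ _ _ hT) S0 SD dm K1 M0 z1 SM Sres.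
exists (Num.min (t0 / 2) d2); first by rewrite lt_min d20 divr_gt0.
exists (M * C2); first by rewrite mulr_ge0.
move=> s h x /andP[h0 hs]; rewrite le_min => /andP[st sd].
have s0 : 0 < s by exact: lt_le_trans hs.
(* [l - 1] steps of length [h] fit into [s], and the rest of [T s] is bounded. Since s < l h, the
   bound C2 / l is at most C2 h / s; and l h <= s + h <= 2 s explains [t0 / 2]. *)
pose l := (Num.truncn (s / h)).+1.
have /andP[l1 l2] := truncn_itv (divr_ge0 (ltW s0) (ltW h0)).
have l1' : l.-1%:R * h <= s by rewrite -ler_pdivlMr.
have l2' : s < l%:R * h by rewrite -ltr_pdivrMr.
have lh : l%:R * h <= t0.
  by rewrite /l -natr1 mulrDl mul1r; move: l1'; rewrite /l/=; lra.
have lr : 0 < l%:R :> R by rewrite ltr0n.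
have := hC l h isT h0 lh x; rewrite /= !ger0_norm ?mulr_ge0 ?(ltW h0)// scale1r => q.
have sE : s = (s - l.-1%:R * h) + l.-1%:R * h by rewrite subrK.
rewrite sE (semigroupD hT) ?subr_ge0 ?mulr_ge0 ?(ltW h0)//.
apply: (@le_trans _ _ (M * (C2 / l%:R * N x))).
  have cond : 0 <= s - l.-1%:R * h <= d2.
    by rewrite subr_ge0 l1'/= (le_trans _ sd)// gerBl mulr_ge0// ltW.
  by apply: (le_trans (hM _ cond _)); rewrite ler_wpM2l.
rewrite -sE mulrA ler_wpM2r ?rnorm_ge0// -!mulrA !ler_wpM2l//.
by rewrite ler_pdivlMr// mulrC ler_pdivrMr// mulrC ltW.
Qed.

End DifferenceBound.

(** * The generator *)

Section Generator.
Context {R : realType} {X : completeNormedModType R[i]} (T : R -> {linear X -> X}).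
Context (hT : strongly_continuous_semigroup T).
Local Notation C := R[i].
Local Notation N := (@rnorm R X).
Implicit Types (x y l : X).

Let tw n : R := 2^-1 ^+ n.

Lemma tw_gt0 n : 0 < tw n.
Proof. by rewrite exprn_gt0// invr_gt0. Qed.

Definition quotient n y : X := ((2 ^+ n : R)%:C)%C *: (T (tw n) y - y).

Lemma quotientK n y : ((tw n)%:C)%C *: quotient n y = T (tw n) y - y.
Proof.
rewrite /quotient scalerA -rmorphM/= /tw -exprMn mulVf ?expr1n ?scale1r//.
Qed.

Lemma rnorm_quotientK n y : N (T (tw n) y - y) = tw n * N (quotient n y).
Proof. by rewrite -quotientK rnormZ cabs_real gtr0_norm ?tw_gt0. Qed.

(* The difference quotients are taken along the steps [2^-n] only; [gen y] is [0] where
   they do not converge. *)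
Definition is_gen y l := forall e : R, 0 < e -> exists n0, forall n, (n0 <= n)%N ->
  N (quotient n y - l) <= e.

Definition gen y : X := xget 0 [set l | is_gen y l].

Lemma is_gen_unique y l l' : is_gen y l -> is_gen y l' -> l = l'.
Proof.
move=> h h'; apply: rnorm_le0_eq => e e0; have e2 : 0 < e / 2 by rewrite divr_gt0.
have [n hn] := h _ e2; have [n' hn'] := h' _ e2.
have := hn (n + n')%N (leq_addr _ _); have := hn' (n + n')%N (leq_addl _ _).
set q := quotient _ _ => q1 q2; rewrite (le_trans (ler_rnorm_dist _ q _))//.
by rewrite [e]splitr lerD// rnormB.
Qed.

Lemma genE y l : is_gen y l -> gen y = l.
Proof.
move=> h; apply: (@is_gen_unique y) => //.
by rewrite /gen; case: xgetP => [l' _ //|/(_ l)].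
Qed.

Lemma is_gen_gen y l : is_gen y l -> is_gen y (gen y).
Proof. by move=> h; rewrite (genE h). Qed.

Lemma is_gen_linear c y y' l l' : is_gen y l -> is_gen y' l' ->
  is_gen (c *: y + y') (c *: l + l').
Proof.
move=> h h' e e0; have c0 : 0 < cabs c + 1 by rewrite ltr_wpDl// cabs_ge0.
have [|n hn] := h (e / 2 / (cabs c + 1)); first by rewrite !divr_gt0.
have [|n' hn'] := h' (e / 2); first by rewrite divr_gt0.
exists (n + n')%N => m mn.
have := hn m (leq_trans (leq_addr _ _) mn); have := hn' m (leq_trans (leq_addl _ _) mn).
have -> : quotient m (c *: y + y') - (c *: l + l')
   = c *: (quotient m y - l) + (quotient m y' - l').
  have -> : quotient m (c *: y + y') = c *: quotient m y + quotient m y'.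
    rewrite /quotient [T _ (_ + _)]linearD [T _ (_ *: _)]linearZ/= opprD addrACA -scalerBr.
    by rewrite scalerDr; congr (_ + _); rewrite !scalerA mulrC.
  by rewrite opprD addrACA -scalerBr.
move=> q1 q2; rewrite (le_trans (ler_rnormD _ _))// [e]splitr lerD// rnormZ.
apply: (le_trans (ler_wpM2l (cabs_ge0 c) q2)).
by apply: mul_div_succ_le; rewrite ?cabs_ge0// divr_ge0// ltW.
Qed.

Lemma is_gen_semigroup u y l : 0 <= u -> is_gen y l -> is_gen (T u y) (T u l).
Proof.
move=> u0 h e e0; have [M M1 hM] := semigroup_bounded hT u.
have M0 : 0 < M by rewrite (lt_le_trans ltr01).
have uu : 0 <= u <= u by rewrite u0 lexx.
have [|n hn] := h (e / M); first by rewrite divr_gt0.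
exists n => m mn; have -> : quotient m (T u y) - T u l = T u (quotient m y - l).
  rewrite [T u (_ - _)]linearB /quotient [T u (_ *: _)]linearZ/= [T u (_ - y)]linearB/=.
  congr (_ *: (_ - _) - _).
  by rewrite -!(semigroupD hT) ?(ltW (tw_gt0 _))// addrC.
by rewrite (le_trans (hM _ uu _))// mulrC -ler_pdivlMr// hn.
Qed.

Lemma gen_semigroup u y l : 0 <= u -> is_gen y l -> gen (T u y) = T u (gen y).
Proof. by move=> u0 h; rewrite (genE (is_gen_semigroup u0 h)) (genE h). Qed.

Lemma dyadic_floor (h : R) n : 0 <= h -> exists m : nat, m%:R * tw n <= h < m%:R * tw n + tw n.
Proof.
move=> h0; exists (Num.truncn (h / tw n)).
have := truncn_itv (divr_ge0 h0 (ltW (tw_gt0 n))).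
by rewrite ler_pdivlMr ?tw_gt0// ltr_pdivrMr ?tw_gt0// -natr1 mulrDl mul1r.
Qed.

(* Both Taylor estimates are proved along the dyadic multiples of [2^-n] below [h]. *)
Lemma taylor_limit (h L M : R) y (K : R) z : 0 <= h <= L -> 0 <= M ->
  (forall t, 0 <= t <= L -> bd (T t) M) ->
  (forall e : R, 0 < e -> exists n0, forall n m, (n0 <= n)%N -> m%:R * tw n <= h < m%:R * tw n + tw n ->
     N (T (m%:R * tw n) y - z) <= K + e) ->
  N (T h y - z) <= K.
Proof.
move=> /andP[h0 hL] M0 hM H; apply/ler_addgt0Pr => e e0.
have M1 : 0 < M + 1 by rewrite ltr_wpDl.
have e2 : 0 < e / 2 by rewrite divr_gt0.
have [n0 hn0] := H _ e2.
have [r r0 hr] := right_continuous0 hT y (divr_gt0 e2 M1).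
have [n1 hn1] := @expr_small R 2^-1 1 r ltac:(lra) r0.
have twr : tw (n0 + n1) < r.
  rewrite (le_lt_trans _ hn1)// mul1r /tw exprD ler_piMl ?exprn_ge0 ?invr_ge0//.
  by rewrite exprn_ile1 ?invr_ge0// invf_le1// ler1n.
have [m hm] := dyadic_floor (n0 + n1) h0; have /andP[m1 m2] := hm.
have := hn0 _ _ (leq_addr _ _) hm.
set t := m%:R * tw (n0 + n1) in m1 m2 *.
have t0 : 0 <= t by rewrite mulr_ge0// ltW// tw_gt0.
have ht : 0 <= h - t by rewrite subr_ge0.
have tL : 0 <= t <= L by rewrite t0 (le_trans m1).
have q : N (T h y - T t y) <= e / 2.
  rewrite -{1}(subrK t h) [h - t + t]addrC (semigroupD hT)// -linearB.
  rewrite (le_trans (hM _ tL _))//.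
  have /ltW : N (T (h - t) y - y) < e / 2 / (M + 1) by apply: hr; rewrite ht/=; lra.
  move/(ler_wpM2l M0) => /le_trans; apply.
  exact: (mul_div_succ_le M0 (ltW e2)).
move=> q2; rewrite (le_trans (ler_rnorm_dist _ (T t y) _))//; lra.
Qed.

(** A Riemann sum version of T(h) y - y as the integral of T(s) l over [0, h]. *)
Lemma taylor1 (h L M : R) y l : 0 <= h <= L -> 0 <= M ->
  (forall t, 0 <= t <= L -> bd (T t) M) -> is_gen y l -> N (T h y - y) <= h * M * N l.
Proof.
move=> hL M0 hM yl; have /andP[h0 hL'] := hL.
apply: (@taylor_limit h L M y) => // e e0.
have hM1 : 0 < h * M + 1 by rewrite ltr_wpDl// mulr_ge0.
have [n0 hn] := yl _ (divr_gt0 e0 hM1).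
exists n0 => n m nn /andP[m1 m2]; have tn := tw_gt0 n.
rewrite (semigroup_telescope hT) ?(ltW tn)// (le_trans (rnorm_sum _ _ _))//.
apply: (@le_trans _ _ (\sum_(i < m) M * (tw n * N (quotient n y)))).
  apply: ler_sum => i _; rewrite -rnorm_quotientK; apply: hM.
  rewrite mulr_ge0 ?(ltW tn)//= (le_trans _ hL')// (le_trans _ m1)//.
  by rewrite ler_wpM2r ?(ltW tn)// ler_nat ltnW.
rewrite sumr_const card_ord -[_ *+ m]mulr_natl.
have -> : m%:R * (M * (tw n * N (quotient n y))) = (m%:R * tw n) * (M * N (quotient n y)) by ring.
have qn : N (quotient n y) <= N l + e / (h * M + 1).
  by have := ler_rnorm_subr (quotient n y) l; have := hn n nn; lra.
apply: (@le_trans _ _ (h * (M * (N l + e / (h * M + 1))))).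
  apply: ler_pM => //; rewrite ?mulr_ge0 ?rnorm_ge0 ?(ltW tn)//.
  by rewrite ler_wpM2l.
have -> : h * (M * (N l + e / (h * M + 1))) = h * M * N l + e * (h * M / (h * M + 1)) by ring.
by rewrite lerD2l ler_piMr ?(ltW e0)// ler_pdivrMr// mul1r lerDl.
Qed.

Lemma taylor2 (h L M : R) y l l' : 0 <= h <= L -> 0 <= M ->
  (forall t, 0 <= t <= L -> bd (T t) M) -> is_gen y l -> is_gen l l' ->
  N (T h y - y - (h%:C)%C *: l) <= h ^+ 2 * M ^+ 2 * N l'.
Proof.
move=> hL M0 hM yl ll; have /andP[h0 hL'] := hL.
rewrite -addrA -opprD.
apply: (@taylor_limit h L M y) => // e e0.
have h1 : 0 < h + 1 by rewrite ltr_wpDl.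
have e2 : 0 < e / 2 by rewrite divr_gt0.
have [n0 hn] := yl _ (divr_gt0 e2 h1).
have Nl1 : 0 < N l + 1 by rewrite ltr_wpDl// rnorm_ge0.
have [n1 hn1] := @expr_small R 2^-1 1 (e / 2 / (N l + 1)) ltac:(lra) (divr_gt0 e2 Nl1).
exists (n0 + n1)%N => n m nn /andP[m1 m2]; have tn := tw_gt0 n.
have twe : tw n * N l <= e / 2.
  have tw1 : tw n <= tw n1.
    rewrite /tw -(subnK (leq_trans (leq_addl _ _) nn)) exprD ler_piMl ?exprn_ge0 ?invr_ge0//.
    by rewrite exprn_ile1 ?invr_ge0// invf_le1// ler1n.
  rewrite mul1r -/(tw n1) in hn1.
  have := ler_wpM2r (rnorm_ge0 l) (le_trans tw1 (ltW hn1)) => /le_trans; apply.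
  by rewrite mulrC; exact: (mul_div_succ_le (rnorm_ge0 l) (ltW e2)).
(* [taylor1] is applied twice: to [z], whose generator is [T (tw n) l - l], and to that increment of
   [l]. This yields the second power of [h]. *)
pose z := T (tw n) y - y.
have zg : is_gen z (T (tw n) l - l).
  have := is_gen_linear (-1) yl (is_gen_semigroup (ltW tn) yl).
  by rewrite !scaleN1r addrC [- l + _]addrC.
have sub : T (m%:R * tw n) y - (y + (h%:C)%C *: l) =
   \sum_(i < m) (T (i%:R * tw n) z - z) + (((m%:R * tw n) : R)%:C)%C *: (quotient n y - l)
    - (((h - m%:R * tw n) : R)%:C)%C *: l.
  have mq : (((m%:R * tw n) : R)%:C)%C *: quotient n y = z *+ m.
    by rewrite realcM -scalerA quotientK rmorph_nat scaler_nat.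
  rewrite opprD addrA (semigroup_telescope hT) ?(ltW tn)// sumrB -/z.
  rewrite sumr_const card_ord scalerBr mq realcB scalerBl opprB !addrA.
  by rewrite addrNK addrNK.
rewrite sub; apply: (le_trans (ler_rnormB _ _)).
have t1 : N ((((h - m%:R * tw n) : R)%:C)%C *: l) <= e / 2.
  rewrite rnormZ cabs_real ger0_norm ?subr_ge0//; apply: le_trans twe.
  by rewrite ler_wpM2r ?rnorm_ge0//; lra.
have t2 : N ((((m%:R * tw n) : R)%:C)%C *: (quotient n y - l)) <= e / 2.
  have mt0 : 0 <= m%:R * tw n by rewrite mulr_ge0// ltW.
  rewrite rnormZ cabs_real ger0_norm//.
  apply: (@le_trans _ _ (h * (e / 2 / (h + 1)))).
    by apply: ler_pM => //; rewrite ?rnorm_ge0// hn// (leq_trans (leq_addr _ _) nn).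
  exact: (mul_div_succ_le h0 (ltW e2)).
have t3 : N (\sum_(i < m) (T (i%:R * tw n) z - z)) <= h ^+ 2 * M ^+ 2 * N l'.
  have [->|m0] := posnP m.
    by rewrite big_ord0 rnorm0 !mulr_ge0 ?sqr_ge0 ?rnorm_ge0.
  have tnh : tw n <= h by rewrite (le_trans _ m1)// ler_peMl ?(ltW tn)// ler1n.
  rewrite (le_trans (rnorm_sum _ _ _))//.
  apply: (@le_trans _ _ (\sum_(i < m) h * M * (tw n * M * N l'))).
    apply: ler_sum => i _.
    have it : 0 <= i%:R * tw n <= h.
      rewrite mulr_ge0 ?(ltW tn)//= (le_trans _ m1)// ler_wpM2r ?(ltW tn)// ler_nat ltnW//.
    have /andP[it0 ith] := it.
    have itL : 0 <= i%:R * tw n <= L by rewrite it0 (le_trans ith).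
    have tnL : 0 <= tw n <= L by rewrite ltW//= (le_trans tnh).
    rewrite (le_trans (taylor1 itL M0 hM zg))//.
    apply: ler_pM; rewrite ?rnorm_ge0 ?(mulr_ge0 it0 M0)//; first by rewrite ler_wpM2r.
    exact: taylor1 tnL M0 hM ll.
  rewrite sumr_const card_ord -[_ *+ m]mulr_natl.
  have -> : m%:R * (h * M * (tw n * M * N l')) = (m%:R * tw n) * (h * M ^+ 2 * N l') by ring.
  have -> : h ^+ 2 * M ^+ 2 * N l' = h * (h * M ^+ 2 * N l') by ring.
  by rewrite ler_wpM2r// !mulr_ge0 ?sqr_ge0 ?rnorm_ge0.
have := ler_rnormD (\sum_(i < m) (T (i%:R * tw n) z - z))
  ((((m%:R * tw n) : R)%:C)%C *: (quotient n y - l)).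
lra.
Qed.

End Generator.

(** n^n <= (2n) (2n - 1) ... (n + 1) = C(2n, n) n!. It turns the bound (n C1 / a)^n on A^n T(a) into
    n! (4 C1 / a)^n, which makes the Taylor series converge in a sector. *)
Lemma expnn_le n : (n ^ n <= 4 ^ n * n`!)%N.
Proof.
have h1 : (n ^ n <= (2 * n) ^_ n)%N.
  rewrite ffact_prod -[X in (X <= _)%N](_ : \prod_(i < n) n = _)%N; last first.
    by rewrite prod_nat_const card_ord.
  by apply: leq_prod => i _; have := ltn_ord i; lia.
have h2 : ('C(2 * n, n) <= 4 ^ n)%N.
  have -> : (4 ^ n = (1 + 1) ^ (2 * n))%N by rewrite expnM.
  rewrite expnDn.
  have nn : (n < (2 * n).+1)%N by lia.
  by rewrite (bigD1 (Ordinal nn))//= !exp1n !muln1 leq_addr.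
by rewrite (leq_trans h1)// -bin_ffact leq_mul.
Qed.

(** * Powers of the generator on the orbits *)

Section Powers.
Context {R : realType} {X : completeNormedModType R[i]} (T : R -> {linear X -> X}).
Context (hT : strongly_continuous_semigroup T).
Context (s0 C1 : R) (s00 : 0 < s0) (C11 : 1 <= C1).
Local Notation C := R[i].
Local Notation N := (@rnorm R X).
Context (hD : forall s h (x : X), 0 < h <= s -> s <= s0 -> N (T s (T h x - x)) <= C1 * h / s * N x).
Implicit Types (x y l : X).

Let C10 : 0 <= C1. Proof. exact: le_trans ler01 C11. Qed.
Let tw n : R := 2^-1 ^+ n.
Let tw0 n : 0 < tw n. Proof. by rewrite exprn_gt0// invr_gt0. Qed.
Let tw2 n : 2 ^+ n * tw n = 1 :> R.
Proof. by rewrite /tw -exprMn mulfV ?expr1n. Qed.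

(** With k = 2^-(m+1), consecutive dyadic quotients of T(2u) w differ by 2^m T(u)^2 (T(k) - 1)^2 w
    up to sign. Each of the two factors T(u) (T(k) - 1) is O(k), so the differences decay
    geometrically; this is why two factors T(u) are split off [T s]. *)
Lemma smooth_gen s x : 0 < s -> exists l, is_gen T (T s x) l.
Proof.
move=> sp; pose u := Num.min (s / 2) s0.
have u0 : 0 < u by rewrite lt_min divr_gt0.
have [us us0] : u <= s / 2 /\ u <= s0 by rewrite /u !ge_min !lexx ?orbT.
pose w := T (s - (u + u)) x.
have su : 0 <= s - (u + u) by lra.
have -> : T s x = T u (T u w).
  have sE : s = u + u + (s - (u + u)) by rewrite addrC subrK.
  rewrite [X in T X x]sE (semigroupD hT _ (addr_ge0 (ltW u0) (ltW u0)) su).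
  by rewrite (semigroupD hT _ (ltW u0) (ltW u0)).
set Y := T u (T u w).
have [n0 hn0] := @expr_small R 2^-1 1 u ltac:(lra) u0.
rewrite mul1r in hn0.
have twn n : tw (n + n0) <= u.
  rewrite /tw exprD (le_trans _ (ltW hn0))// ler_piMl ?exprn_ge0 ?invr_ge0//.
  by rewrite exprn_ile1 ?invr_ge0// invf_le1// ler1n.
pose q n := quotient T (n + n0) Y.
pose K : R := (C1 / u) ^+ 2 * N w.
have K0 : 0 <= K by rewrite mulr_ge0 ?sqr_ge0 ?rnorm_ge0.
have hq n : N (q n.+1 - q n) <= K * 2^-1 ^+ n.
  rewrite /q /quotient addSn; set m := (n + n0)%N; set k := tw m.+1.
  have k0 : 0 < k by exact: tw0.
  have ku : k <= u by have := twn n.+1; rewrite addSn.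
  have kk : tw m = k + k by rewrite /k /tw exprS; field.
  rewrite -/(tw m.+1) -/(tw m) -/k kk (semigroupD hT) ?(ltW k0)//.
  have e : ((2 ^+ m.+1 : R)%:C)%C *: (T k Y - Y) - ((2 ^+ m : R)%:C)%C *: (T k (T k Y) - Y) =
     - (((2 ^+ m : R)%:C)%C *: (T u (T k (T u (T k w - w)) - T u (T k w - w)))).
    have cm v : T u (T k v) = T k (T u v).
      exact: (semigroup_commuting hT v (ltW u0) (ltW k0)).
    have c1 : T u (T u (T k w)) = T k Y by rewrite (cm w) cm.
    have c2 : T u (T k (T u (T k w))) = T k (T k Y) by rewrite (cm (T u _)) c1.
    have c3 : T u (T k (T u w)) = T k Y by rewrite cm.
    have c4 : T u (T k (T u (T k w - w)) - T u (T k w - w)) = T k (T k Y) - T k Y - (T k Y - Y).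
      have lin r v v' : T r (v - v') = T r v - T r v' by exact: linearB.
      by rewrite !lin c2 c3 c1.
    rewrite c4 exprSr realcM -scalerA rmorph_nat -scalerBr -scalerN; congr (_ *: _).
    by rewrite scaler_nat mulr2n !opprB -addrA; congr (_ + _); rewrite addrA subrK.
  rewrite e rnormN rnormZ cabs_real ger0_norm ?exprn_ge0//.
  have Cu : 0 <= C1 * k / u by rewrite divr_ge0 ?mulr_ge0// ltW.
  have kus : 0 < k <= u by rewrite k0.
  have q1 := @hD u k (T u (T k w - w)) kus us0.
  have q2 := ler_wpM2l Cu (@hD u k w kus us0).
  have := ler_wpM2l (exprn_ge0 m (ler0n R 2)) (le_trans q1 q2) => /le_trans; apply.
  have -> : 2 ^+ m * (C1 * k / u * (C1 * k / u * N w)) = (2 ^+ m.+1 * k) * (k / 2) * K.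
    by rewrite /K exprS; field; rewrite gt_eqF.
  rewrite tw2 mul1r mulrC ler_wpM2l// /k /tw exprS.
  rewrite (_ : 2^-1 * _ / 2 = 2^-1 ^+ m * 4^-1); last by field.
  rewrite /m exprD -mulrA ler_piMr ?exprn_ge0 ?invr_ge0//.
  rewrite mulr_ile1 ?exprn_ge0 ?invr_ge0 ?invf_le1 ?ler1n//.
  by rewrite exprn_ile1 ?invr_ge0// invf_le1// ler1n.
have q01 : 0 <= (2^-1 : R) < 1 by apply/andP; split; lra.
pose K' := K / (1 - 2^-1).
have K'0 : 0 <= K' by rewrite divr_ge0//; lra.
have [l hl] := seq_complete (geometric_tail K0 q01 hq)
  (fun d d0 => expr_small (K / (1 - 2^-1)) q01 d0).
exists l => e e0; have [n1 hn1] := expr_small K' q01 e0.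
exists (n1 + n0)%N => n nn.
have nE : (n - n0 + n0)%N = n by rewrite subnK// (leq_trans (leq_addl n1 n0) nn).
have n1n : (n1 <= n - n0)%N by clear -nn; lia.
have h1 : N (l - q (n - n0)%N) <= K' * 2^-1 ^+ (n - n0) by exact: hl.
have h2 : (2^-1 : R) ^+ (n - n0) <= 2^-1 ^+ n1.
  rewrite -(subnK n1n) exprD ler_piMl ?exprn_ge0 ?invr_ge0//.
  by rewrite exprn_ile1 ?invr_ge0// invf_le1// ler1n.
have h3 := le_trans h1 (ler_wpM2l K'0 h2).
by rewrite rnormB -nE; exact: (le_trans h3 (ltW hn1)).
Qed.

Definition orbit_gen n a x : X := iter n (gen T) (T a x).

(** Both parts go in one induction: moving [T v] past the next power needs the generator to exist at
    level [n], and its existence at level [n.+1] follows from that move at a / 2 together with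
    [smooth_gen]. *)
Lemma orbit_gen_shift n u a x : 0 <= u -> 0 < a ->
  orbit_gen n (u + a) x = T u (orbit_gen n a x) /\
  is_gen T (orbit_gen n a x) (orbit_gen n.+1 a x).
Proof.
elim: n u a x => [|n ih] u a x u0 a0.
  split; first by rewrite /orbit_gen /= (semigroupD hT)// ltW.
  by have [l hl] := smooth_gen x a0; exact: is_gen_gen hl.
have e v b : 0 <= v -> 0 < b -> orbit_gen n.+1 (v + b) x = T v (orbit_gen n.+1 b x).
  move=> v0 b0; have [h1 h2] := ih v b x v0 b0.
  by rewrite /= -/(orbit_gen n (v + b) x) h1 (gen_semigroup hT v0 h2).
split; first exact: e.
have a2 : 0 < a / 2 by rewrite divr_gt0.
have [l hl] : exists l, is_gen T (orbit_gen n.+1 a x) l.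
  by rewrite [a]splitr e ?(ltW a2)//; exact: smooth_gen.
exact: is_gen_gen hl.
Qed.

Lemma orbit_gen_is_gen n a x : 0 < a -> is_gen T (orbit_gen n a x) (orbit_gen n.+1 a x).
Proof. by move=> a0; have [] := orbit_gen_shift n x (lexx 0) a0. Qed.

Lemma orbit_genD n u a x : 0 <= u -> 0 < a -> orbit_gen n (u + a) x = T u (orbit_gen n a x).
Proof. by move=> u0 a0; have [] := orbit_gen_shift n x u0 a0. Qed.

Lemma orbit_gen_comp n u a x : 0 <= u -> 0 <= a -> orbit_gen n a (T u x) = orbit_gen n (a + u) x.
Proof. by move=> u0 a0; rewrite /orbit_gen -(semigroupD hT). Qed.

Lemma orbit_gen_linear n a : 0 < a -> linear (orbit_gen n a).
Proof.
move=> a0; elim: n => [|n ih] c x y; first by rewrite /orbit_gen /= linearD linearZ.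
have h1 := orbit_gen_is_gen n x a0; have h2 := orbit_gen_is_gen n y a0.
rewrite /= -!/(orbit_gen n a _) ih.
exact: (genE (is_gen_linear c h1 h2)).
Qed.

Lemma orbit_gen1_bound s x : 0 < s <= s0 -> N (orbit_gen 1 s x) <= C1 / s * N x.
Proof.
move=> /andP[sp ss]; apply/ler_addgt0Pr => e e0.
have [n hn] := orbit_gen_is_gen 0 x sp e0.
have [m hm] := @expr_small R 2^-1 1 s ltac:(lra) sp.
have tws : tw (n + m) <= s.
  rewrite /tw exprD; rewrite mul1r in hm; rewrite (le_trans _ (ltW hm))//.
  rewrite ler_piMl ?exprn_ge0 ?invr_ge0//.
  by rewrite exprn_ile1 ?invr_ge0// invf_le1// ler1n.
have q : N (quotient T (n + m) (T s x)) <= C1 / s * N x.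
  rewrite /quotient rnormZ cabs_real ger0_norm ?exprn_ge0//.
  have -> : T (2^-1 ^+ (n + m)) (T s x) - T s x = T s (T (tw (n + m)) x - x).
    by rewrite [RHS]linearB -!(semigroupD hT) ?(ltW (tw0 _)) ?(ltW sp)// [s + _]addrC.
  have := @hD s (tw (n + m)) x; rewrite tw0 tws => /(_ isT ss).
  move=> /(ler_wpM2l (exprn_ge0 (n + m) (ler0n R 2))) /le_trans; apply.
  have -> : 2 ^+ (n + m) * (C1 * tw (n + m) / s * N x)
    = (2 ^+ (n + m) * tw (n + m)) * (C1 / s * N x) by ring.
  by rewrite tw2 mul1r.
have := hn (n + m)%N (leq_addr _ _); rewrite -/(orbit_gen 0 s x).
have := ler_rnorm_dist (orbit_gen 1 s x) (quotient T (n + m) (T s x)) 0.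
rewrite !subr0 rnormB /orbit_gen /=; lra.
Qed.

(** A^n T(n s) factors as (A T(s))^n. *)
Lemma orbit_gen_bound_mult s n x : 0 < s <= s0 ->
  N (orbit_gen n.+1 (n.+1%:R * s) x) <= (C1 / s) ^+ n.+1 * N x.
Proof.
move=> ss; have /andP[sp _] := ss; elim: n x => [|n ih] x.
  by rewrite mul1r expr1; exact: orbit_gen1_bound.
have -> : orbit_gen n.+2 (n.+2%:R * s) x = orbit_gen n.+1 (n.+1%:R * s) (orbit_gen 1 s x).
  rewrite -[n.+2%:R]natr1 mulrDl mul1r /orbit_gen (semigroupD hT) ?mulr_ge0 ?(ltW sp)//.
  rewrite [LHS]iterSr (gen_semigroup hT _ (orbit_gen_is_gen 0 x sp)) ?mulr_ge0 ?(ltW sp)//.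
rewrite (le_trans (ih _))// [(C1 / s) ^+ n.+2]exprSr -[leRHS]mulrA ler_wpM2l ?orbit_gen1_bound//.
by rewrite exprn_ge0// divr_ge0// ltW.
Qed.

(** If a / n <= s0, time a is cut into n equal steps and [expnn_le] applies. Otherwise n < L / s0,
    so the loss (a / s0)^n from using steps s0 instead is bounded by a constant, which [K]
    absorbs. *)
Lemma orbit_gen_bound (L : R) : exists2 K : R, 1 <= K & forall n a x, 0 < a <= L ->
  N (orbit_gen n a x) <= K * n`!%:R * (4 * C1 / a) ^+ n * N x.
Proof.
have [M M1 hM] := semigroup_bounded hT L; have M0 : 0 <= M by lra.
pose P := Num.max 1 (L / s0); have P1 : 1 <= P by rewrite le_max lexx.
have PL : L / s0 <= P by rewrite le_max lexx orbT.
have P0 : 0 <= P by lra.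
pose m := (Num.truncn P).+1.
have Pm : 1 <= P ^+ m by exact: exprn_ege1.
exists (M * P ^+ m); first by rewrite (le_trans M1)// ler_peMr.
move=> [|n] a x /andP[a0 aL].
  rewrite expr0 mulr1 fact0 mulr1 (le_trans (hM a _ _)) ?(ltW a0)//.
  by rewrite ler_wpM2r ?rnorm_ge0// ler_peMr.
have f1 : 1 <= n.+1`!%:R :> R by rewrite ler1n fact_gt0.
have Ca : 0 <= C1 / a by rewrite divr_ge0// ltW.
have -> : (4 * C1 / a) ^+ n.+1 = 4 ^+ n.+1 * (C1 / a) ^+ n.+1 by rewrite -exprMn mulrA.
have MP : 1 <= M * P ^+ m by rewrite (le_trans M1)// ler_peMr.
have nr : 0 < n.+1%:R :> R by rewrite ltr0n.
have [h|h] := leP (a / n.+1%:R) s0.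
  have ss : 0 < a / n.+1%:R <= s0 by rewrite divr_gt0.
  have := orbit_gen_bound_mult n x ss; rewrite mulrC divfK ?gt_eqF// => /le_trans; apply.
  rewrite ler_wpM2r ?rnorm_ge0//.
  have -> : C1 / (a / n.+1%:R) = n.+1%:R * (C1 / a) by field; rewrite !gt_eqF.
  rewrite exprMn mulrA ler_wpM2r ?exprn_ge0//.
  apply: (@le_trans _ _ (n.+1`!%:R * 4 ^+ n.+1)).
    by rewrite -natrX -natrX -natrM ler_nat mulnC expnn_le.
  by rewrite ler_wpM2r ?exprn_ge0// ler_peMl// ler0n.
have ns : n.+1%:R * s0 < a by rewrite mulrC -ltr_pdivlMr.
have ss : 0 < s0 <= s0 by rewrite s00 lexx.
rewrite -[X in orbit_gen _ X](subrK (n.+1%:R * s0)) orbit_genD ?subr_ge0 ?(ltW ns) ?mulr_gt0//.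
have cond : 0 <= a - n.+1%:R * s0 <= L.
  by rewrite subr_ge0 (ltW ns)/= (le_trans _ aL)// gerBl mulr_ge0// ltW.
rewrite (le_trans (hM _ cond _))//.
rewrite (le_trans (ler_wpM2l M0 (orbit_gen_bound_mult n x ss)))// [leLHS]mulrA ler_wpM2r ?rnorm_ge0//.
have -> : C1 / s0 = C1 / a * (a / s0) by field; rewrite !gt_eqF.
have as1 : 1 <= a / s0.
  rewrite ler_pdivlMr// mul1r (le_trans _ (ltW ns))// ler_peMl ?(ltW s00)// ler1n//.
have q1 : (a / s0) ^+ n.+1 <= P ^+ m.
  apply: (@le_trans _ _ (P ^+ n.+1)).
    apply: lerXn2r; rewrite ?nnegrE//; first lra.
    by rewrite (le_trans _ PL)// ler_wpM2r// invr_ge0 ltW.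
  apply: ler_weXn2l => //; rewrite /m ltnS -ltnS -(ltr_nat R).
  apply: lt_trans (truncnS_gt P); rewrite (lt_le_trans _ PL)// ltr_pdivlMr//.
  by rewrite (le_lt_trans _ (lt_le_trans ns aL))// ler_wpM2r ?(ltW s00)// ler_nat.
rewrite exprMn; set u := (C1 / a) ^+ n.+1.
have u0 : 0 <= u by exact: exprn_ge0.
apply: (@le_trans _ _ (M * u * P ^+ m)).
  by rewrite [leLHS]mulrA ler_wpM2l// mulr_ge0.
have -> : M * P ^+ m * n.+1`!%:R * (4 ^+ n.+1 * u) = M * u * P ^+ m * (n.+1`!%:R * 4 ^+ n.+1).
  by ring.
rewrite ler_peMr ?mulr_ge0 ?exprn_ge0//.
by rewrite mulr_ege1// exprn_ege1// ler1n.
Qed.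

(** For b < a the semigroup runs from b to a, so the expansion is made at b and the derivative is
    then moved to a by [taylor1]; hence the factor 2. *)
Lemma orbit_gen_taylor (L M K a0 : R) n a b x : 0 < a0 -> a0 <= a <= L -> a0 <= b <= L ->
  1 <= M -> 0 <= K -> (forall t, 0 <= t <= L -> bd (T t) M) ->
  (forall n a x, 0 < a <= L -> N (orbit_gen n a x) <= K * n`!%:R * (4 * C1 / a) ^+ n * N x) ->
  N (orbit_gen n b x - orbit_gen n a x - (((b - a) : R)%:C)%C *: orbit_gen n.+1 a x) <=
    2 * M ^+ 2 * (b - a) ^+ 2 * (K * n.+2`!%:R * (4 * C1 / a0) ^+ n.+2 * N x).
Proof.
move=> a00 /andP[a1 a2] /andP[b1 b2] M1 K0 hM hK; have M0 : 0 <= M by lra.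
have bound c : a0 <= c <= L -> N (orbit_gen n.+2 c x) <= K * n.+2`!%:R * (4 * C1 / a0) ^+ n.+2 * N x.
  move=> /andP[c1 c2]; have c0 : 0 < c by exact: lt_le_trans c1.
  have cL : 0 < c <= L by rewrite c0.
  rewrite (le_trans (hK _ _ _ cL))// ler_wpM2r ?rnorm_ge0// ler_wpM2l ?mulr_ge0//.
  apply: lerXn2r; rewrite ?nnegrE ?divr_ge0 ?mulr_ge0 ?(ltW c0) ?(ltW a00)//.
  rewrite ler_wpM2l ?mulr_ge0//.
  by rewrite lef_pV2// posrE.
have ap : 0 < a by exact: lt_le_trans a1.
have bp : 0 < b by exact: lt_le_trans b1.
set W := K * _ * _ * N x in bound *.
have [ab|/ltW ba] := leP a b.
  have h0 : 0 <= b - a <= L by rewrite subr_ge0 ab/=; lra.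
  have -> : orbit_gen n b x = T (b - a) (orbit_gen n a x).
    by rewrite -orbit_genD ?subr_ge0// subrK.
  have := taylor2 hT h0 M0 hM (orbit_gen_is_gen n x ap) (orbit_gen_is_gen n.+1 x ap).
  move=> /le_trans; apply.
  have := bound a; rewrite a1 a2 => /(_ isT) => q.
  have c0 : 0 <= (b - a) ^+ 2 * M ^+ 2 by rewrite mulr_ge0 ?sqr_ge0.
  have := ler_wpM2l c0 q; have := ler_wpM2l c0 (le_trans (rnorm_ge0 _) q); lra.
have h0 : 0 <= a - b <= L by rewrite subr_ge0 ba/=; lra.
have e m : orbit_gen m a x = T (a - b) (orbit_gen m b x).
  by rewrite -orbit_genD ?subr_ge0// subrK.
have -> : orbit_gen n b x - orbit_gen n a x - (((b - a) : R)%:C)%C *: orbit_gen n.+1 a x =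
   (((a - b) : R)%:C)%C *: (T (a - b) (orbit_gen n.+1 b x) - orbit_gen n.+1 b x)
   - (T (a - b) (orbit_gen n b x) - orbit_gen n b x - (((a - b) : R)%:C)%C *: orbit_gen n.+1 b x).
  rewrite -!e -[b - a]opprB [((- (a - b))%:C)%C]rmorphN/= scaleNr opprK scalerBr.
  by rewrite !opprB addrA subrK addrC.
have t2 := taylor2 hT h0 M0 hM (orbit_gen_is_gen n x bp) (orbit_gen_is_gen n.+1 x bp).
have t1 := taylor1 hT h0 M0 hM (orbit_gen_is_gen n.+1 x bp).
apply: (le_trans (ler_rnormB _ _)); rewrite rnormZ cabs_real ger0_norm ?subr_ge0//.
have q : N (orbit_gen n.+2 b x) <= W by apply: bound; rewrite b1.
have c0 : 0 <= (a - b) ^+ 2 * M ^+ 2 by rewrite mulr_ge0 ?sqr_ge0.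
have r1 := ler_wpM2l c0 q.
have ab0 : 0 <= a - b by rewrite subr_ge0.
have r2 : (a - b) * N (T (a - b) (orbit_gen n.+1 b x) - orbit_gen n.+1 b x) <=
    (a - b) ^+ 2 * M ^+ 2 * W.
  apply: (le_trans (ler_wpM2l ab0 t1)); apply: le_trans r1.
  have -> : (a - b) * ((a - b) * M * N (orbit_gen n.+2 b x)) =
     (a - b) ^+ 2 * (M * N (orbit_gen n.+2 b x)) by ring.
  rewrite -[leRHS]mulrA ler_wpM2l ?sqr_ge0// ler_wpM2r ?rnorm_ge0// expr2 ler_peMl//.
have -> : 2 * M ^+ 2 * (b - a) ^+ 2 * W = (a - b) ^+ 2 * M ^+ 2 * W + (a - b) ^+ 2 * M ^+ 2 * W by ring.
by rewrite lerD// (le_trans t2).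
Qed.

End Powers.

(** * Extension to a sector *)

Section PowerDifferences.
Context {R : realType}.
Local Notation C := R[i].
Implicit Types (p q : C).

(** Multiplying through by [b], and by its square in [cabs_exprB2], avoids lowered exponents on the
    right and includes small [n]. *)
Lemma cabs_exprB p q (b : R) n : 0 < b -> cabs p <= b -> cabs q <= b ->
  cabs (p ^+ n - q ^+ n) * b <= n%:R * b ^+ n * cabs (p - q).
Proof.
move=> b0 pb qb; have c0 := cabs_ge0 (p - q); elim: n => [|n ih].
  by rewrite !expr0 subrr cabs0 !mul0r.
have -> : p ^+ n.+1 - q ^+ n.+1 = p * (p ^+ n - q ^+ n) + (p - q) * q ^+ n by rewrite !exprS; ring.
have h1 : cabs (p * (p ^+ n - q ^+ n)) * b <= b * (n%:R * b ^+ n * cabs (p - q)).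
  by rewrite cabsM -mulrA ler_pM ?mulr_ge0 ?cabs_ge0 ?(ltW b0).
have h2 : cabs ((p - q) * q ^+ n) * b <= cabs (p - q) * b ^+ n * b.
  rewrite cabsM cabsX ler_wpM2r ?(ltW b0)// ler_wpM2l//.
  by apply: lerXn2r; rewrite ?nnegrE ?cabs_ge0 ?(ltW b0).
have h3 := ler_wpM2r (ltW b0) (ler_cabsD (p * (p ^+ n - q ^+ n)) ((p - q) * q ^+ n)).
rewrite [leRHS]mulrDl in h3; apply: (le_trans h3); apply: (le_trans (lerD h1 h2)).
by apply: eq_ler; rewrite -natr1 exprS; ring.
Qed.

Lemma cabs_exprB2 p q (b : R) n : 0 < b -> cabs p <= b -> cabs q <= b ->
  cabs (p ^+ n - q ^+ n - n%:R * q ^+ n.-1 * (p - q)) * b ^+ 2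
    <= n%:R ^+ 2 * b ^+ n * cabs (p - q) ^+ 2.
Proof.
move=> b0 pb qb; have c0 := cabs_ge0 (p - q); elim: n => [|n ih].
  by rewrite !expr0 !mul0r subr0 subrr cabs0 expr0n/= !mul0r.
set Y := p ^+ n - q ^+ n - n%:R * q ^+ n.-1 * (p - q) in ih *.
have nq : n%:R * q ^+ n = n%:R * q ^+ n.-1 * q.
  by case: n {ih Y} => [|n]; rewrite ?mul0r//= exprSr mulrA.
have -> : p ^+ n.+1 - q ^+ n.+1 - n.+1%:R * q ^+ n.+1.-1 * (p - q)
   = p * Y + n%:R * q ^+ n.-1 * (p - q) ^+ 2.
  rewrite /= -natr1 mulrDl nq mul1r /Y !exprS; ring.
have h1 : cabs (p * Y) * b ^+ 2 <= b * (n%:R ^+ 2 * b ^+ n * cabs (p - q) ^+ 2).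
  by rewrite cabsM -mulrA ler_pM ?mulr_ge0 ?cabs_ge0 ?sqr_ge0 ?(ltW b0).
have h2 : cabs (n%:R * q ^+ n.-1 * (p - q) ^+ 2) * b ^+ 2 <= n%:R * b ^+ n.+1 * cabs (p - q) ^+ 2.
  case: n {ih Y nq h1} => [|n]; first by rewrite !mul0r cabs0 !mul0r.
  have -> : cabs (n.+1%:R * q ^+ n.+1.-1 * (p - q) ^+ 2) = n.+1%:R * cabs q ^+ n * cabs (p - q) ^+ 2.
    by rewrite cabsM [cabs (n.+1%:R * _)]cabsM cabs_nat !cabsX.
  have -> : n.+1%:R * b ^+ n.+2 * cabs (p - q) ^+ 2 = n.+1%:R * b ^+ n * cabs (p - q) ^+ 2 * b ^+ 2.
    by rewrite !exprS expr0; ring.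
  rewrite ler_wpM2r ?sqr_ge0// ler_wpM2r ?sqr_ge0// ler_wpM2l//.
  by apply: lerXn2r; rewrite ?nnegrE ?cabs_ge0 ?(ltW b0).
have h3 := ler_wpM2r (sqr_ge0 b) (ler_cabsD (p * Y) (n%:R * q ^+ n.-1 * (p - q) ^+ 2)).
rewrite [leRHS]mulrDl in h3; apply: (le_trans h3); apply: (le_trans (lerD h1 h2)).
have -> : b * (n%:R ^+ 2 * b ^+ n * cabs (p - q) ^+ 2) + n%:R * b ^+ n.+1 * cabs (p - q) ^+ 2
  = (n%:R ^+ 2 + n%:R) * (b ^+ n.+1 * cabs (p - q) ^+ 2) by rewrite (exprS b n); ring.
rewrite -[leRHS]mulrA ler_wpM2r ?mulr_ge0 ?sqr_ge0 ?exprn_ge0 ?(ltW b0)//.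
by rewrite -[n.+1%:R]natr1; have := ler0n R n; lra.
Qed.

Lemma half_sum_le n : \sum_(k < n) (2^-1 : R) ^+ k <= 2.
Proof.
suff -> : \sum_(k < n) (2^-1 : R) ^+ k = 2 - 2 * 2^-1 ^+ n.
  by rewrite gerBl mulr_ge0// exprn_ge0// invr_ge0.
elim: n => [|n ih]; first by rewrite big_ord0 expr0; ring.
by rewrite big_ord_recr/= ih exprS; field.
Qed.

Lemma natr_le_exp2 n : n.+1%:R <= 2 ^+ n :> R.
Proof. by rewrite -natrX ler_nat ltn_expl. Qed.

End PowerDifferences.

Section OperatorSeries.
Context {R : realType} {X : completeNormedModType R[i]}.
Local Notation N := (@rnorm R X).

Lemma operator_series (u : nat -> X -> X) (K r : R) : 0 <= K -> 0 <= r < 1 ->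
  (forall n, linear (u n)) -> (forall n x, N (u n x) <= K * r ^+ n * N x) ->
  exists h : {linear X -> X}, forall x n,
    N (h x - \sum_(k < n) u k x) <= K / (1 - r) * r ^+ n * N x.
Proof.
move=> K0 /[dup] r01 /andP[r0 r1] ul uK; have r10 : 0 < 1 - r by rewrite subr_gt0.
have hs x : exists l, forall n, N (l - \sum_(k < n) u k x) <= K * N x / (1 - r) * r ^+ n.
  apply: seq_complete => [|d d0]; last exact: expr_small.
  apply: geometric_tail => //; first by rewrite mulr_ge0// rnorm_ge0.
  by move=> n; rewrite big_ord_recr/= addrAC subrr add0r mulrAC.
have [h hh] := choice hs.
have {}hh x n : N (h x - \sum_(k < n) u k x) <= K / (1 - r) * r ^+ n * N x.
  rewrite (le_trans (hh x n))//; apply: eq_ler; field; exact: lt0r_neq0.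
have hl : linear h.
  move=> c x y; apply: rnorm_le0_eq => e e0.
  pose A := N (c *: x + y) + cabs c * N x + N y.
  have [n hn] := expr_small (K / (1 - r) * A) r01 e0.
  have s1 := hh (c *: x + y) n; have s2 := hh x n; have s3 := hh y n.
  have -> : h (c *: x + y) - (c *: h x + h y) =
    (h (c *: x + y) - \sum_(k < n) u k (c *: x + y)) -
    (c *: (h x - \sum_(k < n) u k x) + (h y - \sum_(k < n) u k y)).
    have -> : \sum_(k < n) u k (c *: x + y) = c *: (\sum_(k < n) u k x) + \sum_(k < n) u k y.
      by rewrite scaler_sumr -big_split/=; apply: eq_bigr => k _; rewrite ul.
    by rewrite scalerBr addrACA -opprD opprB addrA subrK.
  apply: le_trans (ltW hn); apply: (le_trans (ler_rnormB _ _)).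
  have s4 := ler_rnormD (c *: (h x - \sum_(k < n) u k x)) (h y - \sum_(k < n) u k y).
  rewrite rnormZ in s4; have s5 := ler_wpM2l (cabs_ge0 c) s2.
  apply: (le_trans (lerD s1 (le_trans s4 (lerD s5 s3)))).
  by apply: eq_ler; rewrite /A; ring.
pose h1 : {linear X -> X} := HB.pack h (GRing.isLinear.Build _ _ _ _ _ hl).
by exists h1.
Qed.

End OperatorSeries.

Section Extension.
Context {R : realType} {X : completeNormedModType R[i]} (T : R -> {linear X -> X}).
Context (hT : strongly_continuous_semigroup T).
Context (s0 C1 : R) (s00 : 0 < s0) (C11 : 1 <= C1).
Local Notation C := R[i].
Local Notation N := (@rnorm R X).
Context (hD : forall s h (x : X), 0 < h <= s -> s <= s0 -> N (T s (T h x - x)) <= C1 * h / s * N x).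
Implicit Types (x y : X) (z h : C).

Let Q : R := 4 * C1.
Let Q0 : 0 < Q. Proof. by rewrite mulr_gt0// (lt_le_trans _ C11). Qed.

Let coef (b : R) n : C := ('i%C * (b%:C)%C) ^+ n / n`!%:R.

Let cabs_ib (b : R) : cabs ('i%C * (b%:C)%C : C) = `|b|.
Proof.
rewrite cabsM cabs_real (_ : cabs 'i%C = 1) ?mul1r//.
by rewrite cabs_sqrt/= expr0n add0r expr1n sqrtr1.
Qed.

Let cabs_coef b n : cabs (coef b n) = `|b| ^+ n / n`!%:R.
Proof. by rewrite cabsM cabsX cabs_ib cabsV cabs_nat. Qed.

(** Terms of the Taylor series of T in the imaginary direction for [m = 0], and of its derivative,
    with the generator applied once more, for [m = 1]. *)
Let ext_term m z n x : X := coef (complex.Im z) n *: orbit_gen T (n + m) (complex.Re z) x.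

(** On this cone the Taylor ratio is at most 1/8, not merely below 1: the derivative brings a factor
    n + 1 <= 2^n, which must leave a geometric series. *)
Let dom : set C := [set z | 0 < complex.Re z /\ 8 * Q * `|complex.Im z| <= complex.Re z].

Let ext_term_linear m z n : 0 < complex.Re z -> linear (ext_term m z n).
Proof.
move=> z0 c x y; rewrite /ext_term (orbit_gen_linear hT s00 C11 hD _ z0).
by rewrite scalerDr !scalerA mulrC.
Qed.

Let fact_gt n : 0 < n`!%:R :> R. Proof. by rewrite ltr0n fact_gt0. Qed.

Let dom_ratio z : dom z -> 0 <= Q * `|complex.Im z| / complex.Re z <= 8^-1.
Proof.
move=> [z0 zQ]; apply/andP; split; last by rewrite ler_pdivrMr//; lra.
by apply: divr_ge0 (ltW z0); apply: mulr_ge0 (ltW Q0) _.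
Qed.

Let ext_term0_bound (L K : R) z n x : dom z -> complex.Re z <= L -> 0 <= K ->
  (forall n a x, 0 < a <= L -> N (orbit_gen T n a x) <= K * n`!%:R * (4 * C1 / a) ^+ n * N x) ->
  N (ext_term 0 z n x) <= K * 8^-1 ^+ n * N x.
Proof.
move=> dz zL K0 hK; have [z0 _] := dz; have /andP[q0 q1] := dom_ratio dz.
rewrite /ext_term addn0 rnormZ cabs_coef -/Q in hK *.
have zz : 0 < complex.Re z <= L by rewrite z0.
apply: (le_trans (ler_wpM2l _ (hK n _ x zz))).
  by rewrite divr_ge0 ?exprn_ge0// ltW.
have -> : `|complex.Im z| ^+ n / n`!%:R * (K * n`!%:R * (Q / complex.Re z) ^+ n * N x)
   = K * (Q * `|complex.Im z| / complex.Re z) ^+ n * N x.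
  rewrite !exprMn; set u := _ ^-1 ^+ n; field; exact: lt0r_neq0.
rewrite ler_wpM2r ?rnorm_ge0// ler_wpM2l//.
by apply: lerXn2r; rewrite ?nnegrE ?invr_ge0.
Qed.

Let ext_term1_bound (L K : R) z n x : dom z -> complex.Re z <= L -> 0 <= K ->
  (forall n a x, 0 < a <= L -> N (orbit_gen T n a x) <= K * n`!%:R * (4 * C1 / a) ^+ n * N x) ->
  N (ext_term 1 z n x) <= K * (Q / complex.Re z) * 4^-1 ^+ n * N x.
Proof.
move=> dz zL K0 hK; have [z0 _] := dz; have /andP[q0 q1] := dom_ratio dz.
rewrite /ext_term addn1 rnormZ cabs_coef -/Q in hK *.
have zz : 0 < complex.Re z <= L by rewrite z0.
apply: (le_trans (ler_wpM2l _ (hK n.+1 _ x zz))).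
  by rewrite divr_ge0 ?exprn_ge0// ltW.
have -> : `|complex.Im z| ^+ n / n`!%:R * (K * n.+1`!%:R * (Q / complex.Re z) ^+ n.+1 * N x)
   = K * (Q / complex.Re z) * (n.+1%:R * (Q * `|complex.Im z| / complex.Re z) ^+ n) * N x.
  rewrite factS natrM exprS !exprMn; set u := _ ^-1 ^+ n; set v := n.+1%:R; set w := (complex.Re z)^-1.
  by field; exact: lt0r_neq0.
have QK : 0 <= K * (Q / complex.Re z) by rewrite mulr_ge0// divr_ge0 ?(ltW Q0)// ltW.
rewrite ler_wpM2r ?rnorm_ge0// ler_wpM2l//.
apply: (@le_trans _ _ (2 ^+ n * 8^-1 ^+ n)).
  apply: ler_pM; rewrite ?exprn_ge0// ?natr_le_exp2//.
  by apply: lerXn2r; rewrite ?nnegrE ?invr_ge0.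
by rewrite -exprMn; apply: eq_ler; congr (_ ^+ n); field.
Qed.

Let ext_exists (m : nat) z : (m <= 1)%N -> exists h : {linear X -> X}, dom z ->
  exists2 K : R, 0 <= K & forall x n, N (h x - \sum_(k < n) ext_term m z k x) <= K * 4^-1 ^+ n * N x.
Proof.
(* Off the cone the zero map is the default, so that [choice] gives a function on the whole
   plane. *)
move=> m1; have [dz|dz] := pselect (dom z); last by exists \0.
have [K K1 hK] := orbit_gen_bound hT s00 C11 hD (complex.Re z).
have K0 : 0 <= K by rewrite (le_trans ler01).
have q01 : 0 <= (4^-1 : R) < 1 by apply/andP; split; lra.
have [z0 _] := dz.
pose K' := K * (1 + Q / complex.Re z).
have Qz : 0 <= Q / complex.Re z by rewrite divr_ge0 ?(ltW Q0)// ltW.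
have K'0 : 0 <= K' by rewrite mulr_ge0// addr_ge0.
have hu n x : N (ext_term m z n x) <= K' * 4^-1 ^+ n * N x.
  case: m m1 => [|[|//]] _.
    apply: (le_trans (ext_term0_bound n x dz (lexx _) K0 hK)).
    rewrite ler_wpM2r ?rnorm_ge0//; apply: ler_pM; rewrite ?exprn_ge0 ?invr_ge0//.
      by rewrite ler_peMr// lerDl.
    by apply: lerXn2r; rewrite ?nnegrE ?invr_ge0//; lra.
  apply: (le_trans (ext_term1_bound n x dz (lexx _) K0 hK)).
  rewrite ler_wpM2r ?rnorm_ge0// ler_wpM2r ?exprn_ge0 ?invr_ge0// ler_wpM2l//.
  by rewrite lerDr.
have [h hh] := operator_series K'0 q01 (fun n => ext_term_linear m n z0) hu.
exists h => _; exists (K' / (1 - 4^-1)) => //.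
by rewrite divr_ge0//; lra.
Qed.

Let extends (H : C -> {linear X -> X}) := forall z, dom z -> exists2 K : R, 0 <= K &
  forall x n, N (H z x - \sum_(k < n) ext_term 0 z k x) <= K * 4^-1 ^+ n * N x.

Let extension_exists : exists H : C -> {linear X -> X}, extends H.
Proof. by have [H hH] := choice (fun z => @ext_exists 0 z isT); exists H. Qed.

Let quarter_limit (s : nat -> X) (l : X) (A B : R) :
  (forall n, N (l - s n) <= A * 4^-1 ^+ n) -> (forall n, N (s n) <= B) -> N l <= B.
Proof.
move=> h1 h2; apply/ler_addgt0Pr => e e0.
have q01 : 0 <= (4^-1 : R) < 1 by apply/andP; split; lra.
have [n hn] := expr_small A q01 e0.
have := h1 n; have := h2 n; have := ler_rnormD (l - s n) (s n); rewrite subrK; lra.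
Qed.

Let extension_bounded (H : C -> {linear X -> X}) (L : R) : extends H ->
  exists2 K : R, 0 <= K & forall z, dom z -> complex.Re z <= L -> bd (H z) K.
Proof.
move=> hH; have [K K1 hK] := orbit_gen_bound hT s00 C11 hD L.
have K0 : 0 <= K by rewrite (le_trans ler01).
exists (2 * K) => [|z dz zL x]; first by rewrite mulr_ge0.
have [A _ hA] := hH z dz.
apply: (@quarter_limit (fun n => \sum_(k < n) ext_term 0 z k x) _ (A * N x)) => n.
  by rewrite mulrAC.
rewrite (le_trans (rnorm_sum _ _ _))//.
apply: (@le_trans _ _ (\sum_(k < n) K * N x * 2^-1 ^+ k)).
  apply: ler_sum => k _; rewrite (le_trans (ext_term0_bound k x dz zL K0 hK))// mulrAC.
  rewrite ler_wpM2l ?mulr_ge0 ?rnorm_ge0//.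
  by apply: lerXn2r; rewrite ?nnegrE ?invr_ge0//; lra.
rewrite -mulr_sumr; have -> : 2 * K * N x = K * N x * 2 by ring.
by rewrite ler_wpM2l ?half_sum_le// mulr_ge0// rnorm_ge0.
Qed.

Let extension_real (H : C -> {linear X -> X}) (t : R) x : extends H -> 0 < t ->
  H ((t%:C)%C) x = T t x.
Proof.
move=> hH t0; have dt : dom ((t%:C)%C) by split => //=; rewrite normr0 mulr0 ltW.
have [A A0 hA] := hH _ dt; apply: rnorm_le0_eq => e e0.
have q01 : 0 <= (4^-1 : R) < 1 by apply/andP; split; lra.
have [n hn] := expr_small (A * N x) q01 e0.
have := hA x n.+1; rewrite big_ord_recl/= big1 => [|k _]; last first.
  by rewrite /ext_term /coef /= rmorph0 mulr0 expr0n/= mul0r scale0r.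
rewrite addr0 /ext_term /coef expr0 fact0 mulr1n invr1 mulr1 scale1r addn0 /orbit_gen /=.
move=> /le_trans; apply; apply: le_trans (ltW hn).
have AN : 0 <= A * N x by rewrite mulr_ge0 ?rnorm_ge0.
rewrite [leLHS]mulrAC ler_wpM2l// exprS ler_piMl ?exprn_ge0 ?invr_ge0//; lra.
Qed.

(** The n-th term of H(z + h) - H(z) minus its linear part, split into a second-order remainder in
    the real part, a product of two first-order increments, and a second-order remainder of the
    power of the imaginary part. Each is at most a multiple of eta^2 (n + 1)^2 8^-n, and (n + 1)^2
    <= 4^n. *)
Let remainder_term (L M K a b a' b' beta eta : R) n x : 0 < a -> a <= L -> 0 < a' -> a / 2 <= a' <= L ->
  1 <= M -> 0 <= K -> (forall t, 0 <= t <= L -> bd (T t) M) ->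
  (forall n a x, 0 < a <= L -> N (orbit_gen T n a x) <= K * n`!%:R * (4 * C1 / a) ^+ n * N x) ->
  0 < beta -> 16 * Q * beta = a -> `|b| <= beta -> `|b'| <= beta ->
  `|a' - a| <= eta -> `|b' - b| <= eta ->
  N (coef b' n *: orbit_gen T n a' x - coef b n *: orbit_gen T n a x
     - (((a' - a) : R)%:C)%C *: (coef b n *: orbit_gen T n.+1 a x)
     - (n%:R * ('i%C * (b%:C)%C) ^+ n.-1 * ('i%C * (((b' - b) : R)%:C)%C) / n`!%:R) *: orbit_gen T n a x)
  <= 2 * M ^+ 2 * K / beta ^+ 2 * eta ^+ 2 * N x * 2^-1 ^+ n.
Proof.
move=> a0 aL a'0 /andP[a'1 a'2] M1 K0 hM hK be0 bea bb bb' ha hb.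
set E := orbit_gen T n a x; set E' := orbit_gen T n a' x; set E1 := orbit_gen T n.+1 a x.
set h1 := (((a' - a) : R)%:C)%C; set p := 'i%C * (b'%:C)%C; set q := 'i%C * (b%:C)%C.
have pq : 'i%C * (((b' - b) : R)%:C)%C = p - q by rewrite realcB mulrBr.
have e0 : 0 <= eta by rewrite (le_trans _ ha).
have f0 := fact_gt n.
have cp : cabs p <= beta by rewrite cabs_ib.
have cq : cabs q <= beta by rewrite cabs_ib.
have cpq : cabs (p - q) <= eta by rewrite -pq cabs_ib.
have ch1 : cabs h1 <= eta by rewrite cabs_real.
have a20 : 0 < a / 2 by rewrite divr_gt0.
rewrite pq; have -> : coef b' n *: E' - coef b n *: E - h1 *: (coef b n *: E1)
     - (n%:R * q ^+ n.-1 * (p - q) / n`!%:R) *: E =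
   (p ^+ n / n`!%:R) *: (E' - E - h1 *: E1) + ((p ^+ n - q ^+ n) / n`!%:R * h1) *: E1
   + ((p ^+ n - q ^+ n - n%:R * q ^+ n.-1 * (p - q)) / n`!%:R) *: E.
  rewrite -[coef b' n]/(p ^+ n / n`!%:R) -[coef b n]/(q ^+ n / n`!%:R).
  set u := p ^+ n / _; have -> : (p ^+ n - q ^+ n) / n`!%:R = u - q ^+ n / n`!%:R by rewrite mulrBl.
  rewrite [(_ - _ - _) / _]mulrBl mulrBl -/u; set v := q ^+ n / _; set w := _ / _.
  rewrite !scalerBr !scalerA mulrBl !scalerBl.
  rewrite [u * h1]mulrC [v * h1]mulrC.
  by rewrite [RHS](AC (3*2*3) (1*7*5*8*(2*6)*(3*4)))/= addNr addr0 addNr addr0.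
pose W : R := eta ^+ 2 * K * N x / beta ^+ 2 * 8^-1 ^+ n.
have W0 : 0 <= W.
  by rewrite !mulr_ge0 ?invr_ge0 ?sqr_ge0 ?rnorm_ge0 ?exprn_ge0 ?invr_ge0.
have kap : 4 * C1 / (a / 2) = 8^-1 / beta.
  rewrite -bea -/Q; field; rewrite !gt_eqF//.
have kap0 : 0 <= 8^-1 / beta by rewrite divr_ge0 ?invr_ge0// ltW.
have Eb m : N (orbit_gen T m a x) <= K * m`!%:R * (8^-1 / beta) ^+ m * N x.
  have aa : 0 < a <= L by rewrite a0.
  rewrite (le_trans (hK m a x aa))// ler_wpM2r ?rnorm_ge0// ler_wpM2l ?mulr_ge0//.
  rewrite -kap; apply: lerXn2r; rewrite ?nnegrE ?divr_ge0 ?(ltW a0) ?(ltW a20) ?(ltW Q0)//.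
  by rewrite ler_wpM2l ?(ltW Q0)// lef_pV2 ?posrE//; lra.
have nn1 : n.+1%:R = n%:R + 1 :> R by rewrite -natr1.
have nn2 : n.+2%:R = n%:R + 2 :> R by rewrite -natr1 nn1 -addrA.
have n0 := ler0n R n.
have B1 : N ((p ^+ n / n`!%:R) *: (E' - E - h1 *: E1)) <= W * (2 * M ^+ 2 * ((n%:R + 1) * (n%:R + 2)) / 64).
  have aa1 : a / 2 <= a <= L by apply/andP; split => //; lra.
  have aa2 : a / 2 <= a' <= L by rewrite a'1.
  have := orbit_gen_taylor hT s00 C11 hD n x a20 aa1 aa2 M1 K0 hM hK.
  rewrite kap -/E -/E' -/E1 -/h1 => hE.
  rewrite rnormZ cabsM cabsX cabsV cabs_nat.
  have c1 : cabs p ^+ n / n`!%:R <= beta ^+ n / n`!%:R.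
    rewrite ler_wpM2r ?invr_ge0 ?(ltW f0)//.
    by apply: lerXn2r; rewrite ?nnegrE ?cabs_ge0 ?(ltW be0).
  have c2 : (a' - a) ^+ 2 <= eta ^+ 2.
    by rewrite -real_normK ?num_real//; apply: lerXn2r; rewrite ?nnegrE.
  have G0 : 0 <= K * n.+2`!%:R * (8^-1 / beta) ^+ n.+2 * N x.
    by apply: mulr_ge0 (rnorm_ge0 x); apply: mulr_ge0 (exprn_ge0 _ kap0); apply: mulr_ge0.
  have M20 : 0 <= 2 * M ^+ 2 by rewrite mulr_ge0 ?sqr_ge0.
  have c3 := le_trans hE (ler_wpM2r G0 (ler_wpM2l M20 c2)).
  apply: (le_trans (ler_pM _ _ c1 c3)); rewrite ?rnorm_ge0//.
    by rewrite divr_ge0 ?exprn_ge0 ?cabs_ge0// ltW.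
  apply: eq_ler; rewrite /W !factS !natrM nn1 nn2 !exprMn !exprS !exprVn.
  set bn := beta ^+ n; set en := 8 ^+ n.
  by field; rewrite !gt_eqF ?exprn_gt0.
have B2 : N (((p ^+ n - q ^+ n) / n`!%:R * h1) *: E1) <= W * (n%:R * (n%:R + 1) / 8).
  rewrite rnormZ 2!cabsM cabsV cabs_nat.
  have c1 : cabs (p ^+ n - q ^+ n) <= n%:R * beta ^+ n * eta / beta.
    rewrite ler_pdivlMr// (le_trans (cabs_exprB n be0 cp cq))// ler_wpM2l//.
    by rewrite mulr_ge0// exprn_ge0// ltW.
  have c2 : cabs (p ^+ n - q ^+ n) / n`!%:R * cabs h1 <= n%:R * beta ^+ n * eta / beta / n`!%:R * eta.
    apply: ler_pM; rewrite ?cabs_ge0 ?divr_ge0 ?cabs_ge0 ?(ltW f0)//.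
    by rewrite ler_wpM2r// invr_ge0 ltW.
  apply: (le_trans (ler_pM _ _ c2 (Eb n.+1))); rewrite ?rnorm_ge0//.
    by rewrite mulr_ge0 ?cabs_ge0// divr_ge0 ?cabs_ge0// ltW.
  apply: eq_ler; rewrite /W !factS !natrM nn1 !exprMn !exprS !exprVn.
  set bn := beta ^+ n; set en := 8 ^+ n.
  by field; rewrite !gt_eqF ?exprn_gt0.
have B3 : N (((p ^+ n - q ^+ n - n%:R * q ^+ n.-1 * (p - q)) / n`!%:R) *: E) <= W * n%:R ^+ 2.
  rewrite rnormZ cabsM cabsV cabs_nat.
  have c1 : cabs (p ^+ n - q ^+ n - n%:R * q ^+ n.-1 * (p - q))
      <= n%:R ^+ 2 * beta ^+ n * eta ^+ 2 / beta ^+ 2.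
    rewrite ler_pdivlMr ?exprn_gt0// (le_trans (cabs_exprB2 n be0 cp cq))// ler_wpM2l//.
      by rewrite mulr_ge0 ?sqr_ge0// exprn_ge0// ltW.
    by apply: lerXn2r; rewrite ?nnegrE ?cabs_ge0.
  apply: (le_trans (ler_pM _ _ (ler_wpM2r _ c1) (Eb n))); rewrite ?rnorm_ge0 ?invr_ge0 ?(ltW f0)//.
    by rewrite divr_ge0 ?cabs_ge0// ltW.
  apply: eq_ler; rewrite /W !exprMn !exprVn; set bn := beta ^+ n; set en := 8 ^+ n.
  by field; rewrite !gt_eqF ?exprn_gt0.
apply: (le_trans (ler_rnormD _ _)); apply: (le_trans (lerD (le_trans (ler_rnormD _ _) (lerD B1 B2)) B3)).
have M2 : 1 <= M ^+ 2 by exact: exprn_ege1.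
rewrite -!mulrDr.
apply: (@le_trans _ _ (W * (2 * M ^+ 2 * (n.+1%:R * n.+1%:R)))).
  rewrite ler_wpM2l// nn1.
  have u0 : 0 <= n%:R ^+ 2 :> R by exact: sqr_ge0.
  have P2 : 0 <= (M ^+ 2 - 1) * (n%:R + 1) ^+ 2 by rewrite mulr_ge0 ?sqr_ge0// subr_ge0.
  have P3 : 0 <= M ^+ 2 * n%:R by rewrite mulr_ge0 ?sqr_ge0.
  have P4 : 0 <= M ^+ 2 * n%:R ^+ 2 by rewrite mulr_ge0 ?sqr_ge0.
  nra.
have n4 : n.+1%:R * n.+1%:R <= 4 ^+ n :> R.
  have -> : 4 ^+ n = 2 ^+ n * 2 ^+ n :> R by rewrite -exprMn; congr (_ ^+ _); ring.
  by rewrite ler_pM ?natr_le_exp2.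
apply: (@le_trans _ _ (W * (2 * M ^+ 2 * 4 ^+ n))).
  by rewrite ler_wpM2l// ler_wpM2l// mulr_ge0 ?sqr_ge0.
apply: eq_ler; rewrite /W (_ : 8^-1 ^+ n = 2^-1 ^+ n * 4^-1 ^+ n); last first.
  by rewrite -exprMn; congr (_ ^+ n); field.
by rewrite exprVn exprVn; set u := 4 ^+ n; set v := 2 ^+ n; field; rewrite !gt_eqF ?exprn_gt0.
Qed.

Let extension_derivative (H : C -> {linear X -> X}) z : extends H ->
  0 < complex.Re z -> 16 * Q * `|complex.Im z| < complex.Re z ->
  exists (D : {linear X -> X}) (K r : R), [/\ continuous D, 0 <= K, 0 < r &
    forall h, cabs h < r -> forall x,
      N (H (z + h) x - H z x - h *: D x) <= K * cabs h ^+ 2 * N x].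
Proof.
move=> hH z0 zQ; set a := complex.Re z in z0 zQ *; set b := complex.Im z in zQ *.
have dz : dom z by split => //; rewrite -/a -/b; have := mulr_ge0 (ltW Q0) (normr_ge0 b); lra.
have [D /(_ dz)[KD KD0 hKD]] := @ext_exists 1 z isT.
pose L := 2 * a.
have [M M1 hM] := semigroup_bounded hT L.
have [K K1 hK] := orbit_gen_bound hT s00 C11 hD L.
have K0 : 0 <= K by rewrite (le_trans ler01).
(* Twice the 8 of [dom], because the real part may drop to a / 2 near [z]. *)
pose beta := a / (16 * Q).
have Q16 : 0 < 16 * Q by rewrite mulr_gt0.
have be0 : 0 < beta by rewrite divr_gt0.
have bea : 16 * Q * beta = a by rewrite /beta mulrC divfK// gt_eqF.
have bb : `|b| < beta by rewrite ltr_pdivlMr// mulrC.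
exists D, (2 * (2 * M ^+ 2 * K / beta ^+ 2)), (Num.min (a / 2) (beta - `|b|)); split.
- apply: (@bd_continuous _ _ _ KD) => x; have := hKD x 0%N.
  by rewrite big_ord0 subr0 expr0 mulr1.
- by rewrite mulr_ge0// divr_ge0 ?sqr_ge0// mulr_ge0// mulr_ge0 ?sqr_ge0.
- by rewrite lt_min divr_gt0//= subr_gt0.
move=> h; rewrite lt_min => /andP[ha hb] x.
pose a' := complex.Re (z + h); pose b' := complex.Im (z + h).
have a'E : a' - a = complex.Re h by rewrite /a' /a; case: (z) (h) => [? ?] [? ?] /=; ring.
have b'E : b' - b = complex.Im h by rewrite /b' /b; case: (z) (h) => [? ?] [? ?] /=; ring.
have hE : h = (((a' - a) : R)%:C)%C + 'i%C * (((b' - b) : R)%:C)%C.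
  by rewrite a'E b'E -complexE.
have ah : `|a' - a| <= cabs h by rewrite a'E ler_Re_cabs.
have bh : `|b' - b| <= cabs h by rewrite b'E ler_Im_cabs.
have a'1 : a / 2 <= a' <= L by move: ah; rewrite ler_norml /L; lra.
have a'0 : 0 < a' by have := divr_gt0 z0 (ltr0n R 2); lra.
have bb' : `|b'| <= beta.
  have := ler_normD b (b' - b); rewrite addrC subrK; lra.
have dzh : dom (z + h).
  split; first exact: a'0.
  have := ler_wpM2l (ltW Q0) bb'; rewrite -/a' -/b'; lra.
have [A A0 hA] := hH _ dz; have [A' A'0 hA'] := hH _ dzh.
set c := 2 * M ^+ 2 * K / beta ^+ 2.
have c0 : 0 <= c by rewrite divr_ge0 ?sqr_ge0// mulr_ge0// mulr_ge0 ?sqr_ge0.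
pose t := ext_term 0; pose s := ext_term 1.
(* The imaginary derivative of the term k + 1 is i times the term k of [D], which is the
   Cauchy-Riemann equation; hence the last sum has one term fewer. *)
pose F n := \sum_(k < n.+1) t (z + h) k x - \sum_(k < n.+1) t z k x
  - ((((a' - a) : R)%:C)%C *: (\sum_(k < n.+1) s z k x)
     + ('i%C * (((b' - b) : R)%:C)%C) *: (\sum_(k < n) s z k x)).
apply: (@quarter_limit F _ ((A' + A + (`|a' - a| + `|b' - b|) * KD) * N x)) => n.
  have h1 := hA' x n.+1; have h2 := hA x n.+1; have h3 := hKD x n.+1; have h4 := hKD x n.
  have q n' : (4^-1 : R) ^+ n'.+1 <= 4^-1 ^+ n'.
    by rewrite exprS ler_piMl ?exprn_ge0 ?invr_ge0//; lra.
  have Nx := rnorm_ge0 x.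
  have up (B : R) : 0 <= B -> B * 4^-1 ^+ n.+1 * N x <= B * 4^-1 ^+ n * N x.
    by move=> B0; rewrite ler_wpM2r// ler_wpM2l.
  have -> : H (z + h) x - H z x - h *: D x - F n =
    (H (z + h) x - \sum_(k < n.+1) t (z + h) k x) + - (H z x - \sum_(k < n.+1) t z k x)
    + - ((((a' - a) : R)%:C)%C *: (D x - \sum_(k < n.+1) s z k x))
    + - (('i%C * (((b' - b) : R)%:C)%C) *: (D x - \sum_(k < n) s z k x)).
    rewrite {2}hE scalerDl /F !scalerBr.
    set p := _ *: D x; set q' := _ *: D x; set S1 := _ *: _; set S2 := _ *: _.
    set T1 := \sum_(k < _) _; set T2 := \sum_(k < _) _.
    rewrite !opprD !opprK.
    by rewrite [LHS](AC (2*2*(2*2)) (1*5*(2*6)*(3*7)*(4*8))).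
  have -> : (A' + A + (`|a' - a| + `|b' - b|) * KD) * N x * 4^-1 ^+ n =
     A' * 4^-1 ^+ n * N x + A * 4^-1 ^+ n * N x + `|a' - a| * (KD * 4^-1 ^+ n * N x)
     + `|b' - b| * (KD * 4^-1 ^+ n * N x) by ring.
  apply: ler_rnorm4; rewrite ?rnormN.
  - exact: le_trans h1 (up _ A'0).
  - exact: le_trans h2 (up _ A0).
  - by rewrite rnormZ cabs_real ler_wpM2l// (le_trans h3)// up.
  - by rewrite rnormZ cabs_ib ler_wpM2l.
have -> : F n = \sum_(k < n.+1) (coef b' k *: orbit_gen T k a' x - coef b k *: orbit_gen T k a x
     - (((a' - a) : R)%:C)%C *: (coef b k *: orbit_gen T k.+1 a x)
     - (k%:R * ('i%C * (b%:C)%C) ^+ k.-1 * ('i%C * (((b' - b) : R)%:C)%C) / k`!%:R) *: orbit_gen T k a x).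
  rewrite !sumrB /F opprD addrA; congr (_ - _ - _ - _).
  - by apply: eq_bigr => k _; rewrite /t /ext_term addn0.
  - by apply: eq_bigr => k _; rewrite /t /ext_term addn0.
  - by rewrite scaler_sumr; apply: eq_bigr => k _; rewrite /s /ext_term addn1.
  rewrite [RHS]big_ord_recl/= !mul0r scale0r add0r scaler_sumr; apply: eq_bigr => k _.
  rewrite /s /ext_term addn1 scalerA /bump/= add1n -/a -/b; congr (_ *: _).
  rewrite /coef factS natrM; have k0 : (k.+1%:R : C) != 0 by rewrite pnatr_eq0.
  have f0 : (k`!%:R : C) != 0 by rewrite pnatr_eq0 -lt0n fact_gt0.
  have cf (p y v f : C) : v != 0 -> f != 0 -> y * (p / f) = v * p * y / (v * f).
    by move=> v0 f1; field; rewrite f1 v0.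
  exact: cf k0 f0.
apply: (le_trans (rnorm_sum _ _ _)).
apply: (@le_trans _ _ (\sum_(k < n.+1) c * cabs h ^+ 2 * N x * 2^-1 ^+ k)).
  apply: ler_sum => k _; apply: (@remainder_term L M K a b a' b' beta (cabs h)) => //.
  - by rewrite /L; lra.
  - exact: ltW.
rewrite -mulr_sumr; have -> : 2 * c * cabs h ^+ 2 * N x = c * cabs h ^+ 2 * N x * 2 by ring.
by rewrite ler_wpM2l ?half_sum_le// mulr_ge0 ?rnorm_ge0// mulr_ge0 ?sqr_ge0.
Qed.

(** On a vector T(u) x the generator powers are taken at time u instead of Re z, so the series is
    controlled by |Im z| / u and does not degenerate as Re z tends to 0. *)
Let extension_smooth (H : C -> {linear X -> X}) (u : R) x : extends H -> 0 < u <= 1 ->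
  exists2 K : R, 0 <= K & forall z, dom z -> complex.Re z <= 1 ->
    `|complex.Im z| * (2 * Q) <= u -> N (H z (T u x) - T (complex.Re z) (T u x)) <= K * `|complex.Im z|.
Proof.
move=> hH /andP[u0 u1].
have [M M1 hM] := semigroup_bounded hT 1.
have [K K1 hK] := orbit_gen_bound hT s00 C11 hD 1.
have K0 : 0 <= K by rewrite (le_trans ler01).
have M0 : 0 <= M by rewrite (le_trans ler01).
have Nx := rnorm_ge0 x.
exists (M * K * N x * 2 * (Q / u)).
  by rewrite mulr_ge0 ?divr_ge0 ?(ltW Q0) ?(ltW u0)// !mulr_ge0.
move=> z dz z1 zu; set a := complex.Re z in z1 *; set b := complex.Im z in zu *.
have z0 : 0 < a by case: dz.
pose th := `|b| * (Q / u).
have th0 : 0 <= th by rewrite mulr_ge0// divr_ge0 ?(ltW Q0)// ltW.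
have th2 : th <= 2^-1.
  by rewrite /th mulrA ler_pdivrMr//; lra.
have [A A0 hA] := hH z dz.
have tb k : N (ext_term 0 z k (T u x)) <= M * K * N x * th ^+ k.
  rewrite /ext_term addn0 -/a -/b rnormZ cabs_coef.
  rewrite (orbit_gen_comp hT k x (ltW u0) (ltW z0)) (orbit_genD hT s00 C11 hD k x (ltW z0) u0).
  have ca : 0 <= a <= 1 by rewrite (ltW z0).
  have cu : 0 < u <= 1 by rewrite u0.
  have := le_trans (hM a ca (orbit_gen T k u x)) (ler_wpM2l M0 (hK k u x cu)) => hk.
  have bk : 0 <= `|b| ^+ k / k`!%:R by rewrite divr_ge0 ?exprn_ge0// ltW.
  apply: (le_trans (ler_wpM2l bk hk)); apply: eq_ler; rewrite /th -/Q !exprMn.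
  by set v := _^-1 ^+ k; set w := Q ^+ k; field; exact: lt0r_neq0.
have -> : M * K * N x * 2 * (Q / u) * `|b| = M * K * N x * th * 2 by rewrite /th; ring.
apply: (@quarter_limit (fun n => \sum_(k < n.+1) ext_term 0 z k (T u x) - T a (T u x)) _
  (A * N (T u x))) => n.
  have -> : H z (T u x) - T a (T u x) - (\sum_(k < n.+1) ext_term 0 z k (T u x) - T a (T u x))
    = H z (T u x) - \sum_(k < n.+1) ext_term 0 z k (T u x) by rewrite opprB addrA subrK.
  rewrite (le_trans (hA _ _))// mulrAC ler_wpM2l ?mulr_ge0 ?rnorm_ge0//.
  by rewrite exprS ler_piMl ?exprn_ge0 ?invr_ge0//; lra.
rewrite big_ord_recl/= {1}/ext_term {1}/coef expr0 fact0 mulr1n invr1 mulr1 scale1r addn0.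
rewrite /orbit_gen /= -/a addrAC subrr add0r.
have W0 : 0 <= M * K * N x * th by apply: mulr_ge0 th0; rewrite !mulr_ge0.
apply: (le_trans (rnorm_sum _ _ _)).
apply: (@le_trans _ _ (\sum_(k < n) M * K * N x * th * 2^-1 ^+ k)).
  apply: ler_sum => k _; rewrite (le_trans (tb _))// /bump/= add1n exprS mulrA.
  rewrite ler_wpM2l//.
  by apply: lerXn2r; rewrite ?nnegrE ?invr_ge0.
by rewrite -mulr_sumr ler_wpM2l ?half_sum_le.
Qed.

(** As |sin th| < delta <= 1/2, the cosine is at least 1/2, while 16 Q |sin th| is below 1/4. *)
Let sector_dom (delta : R) z : delta <= 2^-1 -> 64 * Q * delta <= 1 -> sector delta z ->
  [/\ 0 < complex.Re z, 16 * Q * `|complex.Im z| < complex.Re z & dom z].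
Proof.
move=> d2 dQ [r [th [r0 hth ->]]].
suff [h1 h2] : 0 < r * cos th /\ 16 * Q * `|r * sin th| < r * cos th.
  split => //; split => //=; have := mulr_ge0 (ltW Q0) (normr_ge0 (r * sin th)); lra.
have sth := le_lt_trans (sin_le th) hth.
have p1 := pihalf_ge1 R.
have c0 : 0 < cos th by apply: cos_gt0_pihalf; move: hth; rewrite ltr_norml; lra.
have c1 : 2^-1 <= cos th.
  have s1 : sin th ^+ 2 <= 4^-1.
    rewrite -real_normK ?num_real// (_ : 4^-1 = 2^-1 ^+ 2); last by field.
    by apply: lerXn2r; rewrite ?nnegrE ?invr_ge0//; lra.
  have := cos2Dsin2 th => h; rewrite leNgt; apply/negP => ch.
  have : cos th ^+ 2 < 4^-1.
    rewrite (_ : 4^-1 = 2^-1 ^+ 2); last by field.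
    by rewrite ltrXn2r// ?nnegrE ?invr_ge0// ltW.
  lra.
split; first by rewrite mulr_gt0.
rewrite normrM (gtr0_norm r0) mulrCA ltr_pM2l//.
have := ltr_pM2l Q0 `|sin th| delta; rewrite sth; lra.
Qed.

Let extension_differentiable (H : C -> {linear X -> X}) z : extends H ->
  0 < complex.Re z -> 16 * Q * `|complex.Im z| < complex.Re z ->
  exists D : {linear X -> X}, continuous D /\
    opnorm (fun x => h^-1 *: (H (z + h) x - H z x) - D x) @[h --> (0 : C^o)^'] --> 0%E.
Proof.
move=> hH z0 zQ; have [D [K [r [cD K0 r0 hD']]]] := extension_derivative hH z0 zQ.
exists D; split => //; have n0 h : h != 0 -> 0 < cabs h by rewrite cabs_gt0.
have op h : h != 0 -> cabs h < r ->
    (opnorm (fun x => h^-1 *: (H (z + h) x - H z x) - D x)%R <= (K * cabs h)%:E)%E.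
  move=> h0 hr; apply: ge_ereal_sup => _ [x x1 <-]; rewrite lee_fin.
  have -> : h^-1 *: (H (z + h) x - H z x) - D x = h^-1 *: (H (z + h) x - H z x - h *: D x).
    by rewrite [RHS]scalerBr scalerA mulVf// scale1r.
  have {}x1 : N x <= 1 by move: x1; rewrite /= rnormE lecR.
  rewrite rnormZ cabsV mulrC ler_pdivrMr ?n0// (le_trans (hD' h hr x))// -[leRHS]mulrA -expr2.
  by rewrite ler_piMr// mulr_ge0 ?sqr_ge0.
apply: (@squeeze_cvge _ _ _ _ (fun=> 0%E) _ (fun h => (K * cabs h)%:E)).
- apply: (cabs_nbhs r0) => h; rewrite subr0 => hr h0; rewrite op// andbT.
  have n1 : N (0 : X) <= 1 by rewrite rnorm0.
  by apply: le_trans (opnorm_ge _ n1); rewrite lee_fin rnorm_ge0.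
- exact: cvg_cst.
apply: cvg_EFin; first by near=> h.
apply/cvgrPdist_lt => e e0; have K1 : 0 < K + 1 by rewrite ltr_wpDl.
apply: (cabs_nbhs (divr_gt0 e0 K1)) => h; rewrite subr0 ltr_pdivlMr// => he _ /=.
rewrite sub0r normrN ger0_norm ?mulr_ge0 ?cabs_ge0//; have := cabs_ge0 h; lra.
Unshelve. all: by end_near.
Qed.

(** Approximation of x by T(u) x, where [extension_smooth] compares H z with T (Re z); the error is
    carried along by the uniform bound on H z near 0. *)
Let extension_continuous0 (H : C -> {linear X -> X}) (A : set C) x : extends H ->
  A `<=` dom -> H z x @[z --> within A (nbhs (0 : C^o))] --> x.
Proof.
move=> hH AD; apply/cvg_rnormP => e e0.
have [B B0 hB] := extension_bounded 1 hH.
have eB : 0 < e / (4 * (B + 1)) by rewrite divr_gt0// mulr_gt0// ltr_wpDl.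
have [r r0 hr] := right_continuous0 hT x eB.
pose u := Num.min (r / 2) 1.
have u01 : 0 < u <= 1 by rewrite /u lt_min ge_min lexx orbT divr_gt0// ltr01.
have [u0 u1] := andP u01.
have ur : u < r by rewrite (le_lt_trans (_ : _ <= r / 2)) ?ge_min ?lexx//; lra.
set y := T u x.
have yx : N (y - x) < e / (4 * (B + 1)) by apply: hr; rewrite (ltW u0).
have [K K0 hK] := extension_smooth x hH u01.
have e4 : 0 < e / 4 by rewrite divr_gt0.
have [r' r'0 hr'] := right_continuous0 hT y e4.
pose rho := Num.min (Num.min r' 1) (Num.min (u / (2 * Q)) (e / (4 * (K + 1)))).
have K10 : 0 < 4 * (K + 1) by rewrite mulr_gt0// ltr_wpDl.
have Q2 : 0 < 2 * Q by rewrite mulr_gt0.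
have rho0 : 0 < rho.
  by rewrite !lt_min r'0 ltr01 (divr_gt0 e0 K10) divr_gt0.
apply: (cabs_nbhs rho0) => z; rewrite subr0 => zr Az.
have dz := AD _ Az; have z0 : 0 < complex.Re z by case: dz.
have Rz : complex.Re z < rho by rewrite (le_lt_trans _ zr)// (le_trans (ler_norm _))// ler_Re_cabs.
have Iz : `|complex.Im z| < rho by rewrite (le_lt_trans _ zr)// ler_Im_cabs.
have [q1 q2 q3 q4] : [/\ rho <= r', rho <= 1, rho <= u / (2 * Q) & rho <= e / (4 * (K + 1))].
  by rewrite /rho; split; rewrite !ge_min lexx ?orbT.
have Rz1 : complex.Re z <= 1 by lra.
rewrite rnormB.
have -> : H z x - x = H z (x - y) + (H z y - T (complex.Re z) y) + (T (complex.Re z) y - y) + (y - x).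
  by rewrite linearB/= !addrA !subrK.
have t1 : N (H z (x - y)) < e / 4.
  apply: (le_lt_trans (hB z dz Rz1 _)); rewrite rnormB.
  apply: (@le_lt_trans _ _ ((B + 1) * N (y - x))).
    by rewrite ler_wpM2r ?rnorm_ge0// lerDl.
  move: yx; rewrite !ltr_pdivlMr ?mulr_gt0// ?ltr_wpDl//; lra.
have t2 : N (H z y - T (complex.Re z) y) < e / 4.
  apply: (le_lt_trans (hK z dz Rz1 _)).
    by rewrite -ler_pdivlMr//; exact: le_trans (ltW Iz) q3.
  apply: (@le_lt_trans _ _ ((K + 1) * `|complex.Im z|)).
    by rewrite ler_wpM2r// lerDl.
  have := lt_le_trans Iz q4; rewrite !ltr_pdivlMr//; lra.
have t3 : N (T (complex.Re z) y - y) < e / 4 by apply: hr'; rewrite (ltW z0)/=; lra.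
have t4 : N (y - x) < e / 4.
  apply: (lt_le_trans yx); rewrite ler_wpM2l ?(ltW e0)// lef_pV2 ?posrE ?mulr_gt0// ?ltr_wpDl//; lra.
have := ler_rnormD (H z (x - y) + (H z y - T (complex.Re z) y) + (T (complex.Re z) y - y)) (y - x).
have := ler_rnormD (H z (x - y) + (H z y - T (complex.Re z) y)) (T (complex.Re z) y - y).
have := ler_rnormD (H z (x - y)) (H z y - T (complex.Re z) y).
lra.
Qed.

Lemma difference_bound_holomorphic : holomorphic_semigroup T.
Proof.
have [H hH] := extension_exists.
have Q64 : 0 < 64 * Q by rewrite mulr_gt0.
pose delta := Num.min 2^-1 (64 * Q)^-1.
have d0 : 0 < delta by rewrite lt_min !invr_gt0 Q64 ltr0n.
have d2 : delta <= 2^-1 by rewrite ge_min lexx.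
have dQ : 64 * Q * delta <= 1.
  by rewrite mulrC -ler_pdivlMr// div1r ge_min lexx orbT.
exists delta, H; split.
- by rewrite d0/=; have := pihalf_ge1 R; lra.
- move=> z /(sector_dom d2 dQ)[z0 zQ dz]; split; last exact: extension_differentiable.
  have [B B0 hB] := extension_bounded (complex.Re z) hH.
  by apply: (@bd_continuous _ _ _ B); apply: hB.
- by move=> t x; exact: extension_real.
move=> d' x /andP[_ dd]; apply: extension_continuous0 => // z zd.
have [//|_ _ //] := sector_dom (le_trans (ltW dd) d2) _ zd.
by apply: le_trans dQ; rewrite ler_pM2l// ltW.
Qed.

End Extension.

Theorem corollary2p4 (R : realType) (X : completeNormedModType R[i])
    (T : R -> {linear X -> X}) (hT : strongly_continuous_semigroup T) :
  holomorphic_semigroup T <->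
  exists f : {poly R[i]},
    (limf_esup (fun t : R => opnorm (poly_op f (T t))) (0 : R)^'+
       < disk_norm f)%E.
Proof.
split; first exact: holomorphic_semigroup_limsup.
move=> [f hf]; have [s0 s00 [C1 C10 hD]] := limsup_difference_bound hT hf.
apply: (difference_bound_holomorphic hT s00 (C1 := C1 + 1)); first by rewrite lerDr.
move=> s h x hs ss0; apply: le_trans (hD s h x hs ss0) _.
have [h0 hs'] := andP hs; have s_gt0 := lt_le_trans h0 hs'.
rewrite ler_wpM2r ?rnorm_ge0// ler_wpM2r ?invr_ge0 ?(ltW s_gt0)//.
by rewrite ler_wpM2r ?(ltW h0)// lerDl.
Qed.
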